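(* The space $\exp_3 S^1$, with fibres the orbits of the natural $S^1$ action $\lambda\cdot\Lambda=\{\lambda\mu : \mu\in\Lambda\}$, is a Seifert fibred $3$-manifold. As such, with its canonical orientation inherited from $S^1$, it is oriented fibre preserving diffeomorphic to $S^3\subset\mathbb{C}^2$ with the $(2,-3)$ $S^1$ action $$\lambda\cdot(z_1,z_2)=(\lambda^2 z_1,\lambda^{-3}z_2),\qquad \lambda\in S^1\subset\mathbb{C},\ (z_1,z_2)\in S^3,$$ where $S^3$ is Seifert fibred by the orbits of this action.
   Context: $S^1$ is the unit circle in $\mathbb{C}$. For a topological space $X$ and $k\geq 1$, $\exp_k X$ is the set of nonempty subsets of $X$ of cardinality at most $k$, with the quotient topology from the map $X^k\to\exp_k X$, $(x_1,\ldots,x_k)\mapsto\{x_1\}\cup\cdots\cup\{x_k\}$. Canonical orientation of $\exp_3 S^1$: fix an orientation of $S^1$. For a set $\Lambda=\{\lambda,\mu,\nu\}$ of three distinct points of $S^1$, orient $T_\Lambda\exp_3 S^1\cong T_\lambda S^1\oplus T_\mu S^1\oplus T_\nu S^1$ by positively orienting each summand and requiring that the cyclic ordering of $\lambda,\mu,\nu$ agree with the orientation of $S^1$. This extends to an orientation of all of $\exp_3 S^1$. Orientation of $S^3$: $S^3$ is oriented as the boundary of the unit ball in $\mathbb{C}^2$ (with its canonical complex orientation) using the ''outward normal first'' convention. ''Oriented fibre preserving diffeomorphic'' means that there is an orientation preserving diffeomorphism carrying fibres (orbits) to fibres (orbits). *)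

(* Defs.v *)
From HB Require Import structures.
From mathcomp Require Import all_boot all_order all_algebra.
From mathcomp Require Import all_classical all_reals all_analysis.
From mathcomp Require Import complex.

Set Implicit Arguments.
Unset Strict Implicit.
Unset Printing Implicit Defensive.

Import Order.TTheory GRing.Theory Num.Theory numFieldNormedType.Exports.

Local Open Scope classical_set_scope.
Local Open Scope card_scope.
Local Open Scope ring_scope.

Definition exp (k : nat) (X : Type) : Type :=
  set_type [set A : set X | A !=set0 /\ A #<= `I_k].

HB.instance Definition _ k X := Choice.on (exp k X).

Lemma expP (k : nat) (X : Type) (L : exp k X) :
  set_val L !=set0 /\ set_val L #<= `I_k.
Proof. exact: set_valP L. Qed.

Definition mkexp (k : nat) (X : Type) (A : set X)
    (hA : A !=set0 /\ A #<= `I_k) : exp k X :=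
  SigSub (mem_set hA : A \in [set A : set X | A !=set0 /\ A #<= `I_k]).

Lemma span_subproof (k : nat) (X : Type) (x : 'I_k.+1 -> X) :
  range x !=set0 /\ range x #<= `I_k.+1.
Proof.
split; first by exists (x ord0); exists ord0.
apply: (card_le_trans (card_image_le x _)).
by have := @card_II k.+1; rewrite card_eq_le => /andP[].
Qed.

Definition span (k : nat) (X : Type) (x : 'I_k.+1 -> X) : exp k.+1 X :=
  mkexp (span_subproof x).

(** The quotient topology from [span]: X^(k+1) -> exp_(k+1) X. *)
Section exp_topology.
Variables (k : nat) (X : topologicalType).

Definition exp_open (U : set (exp k.+1 X)) : Prop :=
  open ((@span k X) @^-1` U : set (prod_topology (fun _ : 'I_k.+1 => X))).

Let exp_openT : exp_open setT.
Proof. by rewrite /exp_open preimage_setT; exact: openT. Qed.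

Let exp_openI (A B : set (exp k.+1 X)) :
  exp_open A -> exp_open B -> exp_open (A `&` B).
Proof. by move=> oA oB; rewrite /exp_open preimage_setI; exact: openI. Qed.

Let exp_open_bigU (I : Type) (f : I -> set (exp k.+1 X)) :
  (forall i, exp_open (f i)) -> exp_open (\bigcup_i f i).
Proof.
by move=> of_; rewrite /exp_open preimage_bigcup; apply: bigcup_open => i _;
  exact: of_.
Qed.

HB.instance Definition _ := isOpenTopological.Build (exp k.+1 X)
  exp_openT exp_openI exp_open_bigU.

End exp_topology.

(** C^k on an open set [U]: [f] is continuous on [U] and all its directional
    derivatives exist and are C^(k-1) there. *)
Fixpoint Ck_on (R : realType) (m n k : nat) (U : set 'rV[R]_m)
    (f : 'rV[R]_m -> 'rV[R]_n) : Prop :=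
  (forall p, U p -> {for p, continuous f}) /\
  if k is k'.+1 then
    forall v, (forall p, U p -> derivable f p v) /\ Ck_on k' U ('D_v f)
  else True.

Definition smooth_on (R : realType) (m n : nat) (U : set 'rV[R]_m)
    (f : 'rV[R]_m -> 'rV[R]_n) : Prop := forall k, Ck_on k U f.

Definition pos_jacobian_on (R : realType) (n : nat) (U : set 'rV[R]_n)
    (f : 'rV[R]_n -> 'rV[R]_n) : Prop := forall p, U p -> 0 < \det ('J f p).

(** The functions [to_coord] and [of_coord] are total but only meaningful on
    [chart_dom] and on [chart_img] respectively. *)
Record chart (R : realType) (n : nat) (M : topologicalType) := Chart {
  chart_dom : set M ;
  to_coord : M -> 'rV[R]_n ;
  of_coord : 'rV[R]_n -> M }.

Section manifolds.
Variables (R : realType) (n : nat).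

Definition chart_img (M : topologicalType) (c : chart R n M) :=
  to_coord c @` chart_dom c.

Definition is_chart (M : topologicalType) (c : chart R n M) : Prop :=
  [/\ open (chart_dom c), open (chart_img c),
      forall x, chart_dom c x -> of_coord c (to_coord c x) = x,
      forall x, chart_dom c x -> {for x, continuous (to_coord c)} &
      forall p, chart_img c p -> {for p, continuous (of_coord c)}].

Definition local_dom (M N : topologicalType) (c : chart R n M)
    (d : chart R n N) (f : M -> N) : set 'rV[R]_n :=
  [set p | chart_img c p /\ chart_dom d (f (of_coord c p))].

Definition local_expr (M N : topologicalType) (c : chart R n M)
    (d : chart R n N) (f : M -> N) : 'rV[R]_n -> 'rV[R]_n :=
  to_coord d \o f \o of_coord c.

Definition oriented_atlas (M : topologicalType) (A : set (chart R n M)) :=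
  [/\ forall c, A c -> is_chart c,
      forall x, exists2 c, A c & chart_dom c x &
      forall c d, A c -> A d ->
        smooth_on (local_dom c d id) (local_expr c d id) /\
        pos_jacobian_on (local_dom c d id) (local_expr c d id)].

Definition oriented_manifold (M : topologicalType) (A : set (chart R n M)) :=
  [/\ hausdorff_space M, @second_countable M & oriented_atlas A].

Definition smooth_map (M N : topologicalType) (A : set (chart R n M))
    (B : set (chart R n N)) (f : M -> N) : Prop :=
  continuous f /\
  forall c d, A c -> B d -> smooth_on (local_dom c d f) (local_expr c d f).

Definition orientation_preserving (M N : topologicalType)
    (A : set (chart R n M)) (B : set (chart R n N)) (f : M -> N) : Prop :=
  forall c d, A c -> B d ->
    pos_jacobian_on (local_dom c d f) (local_expr c d f).

Definition diffeomorphism (M N : topologicalType) (A : set (chart R n M))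
    (B : set (chart R n N)) (f : M -> N) : Prop :=
  exists g : N -> M,
    [/\ cancel f g, cancel g f, smooth_map A B f & smooth_map B A g].

End manifolds.

Section seifert.
Variable R : realType.

Definition disc_coord (p : 'rV[R]_3) : R[i] :=
  (p ord0 0 +i* p ord0 1)%C.

Definition height (p : 'rV[R]_3) : R := p ord0 2.

Definition cis (t : R) : R[i] := (cos t +i* sin t)%C.

(** D^2 x R, where D^2 is the open unit disc, inside C x R = R^3. *)
Definition open_cylinder : set 'rV[R]_3 :=
  [set p | p ord0 0 ^+ 2 + p ord0 1 ^+ 2 < 1].

(** [Phi] exhibits its image as a fibred solid torus of type (a, b). The model
    is the mapping torus of the rotation of D^2 through 2 pi b / a, that is the
    quotient of D^2 x R by the Z-action generated by
    (w, t) |-> (e^(2 pi i b / a) w, t + 1), fibred by the images of the lines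
    {w} x R. [Phi] is the composite of the quotient map with a fibre preserving
    diffeomorphism from the model onto an open subset of [M]. *)
Definition fibred_solid_torus (M : topologicalType) (A : set (chart R 3 M))
    (fib : set (set M)) (a b : nat) (Phi : 'rV[R]_3 -> M) : Prop :=
  [/\ (forall p, open_cylinder p -> {for p, continuous Phi}) /\
        open (Phi @` open_cylinder),
      forall c, A c ->
        let V := [set p | open_cylinder p /\ chart_dom c (Phi p)] in
        smooth_on V (to_coord c \o Phi) /\
        forall p, V p -> \det ('J (to_coord c \o Phi) p) != 0,
      forall p p', open_cylinder p -> open_cylinder p' ->
        (Phi p = Phi p' <->
         exists m : int,
           disc_coord p' =
             cis (2 * pi * m%:~R * b%:R / a%:R) * disc_coord p /\
           height p' = height p + m%:~R) &
      forall p, open_cylinder p ->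
        fib (Phi @` [set p' | disc_coord p' = disc_coord p])].

Definition seifert_fibred (M : topologicalType) (A : set (chart R 3 M))
    (fib : set (set M)) : Prop :=
  [/\ oriented_manifold A,
      partition fib id [set: M] &
      forall F, fib F -> exists a b : nat, exists Phi : 'rV[R]_3 -> M,
        [/\ (0 < a)%N, coprime a b, fibred_solid_torus A fib a b Phi &
            F `<=` Phi @` open_cylinder]].

End seifert.

Definition orbits (G M : Type) (act : G -> M -> M) : set (set M) :=
  [set [set act g x | g in [set: G]] | x in [set: M]].

Section circle.
Variable R : realType.

(** [R[i]^o] is [R[i]] with its norm topology. *)
Definition S1 : topologicalType := set_type [set z : R[i]^o | `|z| = 1].

Lemma S1P (z : S1) : `|set_val z : R[i]| = 1.
Proof. exact: set_valP z. Qed.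

Definition mkS1 (z : R[i]) (hz : `|z| = 1) : S1 :=
  SigSub (mem_set hz : (z : R[i]^o) \in [set z : R[i]^o | `|z| = 1]).

Lemma S1mul_subproof (l m : S1) :
  `|(set_val l : R[i]) * (set_val m : R[i])| = 1.
Proof. by rewrite normrM !S1P mulr1. Qed.

Definition S1mul (l m : S1) : S1 := mkS1 (S1mul_subproof l m).

Lemma expS1_act_subproof (k : nat) (l : S1) (L : exp k S1) :
  S1mul l @` set_val L !=set0 /\ S1mul l @` set_val L #<= `I_k.
Proof.
have [[x Lx] Lk] := expP L; split; first by exists (S1mul l x); exists x.
exact: card_le_trans (card_image_le _ _) Lk.
Qed.

Definition expS1_act (k : nat) (l : S1) (L : exp k S1) : exp k S1 :=
  mkexp (expS1_act_subproof l L).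

Lemma S1_cis_subproof (t : R) : `|cis t| = 1.
Proof. by rewrite normc_def /= cos2Dsin2 sqrtr1. Qed.

Definition S1_cis (t : R) : S1 := mkS1 (S1_cis_subproof t).

(** The two orientations of S^1 are indexed by [eps : bool], the positive
    direction being that of t |-> e^(it) for [false] and of t |-> e^(-it) for
    [true]. *)
Definition S1_param (eps : bool) (t : R) : S1 := S1_cis ((-1) ^+ eps * t).

(** If s < t < u < s + 2 pi then the cyclic order of the points with parameters
    s, t, u agrees with the chosen orientation of S^1; every ordered triple of
    distinct points whose cyclic order does so arises in this way. *)
Definition cyclic_triples : set 'rV[R]_3 :=
  [set p | [/\ p ord0 0 < p ord0 1, p ord0 1 < p ord0 2 &
               p ord0 2 < p ord0 0 + 2 * pi]].

Definition triple_param (eps : bool) (p : 'rV[R]_3) : exp 3 S1 :=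
  span (fun j : 'I_3 => S1_param eps (p ord0 j)).

(** On the open set of three-point subsets the oriented smooth structure [A] is
    the one for which T_L exp_3 S^1 is the oriented direct sum of the lines
    tangent to S^1 at the points of L, positively oriented and taken in cyclic
    order: [triple_param] is an orientation preserving local diffeomorphism. *)
Definition canonical_on_triples (eps : bool) (A : set (chart R 3 (exp 3 S1))) :=
  forall c, A c ->
    let V := cyclic_triples `&` [set p | chart_dom c (triple_param eps p)] in
    smooth_on V (to_coord c \o triple_param eps) /\
    pos_jacobian_on V (to_coord c \o triple_param eps).

End circle.

Section sphere.
Variable R : realType.

Definition S3 : topologicalType :=
  set_type [set z : R[i]^o * R[i]^o | `|z.1| ^+ 2 + `|z.2| ^+ 2 = 1].

Lemma S3P (z : S3) :
  `|(set_val z).1 : R[i]| ^+ 2 + `|(set_val z).2 : R[i]| ^+ 2 = 1.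
Proof. exact: set_valP z. Qed.

Definition mkS3 (z1 z2 : R[i]) (hz : `|z1| ^+ 2 + `|z2| ^+ 2 = 1) : S3 :=
  SigSub (mem_set hz : ((z1, z2) : R[i]^o * R[i]^o) \in
    [set z : R[i]^o * R[i]^o | `|z.1| ^+ 2 + `|z.2| ^+ 2 = 1]).

Lemma S3_act_subproof (l : S1 R) (z : S3) :
  `|(set_val l : R[i]) ^+ 2 * (set_val z).1| ^+ 2 +
  `|(set_val l : R[i]) ^- 3 * (set_val z).2| ^+ 2 = 1.
Proof.
by rewrite !normrM normfV !normrX S1P !expr1n invr1 !mul1r; exact: S3P.
Qed.

Definition S3_act (l : S1 R) (z : S3) : S3 := mkS3 (S3_act_subproof l z).

(** The identification C^2 = R^4 given by the complex orientation of C^2. *)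
Definition S3_vec (z : S3) : 'rV[R]_4 :=
  \row_(j < 4) nth 0 [:: complex.Re (set_val z).1; complex.Im (set_val z).1;
                         complex.Re (set_val z).2; complex.Im (set_val z).2] j.

(** [c] is a positively oriented chart of S^3 as a submanifold of R^4: it and
    its inverse are smooth, where a map defined on a subset of R^4 is smooth
    if it extends locally to smooth maps on open sets, and at each point x the
    outward normal, which is x itself, followed by the coordinate tangent
    vectors, which are the rows of the Jacobian matrix, is a positive basis of
    R^4. *)
Definition S3_atlas : set (chart R 3 S3) :=
  [set c |
    let psi := S3_vec \o of_coord c in
    [/\ is_chart c,
        smooth_on (chart_img c) psi,
        forall x, chart_dom c x ->
          exists (W : set 'rV[R]_4) (g : 'rV[R]_4 -> 'rV[R]_3),
            [/\ open W, W (S3_vec x), smooth_on W g &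
                forall y, chart_dom c y -> W (S3_vec y) ->
                  g (S3_vec y) = to_coord c y] &
        forall p, chart_img c p ->
          0 < \det (col_mx (psi p) ('J psi p) : 'M[R]_4)]].

End sphere.

(* Main.v *)
From HB Require Import structures.
From mathcomp Require Import all_boot all_order all_algebra.
From mathcomp Require Import all_classical all_reals all_analysis.
From mathcomp Require Import complex ring lra.
Require Import Defs.
Set Implicit Arguments.
Unset Strict Implicit.
Unset Printing Implicit Defensive.
Import Order.TTheory GRing.Theory Num.Theory numFieldNormedType.Exports.
Local Open Scope classical_set_scope.
Local Open Scope ring_scope.

(** A set of at most three points of the circle is written {u^2, v^2, w^2} with
    |u + v + w| <= 1. Such square roots exist because of the four choices of
    relative signs one is always admissible ([acute_signs]): the triangle u, v, w
    has orthocentre u + v + w, and the condition is that it is not obtuse. If it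
    is acute, then the roots are unique up to a common sign; if it has two
    opposite vertices, then the set has at most two points ([coords_set]). With
    q = u + v + w and e = u v w put

      Z1 = e q (1 + |q|^2),    Z2 = conj (e^2 - e q^3).

    These depend on the set only, do not vanish simultaneously, and are
    multiplied by l^2 and l^-3 when the set is turned by l. Radial projection of
    (Z1, Z2) to the sphere is therefore an equivariant map exp_3 S^1 -> S^3. For an
    equilateral triangle Z1 = 0; the sets with at most two points have |q| = 1 and
    fill the part |Z2| <= |Z1| of the set on which Z1^3 Z2^2 is real and at most 0.

    The map is bijective. Modulo the action a set with |q| < 1 is given by
    h = q^3 / e, and a ray of C^2 by the modulus of z1 / z2 and the phase of
    z1^3 z2^2. The phase gives one equation for h and the quotient another one, and
    after elimination of the argument of h a monotone function of |q| remains
    ([ratio_mono]), which yields injectivity ([coords_inj]) and, by the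
    intermediate value theorem, surjectivity ([attained_all]). Both spaces are
    quotients of one compact set of triples (u, v, w), so that the bijection is a
    homeomorphism.

    The space exp_3 S^1 receives the charts of the sphere composed with this
    homeomorphism. Then everything about it is transported from the sphere, except
    that the structure is the canonical one on sets of three points. This is a
    computation of the Jacobian determinant: in the angles of u, v, w it is, up to a
    positive constant, the area of the triangle formed by the roots times a
    polynomial in |q|^2 and Re h that is positive for |q| < 1 ([frame_tri],
    [frame_tri_gt0]). The orientation of the circle enters through the sign of all
    three angles and through the cyclic order, and cancels.

    On the sphere, the complements of the orbits z2 = 0 and z1 = 0 are fibred solid
    tori of types (3, 1) and (2, 3): the angle of the coordinate that does not vanish
    advances along the orbits, and its level sets are discs ([torus_fibred]). *)

(** * Directional derivatives and differentiability *)

Section line.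
Variables (R : realType) (V : normedModType R).
Implicit Types (f : V -> R) (p v : V).

Lemma is_derive_line f p v (t : R) : derivable f (p + t *: v) v ->
  is_derive t 1 (fun s : R => f (p + s *: v)) ('D_v f (p + t *: v)).
Proof.
have E : (fun h : R => h^-1 *: (((fun s : R => f (p + s *: v)) \o shift t) (h *: (1:R)) - f (p + t *: v)))
  = (fun h : R => h^-1 *: ((f \o shift (p + t *: v)) (h *: v) - f (p + t *: v))).
  by apply/funext => h /=; rewrite [h *: 1]mulr1 scalerDl addrCA.
by move=> df; split; rewrite /derivable /derive /= E.
Qed.

Lemma is_derive_scale f p v (a : R) : derivable f p v ->
  is_derive p (a *: v) f (a * 'D_v f p).
Proof.
move=> df.
have df0 : derivable f (p + (0 : R) *: v) v by rewrite scale0r addr0.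
have := is_derive_line df0; rewrite scale0r addr0 => dl.
have dm : is_derive (0:R) (1:R) (fun s : R => a * s : R) a.
  have := @is_deriveZ _ _ _ id a (0:R) 1 1 (is_derive_id _ _).
  by rewrite [_ *: 1]mulr1; exact.
have dl' : is_derive (a * 0) (1:R) (fun s : R => f (p + s *: v)) ('D_v f p).
  by rewrite mulr0.
have [dk Dk] := is_derive1_comp dl' dm.
pose k := (fun s : R => f (p + s *: v)) \o (fun s : R => a * s).
have E2 : (fun h : R => h^-1 *: ((f \o shift p) (h *: (a *: v)) - f p)) =
    (fun h : R => h^-1 *: ((k \o shift 0) (h *: (1 : R)) - k 0)).
  apply/funext => h; rewrite /k /= mulr0 scale0r !addr0 [h *: 1]mulr1.
  by congr (_ *: (f _ - _)); rewrite addrC scalerA mulrC.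
by rewrite mulrC -Dk; split; rewrite /derivable /derive E2.
Qed.

Lemma mean_value f p v :
  (forall t, 0 <= t <= 1 -> derivable f (p + t *: v) v) ->
  exists2 t, 0 <= t <= 1 & f (p + v) - f p = 'D_v f (p + t *: v).
Proof.
move=> df.
have dl (t : R) : 0 <= t <= 1 -> is_derive t 1 (fun s : R => f (p + s *: v)) ('D_v f (p + t *: v)).
  by move=> /df; exact: is_derive_line.
have [x x01||c c01] := @MVT _ (fun s : R => f (p + s *: v))
    (fun t => 'D_v f (p + t *: v)) 0 1 ltr01.
- by apply: dl; have /andP[/ltW -> /ltW ->] := x01.
- by apply: derivable_within_continuous => t t01; have [] := dl t t01.
rewrite /= scale1r scale0r addr0 subr0 mulr1 => E; exists c => //.
by have /andP[/ltW -> /ltW ->] := c01.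
Qed.

(** By the mean value theorem the second half of the step from p to p + h (u + v)
    contributes h times a value of 'D_v f near p, which tends to 'D_v f p. *)
Lemma derive_add f (U : set V) p u v : open U -> U p ->
  (forall x, U x -> derivable f x u) -> (forall x, U x -> derivable f x v) ->
  derivable f p (u + v) -> {for p, continuous ('D_v f)} ->
  'D_(u + v) f p = 'D_u f p + 'D_v f p.
Proof.
move=> oU Up du dv duv cv; apply: cvg_lim => //.
have fu : (fun h : R => h^-1 *: (f (h *: u + p) - f p)) @ (0 : R)^' --> 'D_u f p by exact: du.
suff fv : (fun h : R => h^-1 *: (f (h *: (u + v) + p) - f (h *: u + p))) @ (0 : R)^' --> 'D_v f p.
  apply: (cvg_trans _ (cvgD fu fv)); apply: near_eq_cvg; near=> h.
  by rewrite /= -[LHS]scalerDr addrC subrKA.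
apply/cvgrPdist_lt => e e0.
have : nbhs p (U `&` [set x | `|'D_v f p - 'D_v f x| < e]).
  apply: filterI; first exact: open_nbhs_nbhs.
  by move/cvgrPdist_lt : cv; exact.
move=> /nbhs_ballP[r /= r0 rU].
have M0 : 0 < `|u| + `|v| + 1 by rewrite ltr_wpDl ?addr_ge0.
have r1 : 0 < r / (`|u| + `|v| + 1) by rewrite divr_gt0.
near=> h.
have hn0 : h != 0 by near: h; exact: nbhs_dnbhs_neq.
have hr : `|h| < r / (`|u| + `|v| + 1) by near: h; exact: dnbhs0_lt.
have seg t : 0 <= t <= 1 -> ball p r (h *: u + p + t *: (h *: v)).
  move=> /andP[t0 t1]; rewrite -ball_normE /ball_ /= [h *: u + p]addrC -addrA opprD addNKr.
  rewrite normrN scalerA mulrC -scalerA -scalerDr normrZ.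
  rewrite (le_lt_trans (y := `|h| * (`|u| + `|v| + 1)))//; last by rewrite -ltr_pdivlMr.
  rewrite ler_wpM2l// (le_trans (ler_normD _ _))// -addrA lerD2l normrZ ger0_norm//.
  by rewrite ler_wpDr// ler_piMl.
have [t t01|t t01 Et] := @mean_value f (h *: u + p) (h *: v).
  have /rU[Ux _] := seg t t01.
  by have [] := is_derive_scale h (dv _ Ux).
have /rU[Ux dx] := seg t t01.
have -> : h *: (u + v) + p = h *: u + p + h *: v by rewrite scalerDr addrAC.
rewrite Et; have [_ ->] := is_derive_scale h (dv _ Ux).
by rewrite [X in _ - X]mulrA mulVf// mul1r.
Unshelve. all: by end_near. Qed.

End line.

Section C1.
Variables (R : realType) (m : nat).
Local Notation V := 'rV[R]_m.
Implicit Types (f : V -> R) (p v : V).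

Lemma derive_sum_dir f (U : set V) p (I : Type) (s : seq I) (w : I -> V) :
  open U -> U p -> (forall v x, U x -> derivable f x v) ->
  (forall v x, U x -> {for x, continuous ('D_v f)}) ->
  'D_(\sum_(i <- s) w i) f p = \sum_(i <- s) 'D_(w i) f p.
Proof.
move=> oU Up df cf; elim: s => [|i s IH]; first by rewrite !big_nil derive0.
rewrite !big_cons -IH; apply: (derive_add oU Up) => *; by [exact: df | exact: cf].
Qed.

Lemma derive_coord f (U : set V) p v :
  open U -> U p -> (forall v x, U x -> derivable f x v) ->
  (forall v x, U x -> {for x, continuous ('D_v f)}) ->
  'D_v f p = \sum_i v ord0 i * 'D_(delta_mx ord0 i) f p.
Proof.
move=> oU Up df cf; rewrite {1}[v]row_sum_delta (derive_sum_dir _ _ oU)//.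
by apply: eq_bigr => i _; have [_ ->] := is_derive_scale (v ord0 i) (df (delta_mx ord0 i) p Up).
Qed.

(** Smoothness is defined by directional derivatives, the Jacobian matrix by the
    total derivative; this is the bridge between the two. The displacement from p
    is treated as one segment, on which the mean value theorem applies. *)
Lemma differentiable_C1 f (U : set V) p :
  open U -> U p -> (forall v x, U x -> derivable f x v) ->
  (forall v x, U x -> {for x, continuous ('D_v f)}) ->
  differentiable f p.
Proof.
move=> oU Up df cf.
pose c i := 'D_(delta_mx ord0 i) f p.
pose L (v : V) : R := \sum_i v ord0 i * c i.
have Llin : linear L.
  move=> a u v; rewrite /L scaler_sumr -big_split; apply: eq_bigr => i _ /=.
  by rewrite !mxE mulrDl [a *: _]mulrA.
pose Llin' := GRing.isLinear.Build _ _ _ _ _ Llin.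
pose Ll : {linear V -> R} := HB.pack L Llin'.
have Lc : continuous L.
  apply: continuous_big => [|i _ v]; first exact: add_continuous.
  by apply: (cvgM (@coord_continuous R 1 m ord0 i v)); exact: cvg_cst.
suff fL : f \o shift p = cst (f p) + (Ll : V -> R) +o_ (0 : V) id.
  have Ed := @diff_unique _ _ _ f Ll p Lc fL.
  by apply/diff_locallyP; rewrite Ed; split.
apply/eqaddoP => _ /posnumP[e].
have em : 0 < e%:num / m.+1%:R by rewrite divr_gt0.
have nc : \forall x \near p, forall i : 'I_m,
    `|c i - 'D_(delta_mx ord0 i) f x| < e%:num / m.+1%:R.
  have FF : Filter (nbhs p) by exact: nbhs_filter.
  refine (@filter_forall V 'I_m (fun i x => `|c i - 'D_(delta_mx ord0 i) f x| < e%:num / m.+1%:R) (nbhs p) FF _) => i.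
  by have /cvgrPdist_lt := cf (delta_mx ord0 i) p Up; exact.
have nU : nbhs p U by exact: open_nbhs_nbhs.
have : nbhs p (U `&` [set x | forall i : 'I_m,
    `|c i - 'D_(delta_mx ord0 i) f x| < e%:num / m.+1%:R]) by exact: filterI.
move=> /nbhs_ballP[r /= r0 rU].
near=> h.
have hr : `|h| < r by near: h; exact: (@nbhs0_lt R V r r0).
have seg t : 0 <= t <= 1 -> ball p r (p + t *: h).
  move=> /andP[t0 t1]; rewrite -ball_normE /ball_ /= opprD addNKr normrN normrZ.
  by rewrite (le_lt_trans _ hr)// ger0_norm// ler_piMl.
have [t t01|t t01] := @mean_value _ _ f p h.
  by have /rU[Ux _] := seg t t01; exact: df.
have /rU[Ux dx] := seg t t01.
rewrite (derive_coord _ oU)// => Et.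
rewrite -![(_ + _ : _ -> _) _]/(_ + _) -![(- _ : _ -> _) _]/(- _) /= /cst opprD.
rewrite [h + p]addrC addrA Et /L -sumrB.
apply: (le_trans (ler_norm_sum _ _ _)).
apply: (@le_trans _ _ (\sum_(i < m) `|h| * (e%:num / m.+1%:R))).
  apply: ler_sum => i _; rewrite -mulrBr normrM distrC ler_pM//; last exact: ltW.
  rewrite [leRHS]/Num.Def.normr/= mx_normrE.
  exact: (le_bigmax _ (fun ij => `|h ij.1 ij.2|) (ord0, i)).
rewrite sumr_const card_ord -mulrnAr mulrC ler_wpM2r// -mulr_natr -mulrA ler_piMr//.
by rewrite mulrC ler_pdivrMr ?ltr0n// mul1r ler_nat.
Unshelve. all: by end_near. Qed.

End C1.

(** * Maps of class C^k *)

Lemma is_derive_line0 (R : realType) (V W : normedModType R) (f : V -> W) p v df :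
  is_derive (0 : R) (1 : R) (fun h : R => f (h *: v + p)) df <-> is_derive p v f df.
Proof.
have E : (fun h : R => h^-1 *: (((fun h : R => f (h *: v + p)) \o shift 0) (h *: (1:R))
      - f (0 *: v + p))) = (fun h : R => h^-1 *: ((f \o shift p) (h *: v) - f p)).
  by apply/funext => h /=; rewrite addr0 [h *: 1]mulr1 scale0r add0r.
by split=> -[d1 d2]; split; move: d1 d2; rewrite /derivable /derive /= E.
Qed.

Lemma is_derive_comp (R : realType) (V W W' : normedModType R)
    (f : V -> W) (g : W -> W') p v :
  derivable f p v -> differentiable g (f p) ->
  is_derive p v (g \o f) ('d g (f p) ('D_v f p)).
Proof.
move=> df dg; apply/is_derive_line0.
have /is_derive_line0[l1 l2] := derivableP df.
have dl := l1; move/derivable1_diffP: dl => dl.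
pose l := fun h : R => f (h *: v + p); rewrite -/l in dl l1 l2.
have l0 : l 0 = f p by rewrite /l scale0r add0r.
have dgl : differentiable g (l 0) by rewrite l0.
rewrite -[fun h => _]/(g \o l).
have dc : differentiable (g \o l) (0 : R) by exact: differentiable_comp.
split; first exact: diff_derivable.
by rewrite deriveE// diff_comp//= l0 -(deriveE _ dl) l2.
Qed.

Lemma is_derive_comp1 (R : realType) (V : normedModType R)
    (f : V -> R) (g : R -> R) p v (dg : R) :
  derivable f p v -> is_derive (f p) (1 : R) g dg ->
  is_derive p v (g \o f) (dg * 'D_v f p).
Proof.
move=> df [dg1 dg2].
have dg' : differentiable g (f p) by apply/derivable1_diffP.
suff <- : 'd g (f p) ('D_v f p) = dg * 'D_v f p by exact: is_derive_comp.
rewrite -[X in 'd _ _ X]mulr1 linearZ -deriveE// dg2.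
exact: mulrC.
Qed.

Lemma continuous_rV (R : realType) (T : topologicalType) n (F : T -> 'rV[R]_n) p :
  {for p, continuous F} <-> forall j, {for p, continuous (fun x => F x ord0 j)}.
Proof.
split=> [cF j|cF].
  by apply: (@continuous_comp _ _ _ F (fun M : 'rV[R]_n => M ord0 j));
    [exact: cF | exact: coord_continuous].
apply/cvgrPdist_lt => e e0.
have nc : \forall x \near p, forall j : 'I_n, `|F p ord0 j - F x ord0 j| < e.
  refine (@filter_forall _ 'I_n (fun j x => `|F p ord0 j - F x ord0 j| < e)
    (nbhs p) (nbhs_filter p) _) => j.
  by have /cvgrPdist_lt := cF j; exact.
apply: filterS nc => x xe.
rewrite [ltLHS]/Num.Def.normr/= mx_normrE.
apply: bigmax_lt => // -[i j] _ /=; rewrite (ord1 i) !mxE.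
exact: xe.
Qed.

Section scalar.
Variables (R : realType) (m : nat).
Local Notation V := 'rV[R]_m.
Implicit Types (U : set V) (f g : V -> R) (p v : V) (k : nat).

(** [Ck_on] for scalar functions, where products and quotients are available. *)
Fixpoint Cks k U f : Prop :=
  (forall p, U p -> {for p, continuous f}) /\
  if k is k'.+1 then
    forall v, (forall p, U p -> derivable f p v) /\ Cks k' U ('D_v f)
  else True.

Lemma Cks_continuous k U f p : Cks k U f -> U p -> {for p, continuous f}.
Proof. by case: k => [|k] [cf _]; exact: cf. Qed.

Lemma Cks_derivable k U f p v : Cks k.+1 U f -> U p -> derivable f p v.
Proof. by case=> _ /(_ v)[df _]; exact: df. Qed.

Lemma Cks_derive k U f v : Cks k.+1 U f -> Cks k U ('D_v f).
Proof. by case=> _ /(_ v)[]. Qed.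

Lemma CksW k U f : Cks k.+1 U f -> Cks k U f.
Proof.
elim: k f => [|k IH] f Cf; first by case: Cf.
split=> [p Up|v]; first exact: Cks_continuous Cf Up.
split=> [p Up|]; first exact: Cks_derivable Cf Up.
by apply: IH; exact: Cks_derive Cf.
Qed.

Lemma Cks_sub k U U' f : U `<=` U' -> Cks k U' f -> Cks k U f.
Proof.
move=> UU'; elim: k f => [|k IH] f [cf df]; split=> //;
  try by move=> p Up; apply: cf; exact: UU'.
move=> v; by have [dfv Cf] := df v; split; [move=> p Up; apply: dfv; exact: UU' | exact: IH].
Qed.

Lemma Cks_diff k U f p : open U -> Cks k.+1 U f -> U p -> differentiable f p.
Proof.
move=> oU Cf Up; apply: (differentiable_C1 oU Up) => v x Ux.
  exact: Cks_derivable Cf Ux.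
exact: Cks_continuous (Cks_derive v Cf) Ux.
Qed.

Lemma Cks_eq k U f g : open U -> (forall p, U p -> f p = g p) ->
  Cks k U f -> Cks k U g.
Proof.
move=> oU; elim: k f g => [|k IH] f g fg Cf.
- split=> // p Up; have cf := Cks_continuous Cf Up.
  have nfg : {near p, f =1 g}.
    by apply: filterS (open_nbhs_nbhs (conj oU Up)) => x; exact: fg.
  rewrite /prop_for /continuous_at -fg//; apply: cvg_trans cf.
  exact: near_eq_cvg nfg.
have nfg p : U p -> {near p, f =1 g}.
  by move=> Up; apply: filterS (open_nbhs_nbhs (conj oU Up)) => x; exact: fg.
split=> [p Up|v].
  rewrite /prop_for /continuous_at -fg//; apply: cvg_trans (Cks_continuous Cf Up).
  exact: near_eq_cvg (nfg _ Up).
split=> [p Up|].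
  by apply: (@near_eq_derivable R _ _ f g p v (nfg p Up)); exact: Cks_derivable Cf Up.
apply: IH (Cks_derive v Cf) => p Up.
exact: near_eq_derive (nfg p Up).
Qed.

(** Each of the closure properties below is an induction on k through this step:
    a formula for the derivative in terms of functions already under control. *)
Lemma CksS k U f (df : V -> V -> R) : open U ->
  (forall p, U p -> {for p, continuous f}) ->
  (forall v p, U p -> is_derive p v f (df v p)) ->
  (forall v, Cks k U (df v)) -> Cks k.+1 U f.
Proof.
move=> oU cf dfE Cdf; split=> // v; split=> [p /(dfE v)[]//|].
by apply: Cks_eq (Cdf v) => // p /(dfE v)[].
Qed.

Lemma Cks_cst k U (c : R) : Cks k U (fun=> c).
Proof.
have cc (x : R) p : {for p, continuous (fun=> x)} by exact: cst_continuous.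
elim: k c => [|k IH] c; split=> //.
move=> v; split=> [p _|]; first exact: derivable_cst.
rewrite (_ : 'D_v (fun=> c) = (fun=> 0)); first exact: IH.
by apply/funext => x; exact: derive_cst.
Qed.

Lemma is_derive_rVcoord p v j : is_derive p v (fun x : V => x ord0 j) (v ord0 j).
Proof.
have d : differentiable (fun x : V => x ord0 j) p by exact: differentiable_coord.
split; first exact: diff_derivable.
have @f : {linear V -> R}.
  by exists (fun N : V => N ord0 j); do 2![eexists]; do ?[constructor];
     rewrite ?mxE// => ? *; rewrite ?mxE//; move=> ?; rewrite !mxE.
rewrite deriveE// (_ : (fun _ => _) = f)// diff_lin//.
exact: coord_continuous.
Qed.

Lemma Cks_coord k U j : open U -> Cks k U (fun p => p ord0 j).
Proof.
move=> oU; have cf p : U p -> {for p, continuous (fun p : V => p ord0 j)}.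
  by move=> _; exact: coord_continuous.
case: k => [|k]; first by [].
apply: (@CksS _ _ _ (fun v _ => v ord0 j)) => // [v p _|v]; last exact: Cks_cst.
exact: is_derive_rVcoord.
Qed.

Lemma CksD k U f g : open U -> Cks k U f -> Cks k U g ->
  Cks k U (fun p => f p + g p).
Proof.
move=> oU; elim: k f g => [|k IH] f g Cf Cg.
  by split=> // p Up; exact: (cvgD (Cks_continuous Cf Up) (Cks_continuous Cg Up)).
apply: (@CksS _ _ _ (fun v p => 'D_v f p + 'D_v g p)) => //.
- by move=> p Up; exact: (cvgD (Cks_continuous Cf Up) (Cks_continuous Cg Up)).
- move=> v p Up.
  by apply: is_deriveD; apply: derivableP;
    [exact: Cks_derivable Cf Up | exact: Cks_derivable Cg Up].
- by move=> v; apply: IH; [exact: Cks_derive Cf | exact: Cks_derive Cg].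
Qed.

Lemma CksM k U f g : open U -> Cks k U f -> Cks k U g ->
  Cks k U (fun p => f p * g p).
Proof.
move=> oU; elim: k f g => [|k IH] f g Cf Cg.
  by split=> // p Up; exact: (cvgM (Cks_continuous Cf Up) (Cks_continuous Cg Up)).
apply: (@CksS _ _ _ (fun v p => f p * 'D_v g p + g p * 'D_v f p)) => //.
- by move=> p Up; exact: (cvgM (Cks_continuous Cf Up) (Cks_continuous Cg Up)).
- move=> v p Up.
  by apply: is_deriveM; apply: derivableP;
    [exact: Cks_derivable Cf Up | exact: Cks_derivable Cg Up].
- move=> v; apply: CksD => //; apply: IH; first [exact: CksW Cf | exact: CksW Cg |
   exact: Cks_derive Cf | exact: Cks_derive Cg].
Qed.

Lemma CksN k U f : open U -> Cks k U f -> Cks k U (fun p => - f p).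
Proof.
move=> oU Cf; apply: (Cks_eq (f := fun p => -1 * f p)) => // [p _|].
  by rewrite mulN1r.
by apply: CksM => //; exact: Cks_cst.
Qed.

Lemma CksX k U f n : open U -> Cks k U f -> Cks k U (fun p => f p ^+ n).
Proof.
move=> oU Cf; elim: n => [|n IH]; first exact: Cks_cst.
by apply: (Cks_eq (f := fun p => f p * f p ^+ n)) => // [p _|];
  [rewrite exprS | exact: CksM].
Qed.

Lemma Cks_sum k U (I : Type) (s : seq I) (F : I -> V -> R) : open U ->
  (forall i, Cks k U (F i)) -> Cks k U (fun p => \sum_(i <- s) F i p).
Proof.
move=> oU CF; elim: s => [|i s IH].
  by apply: (Cks_eq (f := fun=> 0)) => // [p _|]; [rewrite big_nil | exact: Cks_cst].
apply: (Cks_eq (f := fun p => F i p + \sum_(i <- s) F i p)) => // [p _|].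
  by rewrite big_cons.
exact: CksD.
Qed.

Lemma CksV k U f : open U -> (forall p, U p -> f p != 0) -> Cks k U f ->
  Cks k U (fun p => (f p)^-1).
Proof.
move=> oU f0; elim: k => [|k IH] Cf.
  by split=> // p Up; exact: (cvgV (f0 p Up) (Cks_continuous Cf Up)).
apply: (@CksS _ _ _ (fun v p => - ((f p)^-1 ^+ 2) * 'D_v f p)) => //.
- by move=> p Up; exact: (cvgV (f0 p Up) (Cks_continuous Cf Up)).
- move=> v p Up; have dfp := Cks_derivable (v := v) Cf Up; have fp0 := f0 p Up.
  split; first exact: derivableV.
  by rewrite deriveV// exprVn.
- move=> v; apply: CksM => //; last exact: Cks_derive Cf.
  by apply/CksN/CksX/IH/CksW.
Qed.

Lemma Cks_sqrt k U f : open U -> (forall p, U p -> 0 < f p) -> Cks k U f ->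
  Cks k U (fun p => Num.sqrt (f p)).
Proof.
move=> oU f0; have cs k' : Cks k' U f -> forall p, U p -> {for p, continuous (fun p => Num.sqrt (f p))}.
  move=> Cf p Up; apply: continuous_comp; first exact: Cks_continuous Cf Up.
  exact: sqrt_continuous.
elim: k => [|k IH] Cf; first by split=> //; exact: cs Cf.
apply: (@CksS _ _ _ (fun v p => (2 * Num.sqrt (f p))^-1 * 'D_v f p)) => //.
- exact: cs Cf.
- move=> v p Up; apply: is_derive_comp1; first exact: Cks_derivable Cf Up.
  exact: is_derive1_sqrt (f0 p Up).
- move=> v; apply: CksM => //; last exact: Cks_derive Cf.
  apply: CksV => // [p Up|]; first by rewrite mulf_neq0// gt_eqF// sqrtr_gt0 f0.
  by apply: CksM => //; [exact: Cks_cst | apply: IH; exact: CksW].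
Qed.

Lemma Cks_cos_sin k U f : open U -> Cks k U f ->
  Cks k U (fun p => cos (f p)) /\ Cks k U (fun p => sin (f p)).
Proof.
move=> oU.
have cc k' : Cks k' U f -> (forall p, U p -> {for p, continuous (fun p => cos (f p))}) /\
    (forall p, U p -> {for p, continuous (fun p => sin (f p))}).
  move=> Cf; split=> p Up; apply: continuous_comp; try exact: Cks_continuous Cf Up.
    exact: continuous_cos.
  exact: continuous_sin.
elim: k => [|k IH] Cf; first by have [c s] := cc _ Cf.
have [c s] := cc _ Cf; have [Cc Cs] := IH (CksW Cf).
split.
- apply: (@CksS _ _ _ (fun v p => - sin (f p) * 'D_v f p)) => //.
  + move=> v p Up; apply: is_derive_comp1; exact: Cks_derivable Cf Up.
  + by move=> v; apply: CksM => //; [exact: CksN | exact: Cks_derive Cf].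
- apply: (@CksS _ _ _ (fun v p => cos (f p) * 'D_v f p)) => //.
  + move=> v p Up; apply: is_derive_comp1; exact: Cks_derivable Cf Up.
  + by move=> v; apply: CksM => //; exact: Cks_derive Cf.
Qed.

End scalar.

Section vector.
Variables (R : realType) (m n : nat).
Implicit Types (U : set 'rV[R]_m) (W : set 'rV[R]_n) (k : nat).

Lemma Ck_onP k U (f : 'rV[R]_m -> 'rV[R]_n) : open U ->
  Ck_on k U f <-> forall j, Cks k U (fun p => f p ord0 j).
Proof.
move=> oU; elim: k f => [|k IH] f.
  split=> [[cf _] j|Cf].
    by split=> // p Up; have /continuous_rV := cf p Up; exact.
  by split=> // p Up; apply/continuous_rV => j; exact: Cks_continuous (Cf j) Up.
split=> [[cf df] j|Cf].
  split=> [p Up|v]; first by have /continuous_rV := cf p Up; exact.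
  have [dfv Cv] := df v; split=> [p Up|].
    by have /derivable_mxP := dfv p Up; exact.
  have /IH/(_ j) := Cv; apply: Cks_eq => // p Up.
  by rewrite derive_mx ?mxE//; exact: dfv.
split=> [p Up|v]; first by apply/continuous_rV => j; exact: Cks_continuous (Cf j) Up.
have dfv p : U p -> derivable f p v.
  move=> Up; apply/derivable_mxP => i j; rewrite (ord1 i).
  exact: Cks_derivable (Cf j) Up.
split=> //; apply/IH => j; apply: Cks_eq (Cks_derive v (Cf j)) => // p Up.
by rewrite derive_mx ?mxE//; exact: dfv.
Qed.

Lemma Ck_differentiable k U (f : 'rV[R]_m -> 'rV[R]_n) p : open U ->
  Ck_on k.+1 U f -> U p -> differentiable f p.
Proof.
move=> oU /Ck_onP Cf Up.
have -> : f = \sum_j (fun x => f x ord0 j *: delta_mx ord0 j).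
  by apply/funext => x; rewrite fct_sumE; exact: row_sum_delta.
apply: differentiable_sum => j.
apply: differentiableZl; exact: Cks_diff oU (Cf oU j) Up.
Qed.

Lemma Cks_comp k U W (f : 'rV[R]_m -> 'rV[R]_n) (g : 'rV[R]_n -> R) :
  open U -> open W -> (forall p, U p -> W (f p)) ->
  (forall j, Cks k U (fun p => f p ord0 j)) -> Cks k W g -> Cks k U (g \o f).
Proof.
move=> oU oW fUW; elim: k g => [|k IH] g Cf Cg.
  split=> // p Up; apply: continuous_comp; last exact: Cks_continuous Cg (fUW p Up).
  by apply/continuous_rV => j; exact: Cks_continuous (Cf j) Up.
have dfv v p : U p -> derivable f p v.
  move=> Up; apply/derivable_mxP => i j; rewrite (ord1 i).
  exact: Cks_derivable (Cf j) Up.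
apply: (@CksS _ _ _ _ _ (fun v p =>
   \sum_j 'D_v (fun p => f p ord0 j) p * 'D_(delta_mx ord0 j) g (f p))) => //.
- move=> p Up; apply: continuous_comp; last exact: Cks_continuous Cg (fUW p Up).
  by apply/continuous_rV => j; exact: Cks_continuous (Cf j) Up.
- move=> v p Up; have dg := Cks_diff oW Cg (fUW p Up).
  have := is_derive_comp (dfv v p Up) dg.
  rewrite -deriveE// (derive_coord _ oW (fUW p Up)).
  + by rewrite derive_mx; [under eq_bigr do rewrite mxE | exact: dfv].
  + by move=> v' x Wx; exact: Cks_derivable Cg Wx.
  + by move=> v' x Wx; exact: Cks_continuous (Cks_derive v' Cg) Wx.
- move=> v; apply: Cks_sum => // j; apply: CksM => //; first exact: Cks_derive (Cf j).
  apply: (IH ('D_(delta_mx ord0 j) g)); last exact: Cks_derive Cg.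
  by move=> i; exact: CksW.
Qed.

End vector.

Lemma jac_row (R : realType) m n (f : 'rV[R]_m -> 'rV[R]_n) (p : 'rV[R]_m) i :
  differentiable f p -> row i ('J f p) = 'D_(delta_mx ord0 i) f p.
Proof. by move=> df; rewrite deriveEjacobian// rowE. Qed.

Lemma jac_comp (R : realType) m n l (f : 'rV[R]_m -> 'rV[R]_n)
    (g : 'rV[R]_n -> 'rV[R]_l) (p : 'rV[R]_m) :
  differentiable f p -> differentiable g (f p) ->
  'J (g \o f) p = 'J f p *m 'J g (f p).
Proof.
move=> df dg; apply/row_matrixP => i.
rewrite (jac_row i (differentiable_comp df dg)) row_mul (jac_row i df) -(deriveEjacobian _ dg).
have [_ ->] := is_derive_comp (diff_derivable (v := delta_mx ord0 i) df) dg.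
by rewrite -(deriveE _ dg).
Qed.

Lemma jac_near (R : realType) m n (f g : 'rV[R]_m -> 'rV[R]_n) (p : 'rV[R]_m) :
  differentiable f p -> differentiable g p -> {near p, f =1 g} ->
  'J f p = 'J g p.
Proof.
move=> df dg fg; apply/row_matrixP => i.
apply: (etrans (jac_row i df)); apply: (etrans _ (esym (jac_row i dg))).
exact: near_eq_derive.
Qed.

Section smooth.
Variables (R : realType).

Definition smooths m (U : set 'rV[R]_m) (f : 'rV[R]_m -> R) := forall k, Cks k U f.

Lemma smooth_onP m n (U : set 'rV[R]_m) (f : 'rV[R]_m -> 'rV[R]_n) : open U ->
  smooth_on U f <-> forall j, smooths U (fun p => f p ord0 j).
Proof.
move=> oU; split=> [Cf j k|Cf k]; first by have /Ck_onP/(_ j) := Cf k; exact.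
by apply/Ck_onP => // j; exact: Cf.
Qed.

Lemma smooth_on_sub m n (U U' : set 'rV[R]_m) (f : 'rV[R]_m -> 'rV[R]_n) :
  open U -> open U' -> U `<=` U' -> smooth_on U' f -> smooth_on U f.
Proof.
move=> oU oU' UU' /smooth_onP Cf; apply/smooth_onP => // j k.
by apply: Cks_sub UU' _; exact: Cf.
Qed.

Lemma smooth_on_eq m n (U : set 'rV[R]_m) (f g : 'rV[R]_m -> 'rV[R]_n) :
  open U -> (forall p, U p -> f p = g p) -> smooth_on U f -> smooth_on U g.
Proof.
move=> oU fg /smooth_onP Cf; apply/smooth_onP => // j k.
by apply: Cks_eq (Cf oU j k) => // p Up; rewrite fg.
Qed.

Lemma smooth_on_comp m n l (U : set 'rV[R]_m) (W : set 'rV[R]_n)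
    (f : 'rV[R]_m -> 'rV[R]_n) (g : 'rV[R]_n -> 'rV[R]_l) :
  open U -> open W -> (forall p, U p -> W (f p)) ->
  smooth_on U f -> smooth_on W g -> smooth_on U (g \o f).
Proof.
move=> oU oW fUW /smooth_onP Cf /smooth_onP Cg; apply/smooth_onP => // j k.
apply: (Cks_comp (g := fun x => g x ord0 j) oU oW fUW) => [i|]; first exact: Cf.
exact: Cg.
Qed.

(** Charts of the sphere extend to smooth maps of R^4 only locally. *)
Lemma smooth_on_local m n (U : set 'rV[R]_m) (f : 'rV[R]_m -> 'rV[R]_n) :
  (forall p, U p -> exists W, [/\ open W, W p & smooth_on W f]) ->
  smooth_on U f.
Proof.
move=> loc k.
have {loc} : forall p, U p -> exists W, [/\ open W, W p & Ck_on k W f].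
  by move=> p /loc[W [oW Wp sf]]; exists W; split.
elim: k f => [|k IH] f loc.
  by split=> // p /loc[W [_ Wp [cf _]]]; exact: cf.
split=> [p /loc[W [_ Wp [cf _]]]|v]; first exact: cf.
split=> [p /loc[W [_ Wp [_ /(_ v)[df _]]]]|]; first exact: df.
apply: IH => p /loc[W [oW Wp [_ /(_ v)[_ Cf]]]]; by exists W.
Qed.

Lemma smooth_on_diff m n (U : set 'rV[R]_m) (f : 'rV[R]_m -> 'rV[R]_n) p :
  open U -> smooth_on U f -> U p -> differentiable f p.
Proof. by move=> oU Cf; apply: Ck_differentiable oU (Cf 1). Qed.

Lemma smooth_on_continuous m n (U : set 'rV[R]_m) (f : 'rV[R]_m -> 'rV[R]_n) p :
  smooth_on U f -> U p -> {for p, continuous f}.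
Proof. by move=> /(_ 0) [cf _] Up; exact: cf. Qed.

End smooth.

(** * Topology of the sphere *)

Section topology.
Variable R : realType.
Implicit Types (T : topologicalType).

Lemma Re_norm_le (z : R[i]) : (`|complex.Re z|)%:C%C <= `|z|.
Proof. exact: normc_ge_Re. Qed.

Lemma Im_norm_le (z : R[i]) : (`|complex.Im z|)%:C%C <= `|z|.
Proof.
by case: z => a b; rewrite normc_def lecR /= -[leLHS]sqrtr_sqr ler_wsqrtr// lerDr sqr_ge0.
Qed.

Lemma norm_le_ReIm (z : R[i]) :
  `|z| <= (`|complex.Re z| + `|complex.Im z|)%:C%C.
Proof.
case: z => a b; rewrite normc_def lecR /= -[leRHS]ger0_norm ?addr_ge0// -[leRHS]sqrtr_sqr.
rewrite ler_wsqrtr// sqrrD !real_normK ?num_real// lerD2r lerDl.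
by rewrite mulrn_wge0// mulr_ge0.
Qed.

Lemma continuousC T (f : T -> R[i]^o) (p : T) : {for p, continuous f} <->
  {for p, continuous (fun x => complex.Re (f x) : R)} /\
  {for p, continuous (fun x => complex.Im (f x) : R)}.
Proof.
split=> [cf|[cr ci]].
  split; apply/cvgrPdist_lt => e e0.
    move/cvgrPdist_lt : cf => /(_ e%:C%C); rewrite ltcR => /(_ e0).
    apply: filterS => x; rewrite -ltcR; apply: le_lt_trans.
    by rewrite -raddfB; exact: Re_norm_le.
  move/cvgrPdist_lt : cf => /(_ e%:C%C); rewrite ltcR => /(_ e0).
  apply: filterS => x; rewrite -ltcR; apply: le_lt_trans.
  by rewrite -raddfB; exact: Im_norm_le.
apply/cvgrPdist_lt => -[e e'] e0.
have e'0 : e' = 0 by move: e0; rewrite ltcE /= => /andP[/eqP].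
move: e0; rewrite {}e'0 ltcR => e0.
have e20 : 0 < e / 2 by rewrite divr_gt0.
move/cvgrPdist_lt : cr => /(_ _ e20) cr; move/cvgrPdist_lt : ci => /(_ _ e20) ci.
apply: filterS2 cr ci => x xr xi; apply: (le_lt_trans (norm_le_ReIm _)).
by rewrite !raddfB ltcR [ltRHS]splitr ltrD.
Qed.

(** The topology of a subset type is the initial one for the inclusion. *)
Lemma continuous_set_type T (X : topologicalType) (A : set X) (f : T -> set_type A) (p : T) :
  {for p, continuous f} <-> {for p, continuous (fun x => set_val (f x))}.
Proof.
split=> cf; first by apply: continuous_comp; [exact: cf | exact: initial_continuous].
move=> /= B [/= C [[D oD <-] /= Dfp] CB].
apply: filterS (fun x => CB (f x)) _.
by apply: cf; apply: open_nbhs_nbhs; split.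
Qed.

Lemma continuous_pair T (X Y : topologicalType) (f : T -> X * Y) (p : T) :
  {for p, continuous f} <->
  {for p, continuous (fun x => (f x).1)} /\ {for p, continuous (fun x => (f x).2)}.
Proof.
split=> [cf|[c1 c2]].
  by split; apply: continuous_comp; try exact: cf; [exact: cvg_fst | exact: cvg_snd].
have E : (fun x => ((f x).1, (f x).2)) = f by apply/funext => x; case: (f x).
have c := @cvg_pair _ _ _ _ (nbhs (f p).1) (nbhs (f p).2) _ _ _ _ _ c1 c2.
rewrite /prop_for /continuous_at -[X in X @ _]E.
move: (c (nbhs_filter p) (nbhs_filter _) (nbhs_filter _)).
by case: (f p) => a b; exact.
Qed.

Lemma continuous_S3P T (f : T -> S3 R) (p : T) :
  {for p, continuous f} <-> {for p, continuous (fun x => S3_vec (f x))}.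
Proof.
split=> [/continuous_set_type/continuous_pair[/continuousC[c1 c2] /continuousC[c3 c4]]|
  /continuous_rV cf].
  apply/continuous_rV => j.
  have -> : (fun x => S3_vec (f x) ord0 j) = (fun x => nth 0 [:: complex.Re (set_val (f x)).1;
      complex.Im (set_val (f x)).1; complex.Re (set_val (f x)).2; complex.Im (set_val (f x)).2] j).
    by apply/funext => x; rewrite mxE.
  by case: j => -[|[|[|[|]]]].
have E (j : 'I_4) g : (forall x, nth 0 [:: complex.Re (set_val (f x)).1;
      complex.Im (set_val (f x)).1; complex.Re (set_val (f x)).2; complex.Im (set_val (f x)).2] j = g x) ->
      {for p, continuous g}.
  by move=> gE; have := cf j; congr (continuous_at _ _); apply/funext => x; rewrite mxE.
apply/continuous_set_type/continuous_pair; split; apply/continuousC; split;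
  [apply: (E (inord 0))|apply: (E (inord 1))|apply: (E (inord 2))|apply: (E (inord 3))];
  move=> x; rewrite inordK//.
Qed.
End topology.

Lemma hausdorff_inj (M N : topologicalType) (h : M -> N) : continuous h ->
  injective h -> hausdorff_space N -> hausdorff_space M.
Proof.
move=> ch hI; rewrite !open_hausdorff => hN x y xy.
have hxy : h x != h y by apply: contra_neq xy; exact: hI.
have [[A B] /= [xA yB] [oA oB AB]] := hN _ _ hxy.
exists (h @^-1` A, h @^-1` B) => /=; first by move: xA yB; rewrite !inE.
split; [by apply: open_comp oA => z _; exact: ch|by apply: open_comp oB => z _; exact: ch|].
by rewrite -preimage_setI (eqP AB) preimage_set0.
Qed.

Section embedded.
Variables (R : realType) (n : nat) (M : topologicalType).
Variables (h : M -> 'rV[R]_n) (g : 'rV[R]_n -> M).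
Hypothesis ch : continuous h.
Hypothesis hK : cancel h g.
Hypothesis cg : forall x, {for h x, continuous g}.

(** The preimages of the boxes with rational faces form a basis, because g is
    continuous at the points h x. *)
Lemma embedded_second_countable : @second_countable M.
Proof.
pose box (ab : {ffun 'I_n -> rat * rat}) : set M :=
  [set z | forall j, ratr (ab j).1 < h z ord0 j < ratr (ab j).2].
exists (range box); first exact: (sub_countable (card_image_le _ _) (countableP _)).
split=> [_ [ab _ <-]|x A].
  rewrite openE => z zab.
  have cj j : {for z, continuous (fun z => h z ord0 j)}.
    by have /continuous_rV := @ch z; exact.
  refine (@filter_forall _ 'I_n (fun j z => ratr (ab j).1 < h z ord0 j < ratr (ab j).2)
    (nbhs z) (nbhs_filter z) _) => j.
  have /andP[l u] := zab j.
  have nl : \forall y \near z, ratr (ab j).1 < h y ord0 j by exact: (cvgr_gt _ (cj j) _ l).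
  have nu : \forall y \near z, h y ord0 j < ratr (ab j).2 by exact: (cvgr_lt _ (cj j) _ u).
  by apply: filterS2 nl nu => y -> ->.
rewrite nbhs_simpl => nA.
have : nbhs (h x) (g @^-1` A) by apply: cg; rewrite hK.
move=> /nbhs_ballP[e /= e0 eA].
have rl j : exists r : rat, h x ord0 j - e < ratr r < h x ord0 j.
  by apply: rat_in_itvoo; rewrite ltrBlDr ltrDl.
have ru j : exists r : rat, h x ord0 j < ratr r < h x ord0 j + e.
  by apply: rat_in_itvoo; rewrite ltrDl.
have [a aE] := choice rl; have [b bE] := choice ru.
exists (box [ffun j => (a j, b j)]); last first.
  move=> z zb; rewrite /= -(hK z); apply: eA; rewrite -ball_normE /ball_ /=.
  rewrite [ltLHS]/Num.Def.normr/= mx_normrE.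
  apply: bigmax_lt => // -[i j] _ /=; rewrite (ord1 i) !mxE.
  have := zb j; rewrite ffunE /= => /andP[l u].
  have /andP[l1 _] := aE j; have /andP[_ u1] := bE j.
  by rewrite ltr_distlC; apply/andP; split; [exact: lt_trans l1 l | exact: lt_trans u u1].
split; first by exists [ffun j => (a j, b j)].
by move=> j; rewrite ffunE /=; have /andP[_ ->] := aE j; have /andP[-> _] := bE j.
Qed.

End embedded.

Section S3n.
Variable R : realType.
Implicit Types (x : 'rV[R]_4) (z : S3 R).

Definition norm2 x : R := \sum_j x ord0 j ^+ 2.

Lemma norm2E x : norm2 x = x ord0 0 ^+ 2 + x ord0 1 ^+ 2 + x ord0 2 ^+ 2 + x ord0 3 ^+ 2.
Proof.
rewrite /norm2 !big_ord_recl big_ord0 addr0 !addrA.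
by congr (_ + _ + _ + _); congr (x ord0 _ ^+ 2); apply/val_inj.
Qed.

Lemma norm2_gt0 x : x != 0 -> 0 < norm2 x.
Proof.
move=> x0; rewrite lt_def sumr_ge0 ?andbT => [|j _]; last exact: sqr_ge0.
apply: contra x0; rewrite psumr_eq0 => [/allP h|j _]; last exact: sqr_ge0.
apply/eqP/rowP => j; rewrite mxE; apply/eqP; rewrite -sqrf_eq0.
by apply: h; rewrite mem_index_enum.
Qed.

Lemma norm2Z a x : norm2 (a *: x) = a ^+ 2 * norm2 x.
Proof. by rewrite /norm2 mulr_sumr; apply: eq_bigr => j _; rewrite mxE exprMn. Qed.

Definition vec4 (a b c d : R) : 'rV[R]_4 := \row_(j < 4) nth 0 [:: a; b; c; d] j.

Lemma normc2E (z : R[i]) : `|z| ^+ 2 = (complex.Re z ^+ 2 + complex.Im z ^+ 2)%:C%C.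
Proof. by rewrite add_Re2_Im2. Qed.

Lemma norm2_S3_vec z : norm2 (S3_vec z) = 1.
Proof.
have := S3P z; rewrite !normc2E -rmorphD /= => /complexI <-.
by rewrite norm2E !mxE /= !addrA.
Qed.

Lemma S3_vec_neq0 z : S3_vec z != 0.
Proof.
apply: contraTneq (ltr01 : 0 < 1 :> R) => z0; rewrite -(norm2_S3_vec z) z0.
by rewrite /norm2 big1 ?ltxx// => j _; rewrite mxE expr0n.
Qed.

Lemma S3_vec_inj : injective (@S3_vec R).
Proof.
move=> z w zw; apply: val_inj.
have E (j : 'I_4) := congr1 (fun M : 'rV_4 => M ord0 j) zw.
have := (E 0, E 1, E 2, E 3); rewrite /S3_vec !mxE /=.
case: z w {zw E} => [[[a b] [c d]] hz] [[[a' b'] [c' d']] hw] /=.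
by rewrite /set_val /= => -[[[-> ->] ->] ->].
Qed.

Lemma S3_vec_surj x : norm2 x = 1 -> exists z, S3_vec z = x.
Proof.
move=> x1.
have h : `|(x ord0 0 +i* x ord0 1)%C| ^+ 2 + `|(x ord0 2 +i* x ord0 3)%C| ^+ 2 = 1 :> R[i].
  by rewrite !normc2E -rmorphD /= addrA -norm2E x1.
exists (mkS3 h); apply/rowP => j; rewrite mxE /set_val /=.
by case: j => -[|[|[|[|]]]]//= lj; congr (x ord0 _); exact: val_inj.
Qed.

Lemma S3_base_subproof : `|1 : R[i]| ^+ 2 + `|0 : R[i]| ^+ 2 = 1.
Proof. by rewrite normr1 normr0 expr1n expr0n addr0. Qed.

(** The radial projection of R^4 minus the origin onto the sphere. *)
Definition S3n x : S3 R :=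
  xget (mkS3 S3_base_subproof) [set z | S3_vec z = (Num.sqrt (norm2 x))^-1 *: x].

Lemma S3nE x : x != 0 -> S3_vec (S3n x) = (Num.sqrt (norm2 x))^-1 *: x.
Proof.
move=> x0; rewrite /S3n; case: xgetP => [z _ //|/(_ _) nz].
have [|z /nz//] := @S3_vec_surj ((Num.sqrt (norm2 x))^-1 *: x).
by rewrite norm2Z exprVn sqr_sqrtr ?mulVf ?gt_eqF ?norm2_gt0// ltW// norm2_gt0.
Qed.

Lemma S3nZ a x : 0 < a -> x != 0 -> S3n (a *: x) = S3n x.
Proof.
move=> a0 x0; apply: S3_vec_inj; rewrite !S3nE//; last by rewrite scaler_eq0 gt_eqF.
rewrite norm2Z sqrtrM ?sqr_ge0// sqrtr_sqr gtr0_norm// invfM scalerA.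
by rewrite mulrAC mulVf ?mul1r// gt_eqF.
Qed.

Lemma S3nK : cancel (@S3_vec R) S3n.
Proof.
move=> z; apply: S3_vec_inj; rewrite S3nE ?S3_vec_neq0//.
by rewrite norm2_S3_vec sqrtr1 invr1 scale1r.
Qed.

Lemma S3n_eq x y : x != 0 -> y != 0 -> S3n x = S3n y -> exists2 a, 0 < a & x = a *: y.
Proof.
move=> x0 y0 /(congr1 (@S3_vec R)); rewrite !S3nE// => xy.
have sx : 0 < Num.sqrt (norm2 x) by rewrite sqrtr_gt0 norm2_gt0.
have sy : 0 < Num.sqrt (norm2 y) by rewrite sqrtr_gt0 norm2_gt0.
exists (Num.sqrt (norm2 x) / Num.sqrt (norm2 y)); first by rewrite divr_gt0.
by rewrite -scalerA -xy scalerA mulfV ?scale1r// gt_eqF.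
Qed.

Lemma smooths_norm2 m (U : set 'rV[R]_m) (Z : 'rV[R]_m -> 'rV[R]_4) : open U ->
  smooth_on U Z -> smooths U (fun p => norm2 (Z p)).
Proof.
move=> oU /smooth_onP sZ k; apply: Cks_sum => // j; apply: CksX => //.
exact: sZ.
Qed.

Lemma smooths_sqrt_norm2 m (U : set 'rV[R]_m) (Z : 'rV[R]_m -> 'rV[R]_4) : open U ->
  (forall p, U p -> Z p != 0) ->
  smooth_on U Z -> smooths U (fun p => (Num.sqrt (norm2 (Z p)))^-1).
Proof.
move=> oU Z0 sZ k; apply: CksV => // [p Up|].
  by rewrite gt_eqF// sqrtr_gt0 norm2_gt0// Z0.
apply: Cks_sqrt => // [p Up|]; first by rewrite norm2_gt0// Z0.
exact: smooths_norm2.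
Qed.

Lemma smooth_S3n m (U : set 'rV[R]_m) (Z : 'rV[R]_m -> 'rV[R]_4) : open U ->
  (forall p, U p -> Z p != 0) -> smooth_on U Z ->
  smooth_on U (@S3_vec R \o S3n \o Z).
Proof.
move=> oU Z0 sZ.
apply: (smooth_on_eq (f := fun p => (Num.sqrt (norm2 (Z p)))^-1 *: Z p)) => // [p Up|].
  by rewrite /= S3nE// Z0.
apply/smooth_onP => // j k.
apply: (Cks_eq (f := fun p => (Num.sqrt (norm2 (Z p)))^-1 * Z p ord0 j)) => // [p _|].
  by rewrite mxE.
apply: CksM => //; first exact: smooths_sqrt_norm2.
by move/smooth_onP : sZ; exact.
Qed.

Lemma smooth_on_id m (U : set 'rV[R]_m) : open U -> smooth_on U id.
Proof. by move=> oU; apply/smooth_onP => // j k; exact: Cks_coord. Qed.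

Lemma S3n_continuous m (U : set 'rV[R]_m) (Z : 'rV[R]_m -> 'rV[R]_4) p : open U ->
  (forall p, U p -> Z p != 0) -> smooth_on U Z -> U p ->
  {for p, continuous (S3n \o Z)}.
Proof.
by move=> oU Z0 sZ Up; apply/continuous_S3P;
  apply: smooth_on_continuous (smooth_S3n oU Z0 sZ) Up.
Qed.

Lemma S3_vec_continuous : continuous (@S3_vec R).
Proof. by move=> z; apply: (@continuous_S3P _ _ id z).1. Qed.

Lemma open_neq0 n : open [set x : 'rV[R]_n | x != 0].
Proof.
have -> : [set x : 'rV[R]_n | x != 0] = ~` [set 0].
  by apply/seteqP; split=> x /= /eqP.
rewrite openC; apply: accessible_closed_set1.
exact/hausdorff_accessible/norm_hausdorff.
Qed.

Lemma S3n_continuous_at z : {for S3_vec z, continuous S3n}.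
Proof.
apply: (@S3n_continuous _ [set x | x != 0] id) => //.
- exact: open_neq0.
- by apply: smooth_on_id; exact: open_neq0.
- exact: S3_vec_neq0.
Qed.

Lemma S3_hausdorff : hausdorff_space (S3 R).
Proof. exact: hausdorff_inj S3_vec_continuous S3_vec_inj (@norm_hausdorff _ 'rV[R]_4). Qed.

Lemma S3_second_countable : @second_countable (S3 R).
Proof. exact: embedded_second_countable S3_vec_continuous S3nK S3n_continuous_at. Qed.

End S3n.

(** * Orientation and charts of the sphere *)

(** The expansion is spelled out so that identities between determinants become
    polynomial identities. *)
Lemma det4 (K : comPzRingType) (f : nat -> nat -> K) :
  \det (\matrix_(i < 4, j < 4) f i j) =
    f 0 0 * (f 1 1 * (f 2 2 * f 3 3 - f 2 3 * f 3 2)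
           - f 1 2 * (f 2 1 * f 3 3 - f 2 3 * f 3 1)
           + f 1 3 * (f 2 1 * f 3 2 - f 2 2 * f 3 1))
  - f 0 1 * (f 1 0 * (f 2 2 * f 3 3 - f 2 3 * f 3 2)
           - f 1 2 * (f 2 0 * f 3 3 - f 2 3 * f 3 0)
           + f 1 3 * (f 2 0 * f 3 2 - f 2 2 * f 3 0))
  + f 0 2 * (f 1 0 * (f 2 1 * f 3 3 - f 2 3 * f 3 1)
           - f 1 1 * (f 2 0 * f 3 3 - f 2 3 * f 3 0)
           + f 1 3 * (f 2 0 * f 3 1 - f 2 1 * f 3 0))
  - f 0 3 * (f 1 0 * (f 2 1 * f 3 2 - f 2 2 * f 3 1)
           - f 1 1 * (f 2 0 * f 3 2 - f 2 2 * f 3 0)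
           + f 1 2 * (f 2 0 * f 3 1 - f 2 1 * f 3 0)).
Proof.
rewrite (expand_det_row _ ord0) !big_ord_recl big_ord0 /cofactor.
rewrite !(expand_det_row _ ord0) !big_ord_recl !big_ord0 /cofactor.
rewrite !(expand_det_row _ ord0) !big_ord_recl !big_ord0 /cofactor.
rewrite !det_mx11 !mxE /= /bump /=.
ring.
Qed.

Section frame.
Variable R : realType.
Implicit Types (Z Y : 'rV[R]_3 -> 'rV[R]_4) (p : 'rV[R]_3).

(** The sign of this determinant decides whether Z, if it is a parametrization of
    the sphere or of a surface star-shaped about 0, is positively oriented. *)
Definition frame Z p : R := \det (col_mx (Z p) ('J Z p) : 'M[R]_4).

Lemma jacE m n (Z : 'rV[R]_m -> 'rV[R]_n) (p : 'rV[R]_m) i j : differentiable Z p ->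
  'J Z p i j = 'D_(delta_mx ord0 i) (fun q => Z q ord0 j) p.
Proof.
move=> dZ; have := congr1 (fun M : 'rV_n => M ord0 j) (jac_row i dZ).
rewrite mxE => ->; rewrite derive_mx ?mxE//.
exact: diff_derivable.
Qed.

Lemma frame_near Z Y p : differentiable Z p -> differentiable Y p ->
  {near p, Z =1 Y} -> frame Z p = frame Y p.
Proof.
move=> dZ dY ZY; have E1 := nbhs_singleton ZY.
exact: (congr2 (fun (A : 'rV[R]_4) (B : 'M[R]_(3, 4)) => \det (col_mx A B : 'M[R]_4))
  E1 (jac_near dZ dY ZY)).
Qed.

(** The derivatives of nu only add multiples of the first row to the others. *)
Lemma frame_scale Z (nu : 'rV[R]_3 -> R) p :
  differentiable Z p -> differentiable nu p ->
  differentiable (fun q => nu q *: Z q) p ->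
  frame (fun q => nu q *: Z q) p = nu p ^+ 4 * frame Z p.
Proof.
move=> dZ dnu dnuZ.
pose d : 'cV[R]_3 := \col_i 'D_(delta_mx ord0 i) nu p.
have JE : 'J (fun q => nu q *: Z q) p = d *m Z p + nu p *: 'J Z p.
  apply/matrixP => i j; rewrite (jacE _ _ dnuZ) [RHS]mxE [X in _ = X + _]mxE.
  rewrite [X in _ = _ + X]mxE big_ord1 (jacE _ _ dZ) [d _ _]mxE.
  have -> : (fun q : 'rV[R]_3 => (nu q *: Z q) ord0 j) = nu * (fun q => Z q ord0 j).
    by apply/funext => q; rewrite mxE.
  rewrite deriveM; last 2 first.
  - exact: diff_derivable.
  - by have /derivable_mxP := diff_derivable (v := delta_mx ord0 i) dZ; exact.
  by rewrite addrC; congr (_ + _); exact: mulrC.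
rewrite /frame JE.
have -> : (col_mx (nu p *: Z p) (d *m Z p + nu p *: 'J Z p) : 'M[R]_4) =
  (block_mx (nu p)%:M 0 d (nu p)%:M : 'M[R]_(1 + 3)) *m col_mx (Z p) ('J Z p).
  by rewrite mul_block_col !mul_scalar_mx mul0mx addr0.
rewrite det_mulmx; congr (_ * _).
have -> := @det_lblock R 1 3 (nu p)%:M d (nu p)%:M.
by rewrite !det_scalar -exprD.
Qed.

(** The chain rule multiplies the matrix on the left by the block diagonal matrix
    with blocks 1 and the Jacobian matrix of tau. *)
Lemma frame_comp (psi : 'rV[R]_3 -> 'rV[R]_4) (tau : 'rV[R]_3 -> 'rV[R]_3) p :
  differentiable tau p -> differentiable psi (tau p) ->
  frame (psi \o tau) p = \det ('J tau p) * frame psi (tau p).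
Proof.
move=> dt dp; rewrite /frame (jac_comp dt dp).
have -> : (col_mx ((psi \o tau) p) ('J tau p *m 'J psi (tau p)) : 'M[R]_4) =
  (block_mx 1%:M 0 0 ('J tau p) : 'M[R]_(1 + 3)) *m col_mx (psi (tau p)) ('J psi (tau p)).
  by rewrite mul_block_col mul1mx !mul0mx addr0 add0r.
rewrite det_mulmx; congr (_ * _).
have -> := @det_lblock R 1 3 1%:M 0 ('J tau p).
by rewrite det1 mul1r.
Qed.

Lemma frameE Z (f : nat -> nat -> R) p : differentiable Z p ->
  (forall j : 'I_4, Z p ord0 j = f 0 j) ->
  (forall (i : 'I_3) (j : 'I_4), 'D_(delta_mx ord0 i) (fun q => Z q ord0 j) p = f i.+1 j) ->
  frame Z p = \det (\matrix_(i < 4, j < 4) f i j).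
Proof.
move=> dZ Z0 Zi; rewrite /frame; congr (\det _); apply/matrixP => i j.
rewrite [RHS]mxE; case: (splitP (i : 'I_(1 + 3))) => k ik.
  have -> : i = lshift 3 k :> 'I_(1+3) by apply/val_inj.
  have -> := @col_mxEu R 1 3 4 (Z p) ('J Z p) k j.
  by rewrite (ord1 k) Z0.
have -> : i = rshift 1 k :> 'I_(1+3) by apply/val_inj.
have -> := @col_mxEd R 1 3 4 (Z p) ('J Z p) k j.
by rewrite (jacE k j dZ) Zi.
Qed.

End frame.

Section charts.
Variable R : realType.
Implicit Types (c : chart R 3 (S3 R)) (U : set 'rV[R]_3) (f : 'rV[R]_3 -> S3 R).

Lemma chart_pull_open c U f : S3_atlas c -> open U ->
  (forall p, U p -> {for p, continuous f}) ->
  open (U `&` [set p | chart_dom c (f p)]).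
Proof.
move=> [[od _ _ _ _] _ _ _] oU cf; rewrite openE => p [Up dp].
apply: filterI; first exact: open_nbhs_nbhs.
by apply: (cf p Up); exact: open_nbhs_nbhs.
Qed.

Lemma smooth_S3_continuous U f p : smooth_on U (@S3_vec R \o f) -> U p ->
  {for p, continuous f}.
Proof. by move=> sf Up; apply/continuous_S3P; exact: smooth_on_continuous sf Up. Qed.

(** Maps into the sphere are smooth as soon as they are so in ambient coordinates,
    since a chart extends locally to a smooth map of R^4. *)
Lemma chart_smooth c U f : S3_atlas c -> open U -> smooth_on U (@S3_vec R \o f) ->
  smooth_on (U `&` [set p | chart_dom c (f p)]) (to_coord c \o f).
Proof.
move=> Ac oU sf.
have oV := chart_pull_open Ac oU (fun p => smooth_S3_continuous (p := p) sf).
apply: smooth_on_local => p Vp; have [Up dp] := Vp.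
have [_ _ loc _] := Ac; have [W [g [oW Wp sg gE]]] := loc _ dp.
pose V' := (U `&` [set p | chart_dom c (f p)]) `&` [set q | W (S3_vec (f q))].
have oV' : open V'.
  rewrite openE => q [Vq Wq]; apply: filterI; first exact: open_nbhs_nbhs.
  by apply: (smooth_on_continuous sf Vq.1); exact: open_nbhs_nbhs.
exists V'; split=> //.
apply: (smooth_on_eq (f := g \o (@S3_vec R \o f))) => // [q [[_ dq] Wq]|].
  exact: gE.
apply: (smooth_on_comp oV' oW _ _ sg) => [q [] //|].
by apply: (smooth_on_sub oV' oU _ sf) => q [[]].
Qed.

(** The map f is the composite of its expression in the chart c with the
    parametrization inverse to c, to which [frame_comp] applies. *)
Lemma chart_frame c U f p : S3_atlas c -> open U -> smooth_on U (@S3_vec R \o f) ->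
  U p -> chart_dom c (f p) ->
  frame (@S3_vec R \o f) p =
  \det ('J (to_coord c \o f) p) * frame (@S3_vec R \o of_coord c) (to_coord c (f p)).
Proof.
move=> Ac oU sf Up dp.
have sV := chart_smooth Ac oU sf.
have oV := chart_pull_open Ac oU (fun p => smooth_S3_continuous (p := p) sf).
have [[od oi cK _ _] spsi _ _] := Ac.
have Vp : (U `&` [set p | chart_dom c (f p)]) p by [].
have ip : chart_img c (to_coord c (f p)) by exists (f p).
have dt := smooth_on_diff oV sV Vp.
have dpsi := smooth_on_diff oi spsi ip.
apply: (etrans _ (frame_comp dt dpsi)).
have df := smooth_on_diff oU sf Up.
apply: (frame_near df (differentiable_comp dt dpsi)).
by apply: filterS (open_nbhs_nbhs (conj oV Vp)) => q [_ dq] /=; rewrite cK.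
Qed.

Lemma chart_jac_pos c U f p : S3_atlas c -> open U -> smooth_on U (@S3_vec R \o f) ->
  U p -> chart_dom c (f p) -> 0 < frame (@S3_vec R \o f) p ->
  0 < \det ('J (to_coord c \o f) p).
Proof.
move=> Ac oU sf Up dp; rewrite (chart_frame Ac oU sf Up dp) pmulr_lgt0//.
by have [_ _ _] := Ac; apply; exists (f p).
Qed.

Lemma chart_jac_neq0 c U f p : S3_atlas c -> open U -> smooth_on U (@S3_vec R \o f) ->
  U p -> chart_dom c (f p) -> frame (@S3_vec R \o f) p != 0 ->
  \det ('J (to_coord c \o f) p) != 0.
Proof.
move=> Ac oU sf Up dp; rewrite (chart_frame Ac oU sf Up dp).
by apply: contraNneq => ->; rewrite mul0r.
Qed.

Lemma frame_S3n U (Z : 'rV[R]_3 -> 'rV[R]_4) p : open U ->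
  (forall p, U p -> Z p != 0) -> smooth_on U Z -> U p ->
  frame (@S3_vec R \o @S3n R \o Z) p =
  (Num.sqrt (norm2 (Z p)))^-1 ^+ 4 * frame Z p.
Proof.
move=> oU Z0 sZ Up.
have E q : U q -> (@S3_vec R \o @S3n R \o Z) q = (Num.sqrt (norm2 (Z q)))^-1 *: Z q.
  by move=> Uq; rewrite /= S3nE// Z0.
have sN := smooth_S3n oU Z0 sZ.
have dN := smooth_on_diff oU sN Up.
have sN' : smooth_on U (fun q => (Num.sqrt (norm2 (Z q)))^-1 *: Z q).
  exact: smooth_on_eq oU E sN.
have dN' := smooth_on_diff oU sN' Up.
have dZ := smooth_on_diff oU sZ Up.
have dnu := Cks_diff oU (smooths_sqrt_norm2 oU Z0 sZ 1) Up.
apply: (etrans _ (frame_scale dZ dnu dN')).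
apply: (frame_near dN dN').
by apply: filterS (open_nbhs_nbhs (conj oU Up)) => q; exact: E.
Qed.

Lemma frame_S3n_gt0 U (Z : 'rV[R]_3 -> 'rV[R]_4) p : open U ->
  (forall p, U p -> Z p != 0) -> smooth_on U Z -> U p ->
  (0 < frame (@S3_vec R \o @S3n R \o Z) p) = (0 < frame Z p).
Proof.
move=> oU Z0 sZ Up; rewrite (frame_S3n oU Z0 sZ Up) pmulr_rgt0// exprn_gt0//.
by rewrite invr_gt0 sqrtr_gt0 norm2_gt0// Z0.
Qed.

Lemma frame_S3n_neq0 U (Z : 'rV[R]_3 -> 'rV[R]_4) p : open U ->
  (forall p, U p -> Z p != 0) -> smooth_on U Z -> U p ->
  (frame (@S3_vec R \o @S3n R \o Z) p != 0) = (frame Z p != 0).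
Proof.
move=> oU Z0 sZ Up; rewrite (frame_S3n oU Z0 sZ Up) mulf_eq0 expf_eq0 /= invr_eq0.
by rewrite gt_eqF// sqrtr_gt0 norm2_gt0// Z0.
Qed.

End charts.

(** * Stereographic charts *)

Section pointwise.
Variables (R : realType) (m : nat).
Implicit Types (f g : 'rV[R]_m -> R) (p v : 'rV[R]_m).

Lemma isd_cst (c : R) p v : is_derive p v (fun=> c) 0.
Proof. exact: is_derive_cst. Qed.

Lemma isdD f g p v (df dg : R) : is_derive p v f df -> is_derive p v g dg ->
  is_derive p v (fun q => f q + g q) (df + dg).
Proof. exact: is_deriveD. Qed.

Lemma isdM f g p v (df dg : R) : is_derive p v f df -> is_derive p v g dg ->
  is_derive p v (fun q => f q * g q) (f p * dg + g p * df).
Proof. exact: is_deriveM. Qed.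

Lemma isdN f p v (df : R) : is_derive p v f df ->
  is_derive p v (fun q => - f q) (- df).
Proof. exact: is_deriveN. Qed.

Lemma isd_cos f p v (df : R) : is_derive p v f df ->
  is_derive p v (fun q => cos (f q)) (- sin (f p) * df).
Proof.
by move=> [d <-]; apply: is_derive_comp1.
Qed.

Lemma isd_sin f p v (df : R) : is_derive p v f df ->
  is_derive p v (fun q => sin (f q)) (cos (f p) * df).
Proof.
by move=> [d <-]; apply: is_derive_comp1.
Qed.

Lemma isd_sqrt f p v (df : R) : 0 < f p -> is_derive p v f df ->
  is_derive p v (fun q => Num.sqrt (f q)) ((2 * Num.sqrt (f p))^-1 * df).
Proof.
by move=> f0 [d <-]; apply: is_derive_comp1 => //; exact: is_derive1_sqrt.
Qed.

Lemma smooth_vec4 (U : set 'rV[R]_m) (a b c d : 'rV[R]_m -> R) : open U ->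
  smooths U a -> smooths U b -> smooths U c -> smooths U d ->
  smooth_on U (fun p => vec4 (a p) (b p) (c p) (d p)).
Proof.
move=> oU sa sb sc sd; apply/smooth_onP => // j k.
apply: (Cks_eq (f := nth (fun=> 0) [:: a; b; c; d] j)) => // [p _|].
  by rewrite mxE; case: j => -[|[|[|[|]]]].
by case: j => -[|[|[|[|]]]].
Qed.

End pointwise.

Lemma frame_vec4 (R : realType) (U : set 'rV[R]_3) (a b c d : 'rV[R]_3 -> R)
    (da db dc dd : 'rV[R]_3 -> R) p : open U -> U p ->
  smooth_on U (fun p => vec4 (a p) (b p) (c p) (d p)) ->
  (forall v, is_derive p v a (da v)) -> (forall v, is_derive p v b (db v)) ->
  (forall v, is_derive p v c (dc v)) -> (forall v, is_derive p v d (dd v)) ->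
  frame (fun p => vec4 (a p) (b p) (c p) (d p)) p =
  let e (i : 'I_3) : 'rV[R]_3 := delta_mx ord0 i in
  \det (\matrix_(i < 4, j < 4) nth 0 (nth [::]
    [:: [:: a p; b p; c p; d p];
        [:: da (e 0); db (e 0); dc (e 0); dd (e 0)];
        [:: da (e 1); db (e 1); dc (e 1); dd (e 1)];
        [:: da (e 2); db (e 2); dc (e 2); dd (e 2)]] i) j).
Proof.
move=> oU Up sZ Da Db Dc Dd.
apply: (frameE (f := fun i j : nat => nth 0 (nth [::] _ i) j)).
- exact: smooth_on_diff oU sZ Up.
- by move=> j; rewrite mxE.
move=> i j.
have -> : (fun q => vec4 (a q) (b q) (c q) (d q) ord0 j) = nth (fun=> 0) [:: a; b; c; d] j.
  by apply/funext => q; rewrite mxE; case: j => -[|[|[|[|]]]].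
pose w : 'rV[R]_3 := delta_mx ord0 i; rewrite -/w.
transitivity (nth 0 [:: da w; db w; dc w; dd w] j).
  case: j => -[|[|[|[|]]]]//= _.
  - by have [] := Da w.
  - by have [] := Db w.
  - by have [] := Dc w.
  - by have [] := Dd w.
have -> : w = delta_mx ord0 (nth 0 [:: 0; 1; 2] i).
  by congr (delta_mx ord0 _); case: i {w} => -[|[|[|]]]//= lti; exact/val_inj.
by case: i {w} => -[|[|[|]]].
Qed.

Section stereo.
Variables (R : realType) (s : R).
Hypothesis s1 : s ^+ 2 = 1.
Implicit Types (q : 'rV[R]_3) (x : S3 R).

Definition sq3 q : R := q ord0 0 ^+ 2 + q ord0 1 ^+ 2 + q ord0 2 ^+ 2.

Definition stereo_vec q :=
  vec4 (2 * q ord0 0) (2 * q ord0 1) (2 * (s * q ord0 2)) (s * (sq3 q - 1)).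

(** The inverse of the projection from the pole (0, 0, 0, s). The sign s in the
    third coordinate makes both of these charts positive. *)
Definition stereo : chart R 3 (S3 R) :=
  Chart [set x | 1 - s * S3_vec x ord0 3 != 0]
    (fun x => (1 - s * S3_vec x ord0 3)^-1 *: \row_(j < 3)
       nth 0 [:: S3_vec x ord0 0; S3_vec x ord0 1; s * S3_vec x ord0 2] j)
    (@S3n R \o stereo_vec).

Lemma sq3_ge0 q : 0 <= sq3 q.
Proof. by rewrite /sq3 !addr_ge0// sqr_ge0. Qed.

Lemma norm2_stereo_vec q : norm2 (stereo_vec q) = (sq3 q + 1) ^+ 2.
Proof.
rewrite norm2E !mxE /=; have := s1; rewrite /sq3.
set a := q _ _; set b := q _ _; set c := q _ _ => ss.
transitivity (4 * a ^+ 2 + 4 * b ^+ 2 + s ^+ 2 * (4 * c ^+ 2 + (a ^+ 2 + b ^+ 2 + c ^+ 2 - 1) ^+ 2)).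
  by ring.
by rewrite ss; ring.
Qed.

Lemma sqrt_stereo_vec q : Num.sqrt (norm2 (stereo_vec q)) = sq3 q + 1.
Proof. by rewrite norm2_stereo_vec sqrtr_sqr ger0_norm// addr_ge0// sq3_ge0. Qed.

Lemma stereo_vec_neq0 q : stereo_vec q != 0.
Proof.
apply/eqP => z0; have := norm2_stereo_vec q; rewrite z0 /norm2 big1.
  by move=> /esym/eqP; rewrite expf_eq0 /= gt_eqF// ltr_wpDl// sq3_ge0.
by move=> j _; rewrite mxE expr0n.
Qed.

Lemma smooth_stereo_vec (U : set 'rV[R]_3) : open U -> smooth_on U stereo_vec.
Proof.
move=> oU; have sc j : smooths U (fun q => q ord0 j) by move=> k; exact: Cks_coord.
have cc a : smooths U (fun=> a) by move=> k; exact: Cks_cst.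
have ssq : smooths U sq3.
  by move=> k; apply: CksD => //; [apply: CksD => //|]; apply: CksX => //; exact: sc.
apply: smooth_vec4 => // k; apply: CksM => //; try exact: cc; try exact: sc.
  by apply: CksM => //; [exact: cc | exact: sc].
exact: CksD oU (ssq k) (cc _ k).
Qed.

Lemma stereoE q j : S3_vec (of_coord stereo q) ord0 j = stereo_vec q ord0 j / (sq3 q + 1).
Proof. by rewrite /= S3nE ?stereo_vec_neq0// sqrt_stereo_vec mxE mulrC. Qed.

Lemma stereo_dom_of q : chart_dom stereo (of_coord stereo q).
Proof.
rewrite /chart_dom/= -[S3n _]/(of_coord stereo q) stereoE mxE /=.
have q0 : sq3 q + 1 != 0 by rewrite gt_eqF// ltr_wpDl// sq3_ge0.
have -> : 1 - s * (s * (sq3 q - 1) / (sq3 q + 1)) = 2 / (sq3 q + 1).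
  transitivity ((sq3 q + 1 - s ^+ 2 * (sq3 q - 1)) / (sq3 q + 1)); first by field.
  by rewrite s1; congr (_ / _); ring.
by rewrite mulf_neq0// ?invr_eq0.
Qed.

Lemma stereo_to_of q : to_coord stereo (of_coord stereo q) = q.
Proof.
have q0 : sq3 q + 1 != 0 by rewrite gt_eqF// ltr_wpDl// sq3_ge0.
have E : 1 - s * (s * (sq3 q - 1) / (sq3 q + 1)) = 2 / (sq3 q + 1).
  transitivity ((sq3 q + 1 - s ^+ 2 * (sq3 q - 1)) / (sq3 q + 1)); first by field.
  by rewrite s1; congr (_ / _); ring.
have C i : S3_vec (S3n (stereo_vec q)) ord0 i = stereo_vec q ord0 i / (sq3 q + 1) := stereoE q i.
apply/rowP => j; rewrite [LHS]mxE [X in _ * X]mxE /= !C !mxE /= E.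
have E2 : s * (2 * (s * q ord0 2) / (sq3 q + 1)) = 2 * q ord0 2 / (sq3 q + 1).
  transitivity (s ^+ 2 * (2 * q ord0 2 / (sq3 q + 1))); first by field.
  by rewrite s1 mul1r.
rewrite E2; case: j => -[|[|[|]]]//= lj; set j := Ordinal lj.
- by have -> : j = 0 by [exact/val_inj]; field; rewrite q0.
- by have -> : j = 1 by [exact/val_inj]; field; rewrite q0.
- by have -> : j = 2 by [exact/val_inj]; field; rewrite q0.
Qed.

Lemma stereo_of_to x : chart_dom stereo x -> of_coord stereo (to_coord stereo x) = x.
Proof.
rewrite /chart_dom /= => d0.
have n1 := norm2_S3_vec x; rewrite norm2E in n1.
have X0 := S3_vec_neq0 x; have XK := S3nK x.
move: (S3_vec x) d0 n1 X0 XK => X d0 n1 X0 XK; set d := 1 - s * X ord0 3 in d0 *.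
have d_gt0 : 0 < d.
  rewrite lt_def d0 /d /= subr_ge0.
  have : (s * X ord0 3) ^+ 2 <= 1.
    rewrite exprMn s1 mul1r -n1.
    have := sqr_ge0 (X ord0 0); have := sqr_ge0 (X ord0 1); have := sqr_ge0 (X ord0 2).
    by lra.
  by move: (s * X ord0 3) => y y1; nra.
have -> : stereo_vec (d^-1 *: \row_j nth 0 [:: X ord0 0; X ord0 1; s * X ord0 2] j) = (2 / d) *: X.
  apply/rowP => j; rewrite [RHS]mxE mxE /sq3 !mxE /=.
  have E2 : 2 * (s * (d^-1 * (s * X ord0 2))) = 2 / d * X ord0 2.
    transitivity (s ^+ 2 * (2 / d * X ord0 2)); first by ring.
    by rewrite s1 mul1r.
  have E3 : s * ((d^-1 * X ord0 0) ^+ 2 + (d^-1 * X ord0 1) ^+ 2 + (d^-1 * (s * X ord0 2)) ^+ 2 - 1) = 2 / d * X ord0 3.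
    transitivity (s * ((X ord0 0 ^+ 2 + X ord0 1 ^+ 2 + s ^+ 2 * X ord0 2 ^+ 2) / d ^+ 2 - 1)); first by field.
    rewrite s1 mul1r.
    have -> : X ord0 0 ^+ 2 + X ord0 1 ^+ 2 + X ord0 2 ^+ 2 = d * (1 + s * X ord0 3).
      rewrite /d; transitivity (1 - s ^+ 2 * X ord0 3 ^+ 2); last by ring.
      by rewrite s1 mul1r; lra.
    transitivity ((s * (1 + s * X ord0 3 - d)) / d); first by field.
    rewrite /d; transitivity (s ^+ 2 * (2 * X ord0 3) / (1 - s * X ord0 3)); first by ring.
    by rewrite s1; ring.
  rewrite E2 E3; case: j => -[|[|[|[|]]]]//= lj; set j := Ordinal lj.
  - by have -> : j = 0 by [exact/val_inj]; ring.
  - by have -> : j = 1 by [exact/val_inj]; ring.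
  - by have -> : j = 2 by [exact/val_inj].
  - by have -> : j = 3 by [exact/val_inj].
by rewrite S3nZ ?divr_gt0.
Qed.

Lemma stereo_img : chart_img stereo = setT.
Proof.
apply/seteqP; split=> // q _; exists (of_coord stereo q); first exact: stereo_dom_of.
exact: stereo_to_of.
Qed.

Definition off_pole : set 'rV[R]_4 := [set y | 1 - s * y ord0 3 != 0].

Definition stereo_amb (y : 'rV[R]_4) : 'rV[R]_3 :=
  (1 - s * y ord0 3)^-1 *: \row_(j < 3) nth 0 [:: y ord0 0; y ord0 1; s * y ord0 2] j.

Lemma open_stereo_amb : open off_pole.
Proof.
have -> : off_pole = (fun y : 'rV[R]_4 => 1 - s * y ord0 3) @^-1` [set x : R | x != 0] by [].
apply: open_comp; last first.
  have -> : [set x : R | x != 0] = ~` [set 0] by apply/seteqP; split=> x /= /eqP.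
  by rewrite openC; apply: accessible_closed_set1; exact/hausdorff_accessible/norm_hausdorff.
have c : Cks 0 setT (fun y : 'rV[R]_4 => 1 - s * y ord0 3).
  have oT : open [set: 'rV[R]_4] := openT.
  exact: CksD oT (Cks_cst _ _ _) (CksN oT (CksM oT (Cks_cst _ _ _) (Cks_coord _ _ oT))).
by move=> y _; exact: Cks_continuous c I.
Qed.

Lemma smooth_stereo_amb : smooth_on off_pole stereo_amb.
Proof.
have oW := open_stereo_amb; apply/smooth_onP => // j k.
have sc j' : Cks k off_pole (fun y => y ord0 j').
  exact: Cks_coord.
have cc (a : R) : Cks k off_pole (fun=> a) by exact: Cks_cst.
apply: (Cks_eq (f := fun y => (1 + - (s * y ord0 3))^-1 *
   nth (fun=> 0) [:: (fun y => y ord0 0); (fun y => y ord0 1); (fun y => s * y ord0 2)] j y)) => //.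
  by move=> y _; rewrite !mxE; case: j => -[|[|[|]]].
apply: CksM => //.
  apply: CksV => //; apply: CksD => //; apply: CksN => //; exact: CksM.
case: j => -[|[|[|]]]//= _; exact: CksM.
Qed.

Lemma frame_stereo q : 0 < frame stereo_vec q.
Proof.
have sZ : smooth_on setT stereo_vec by apply: smooth_stereo_vec; exact: openT.
have Dq i v := is_derive_rVcoord q v i.
have Da i v := isdM (isd_cst 2 q v) (Dq i v).
have Dc v := isdM (isd_cst 2 q v) (isdM (isd_cst s q v) (Dq 2 v)).
have Dd v := isdM (isd_cst s q v) (isdD (isdD (isdD (isdM (Dq 0 v) (Dq 0 v))
  (isdM (Dq 1 v) (Dq 1 v))) (isdM (Dq 2 v) (Dq 2 v))) (isd_cst (-1) q v)).
have /= -> := frame_vec4 openT I sZ (Da 0) (Da 1) Dc Dd.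
rewrite (det4 (fun i j => nth 0 (nth [::] _ i) j)) /=.
have E (i j : 'I_3) : (delta_mx ord0 i : 'rV[R]_3) ord0 j = (j == i)%:R by rewrite mxE eqxx.
rewrite !E /=.
set D := (X in 0 < X).
have -> : D = s ^+ 2 * (8 * (sq3 q + 1)) by rewrite /D /sq3; ring.
by rewrite s1 mul1r mulr_gt0// ltr_wpDl// sq3_ge0.
Qed.

Lemma stereo_atlas : S3_atlas stereo.
Proof.
have of_cont q : {for q, continuous (of_coord stereo)}.
  apply: (@S3n_continuous _ _ setT) => //; first exact: openT.
    by move=> p _; exact: stereo_vec_neq0.
  by apply: smooth_stereo_vec; exact: openT.
have amb x : to_coord stereo x = stereo_amb (S3_vec x) by [].
have domE : chart_dom stereo = @S3_vec R @^-1` off_pole by [].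
have psi_smooth : smooth_on setT (@S3_vec R \o of_coord stereo).
  apply: smooth_S3n; [exact: openT|by move=> p _; exact: stereo_vec_neq0|].
  by apply: smooth_stereo_vec; exact: openT.
split.
- split.
  + rewrite domE; apply: open_comp open_stereo_amb => x _; exact: S3_vec_continuous.
  + by rewrite stereo_img; exact: openT.
  + exact: stereo_of_to.
  + move=> x dx; have cs := smooth_on_continuous smooth_stereo_amb dx.
    exact: (@continuous_comp _ _ _ (@S3_vec R) stereo_amb x (@S3_vec_continuous R x) cs).
  + by move=> p _; exact: of_cont.
- by rewrite stereo_img.
- move=> x dx; exists off_pole, stereo_amb; split=> //.
    exact: open_stereo_amb.
  exact: smooth_stereo_amb.
move=> p _; rewrite -/(frame _ p) (@frame_S3n_gt0 _ setT)//.
- exact: frame_stereo.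
- exact: openT.
- by move=> q _; exact: stereo_vec_neq0.
- by apply: smooth_stereo_vec; exact: openT.
Qed.

End stereo.

Section S3_manifold.
Variable R : realType.

Lemma S3_cover (x : S3 R) : exists2 c, @S3_atlas R c & chart_dom c x.
Proof.
have [x3|x3] := eqVneq (1 - 1 * S3_vec x ord0 3) 0; last first.
  by exists (stereo 1); [apply: stereo_atlas; rewrite expr1n | exact: x3].
exists (stereo (-1)); first by apply: stereo_atlas; rewrite sqrrN expr1n.
rewrite /chart_dom /=; move/eqP: x3; rewrite mul1r subr_eq0 => /eqP <-.
by rewrite mulN1r opprK (eqr_nat R 2 0).
Qed.

(** A transition map is the expression in the chart d of the parametrization
    inverse to c, whose frame is positive. *)
Lemma S3_transition (c d : chart R 3 (S3 R)) : S3_atlas c -> S3_atlas d ->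
  smooth_on (local_dom c d id) (local_expr c d id) /\
  pos_jacobian_on (local_dom c d id) (local_expr c d id).
Proof.
move=> Ac Ad; have [[_ oi _ _ _] spsi _ fpos] := Ac.
split; first exact: chart_smooth Ad oi spsi.
by move=> p [ip dp]; apply: (chart_jac_pos Ad oi spsi ip dp); exact: fpos.
Qed.

Lemma S3_oriented_manifold : oriented_manifold (@S3_atlas R).
Proof.
split; [exact: S3_hausdorff | exact: S3_second_countable |].
split; [by move=> c [] | exact: S3_cover | exact: S3_transition].
Qed.

End S3_manifold.

(** * Triangles inscribed in the unit circle *)

Section modulus.
Variable R : realType.
Local Notation C := R[i].
Local Notation cj := (@conjc R).
Implicit Types (x y z u v w e q h k : C).

Lemma ReM x y : complex.Re (x * y) = complex.Re x * complex.Re y - complex.Im x * complex.Im y.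
Proof. by case: x y => a b [c d]; simpc. Qed.
Lemma ImM x y : complex.Im (x * y) = complex.Re x * complex.Im y + complex.Im x * complex.Re y.
Proof. by case: x y => a b [c d]; simpc. Qed.

(** Instances of the morphism laws for conjugation and for the inclusion of R, for
    rewriting: the general laws also match powers and moduli, after unfolding. *)
Lemma cjM x y : cj (x * y) = cj x * cj y. Proof. exact: rmorphM. Qed.
Lemma cjD x y : cj (x + y) = cj x + cj y. Proof. exact: rmorphD. Qed.
Lemma cjN x : cj (- x) = - cj x. Proof. exact: rmorphN. Qed.
Lemma cjX x n : cj (x ^+ n) = cj x ^+ n. Proof. exact: rmorphXn. Qed.
Lemma cjV x : cj x^-1 = (cj x)^-1. Proof. exact: conjc_inv. Qed.
Lemma cjr (a : R) : cj a%:C%C = a%:C%C. Proof. exact: conjc_real. Qed.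
Lemma cjn n : cj n%:R = n%:R :> C. Proof. exact: rmorph_nat. Qed.
Lemma cj1 : cj 1 = 1 :> C. Proof. exact: rmorph1. Qed.

Lemma rcM (a b : R) : (a * b)%:C%C = a%:C%C * b%:C%C :> C. Proof. exact: rmorphM. Qed.
Lemma rcD (a b : R) : (a + b)%:C%C = a%:C%C + b%:C%C :> C. Proof. exact: rmorphD. Qed.
Lemma rcN (a : R) : (- a)%:C%C = - a%:C%C :> C. Proof. exact: rmorphN. Qed.
Lemma rcX (a : R) n : (a ^+ n)%:C%C = a%:C%C ^+ n :> C. Proof. exact: rmorphXn. Qed.
Lemma rcV (a : R) : (a^-1)%:C%C = a%:C%C^-1 :> C. Proof. exact: fmorphV. Qed.
Lemma rcn n : (n%:R : R)%:C%C = n%:R :> C. Proof. exact: rmorph_nat. Qed.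
Lemma rc1 : (1 : R)%:C%C = 1 :> C. Proof. exact: rmorph1. Qed.

Definition nsq x : R := complex.Re x ^+ 2 + complex.Im x ^+ 2.

Lemma nsqE x : (nsq x)%:C%C = x * cj x.
Proof. by case: x => a b; rewrite /nsq /=; simpc; congr (_ +i* _)%C; ring. Qed.

Lemma nsqM x y : nsq (x * y) = nsq x * nsq y.
Proof. by apply: complexI; rewrite rmorphM /= !nsqE rmorphM /=; ring. Qed.

Lemma nsq_ge0 x : 0 <= nsq x.
Proof. by rewrite addr_ge0// sqr_ge0. Qed.

Lemma nsq_eq0 x : (nsq x == 0) = (x == 0).
Proof. by rewrite paddr_eq0 ?sqr_ge0// !sqrf_eq0 eq_complex. Qed.

Lemma nsq_gt0 x : (0 < nsq x) = (x != 0).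
Proof. by rewrite lt_def nsq_ge0 andbT nsq_eq0. Qed.

Lemma nsqJ x : nsq (cj x) = nsq x.
Proof. by case: x => a b; rewrite /nsq /= sqrrN. Qed.

Lemma nsqN x : nsq (- x) = nsq x.
Proof. by case: x => a b; rewrite /nsq /= !sqrrN. Qed.

Lemma nsq1 : nsq 1 = 1.
Proof. by rewrite /nsq /= expr1n expr0n addr0. Qed.

Lemma nsq0 : nsq 0 = 0.
Proof. by rewrite /nsq /= expr0n addr0. Qed.

Lemma nsqX x n : nsq (x ^+ n) = nsq x ^+ n.
Proof. by elim: n => [|n IH]; rewrite ?expr0 ?nsq1// !exprS nsqM IH. Qed.

Lemma nsqV x : nsq x^-1 = (nsq x)^-1.
Proof.
have [->|x0] := eqVneq x 0; first by rewrite invr0 nsq0 invr0.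
have nx0 : nsq x != 0 by rewrite nsq_eq0.
by apply: (mulfI nx0); rewrite -nsqM !mulfV// nsq1.
Qed.

Lemma nsqr (a : R) : nsq a%:C%C = a ^+ 2.
Proof. by rewrite /nsq /= expr0n addr0. Qed.

Lemma nsq1P x : nsq x = 1 -> [/\ x * cj x = 1, cj x = x^-1 & x != 0].
Proof.
move=> x1; have xc : x * cj x = 1 by rewrite -nsqE x1.
have x0 : x != 0 by rewrite -nsq_gt0 x1.
by split=> //; apply: (mulfI x0); rewrite xc mulfV.
Qed.

Lemma nsq_sqrtc x : nsq x = 1 -> nsq (sqrtc x) = 1.
Proof.
move=> x1; have : nsq (sqrtc x) ^+ 2 = 1 by rewrite -nsqX sqr_sqrtc.
move=> /eqP; rewrite sqrf_eq1 => /orP[/eqP //|/eqP E].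
by have := nsq_ge0 (sqrtc x); rewrite E; lra.
Qed.

Lemma sqr_eq x y : x ^+ 2 = y ^+ 2 -> x = y \/ x = - y.
Proof. by move/eqP; rewrite eqf_sqr => /orP[/eqP|/eqP]; [left|right]. Qed.

End modulus.

Section orth.
Variable R : realType.
Local Notation C := R[i].
Local Notation cj := (@conjc R).
Implicit Types (x y z u v w e q h k : C).

Lemma conj_e1 u v w : nsq u = 1 -> nsq v = 1 -> nsq w = 1 ->
  u * v + v * w + w * u = u * v * w * cj (u + v + w).
Proof.
move=> /nsq1P[_ cu u0] /nsq1P[_ cv v0] /nsq1P[_ cw w0].
by rewrite !rmorphD /= cu cv cw; field; rewrite u0 v0 w0.
Qed.

(** If |u| = |v| = |w| = 1 then u + v + w is the orthocentre of the triangle u, v, w.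
    By this formula it lies on the unit circle if and only if two vertices are
    opposite. *)
Lemma nsq_e1 u v w : nsq u = 1 -> nsq v = 1 -> nsq w = 1 ->
  (nsq (u + v + w))%:C%C - 1 = (u + v) * (v + w) * (w + u) / (u * v * w).
Proof.
move=> /nsq1P[_ cu u0] /nsq1P[_ cv v0] /nsq1P[_ cw w0].
by rewrite nsqE !rmorphD /= cu cv cw; field; rewrite u0 v0 w0.
Qed.

(** Reversing one vertex of a triangle with orthocentre in the closed disc moves
    the orthocentre out of it, unless the other two vertices are opposite. *)
Lemma nsq_flip u v w : nsq u = 1 -> nsq v = 1 -> nsq w = 1 ->
  nsq (u + v + w) + nsq (- u + v + w) = 2 + 2 * nsq (v + w).
Proof.
move=> /nsq1P[_ cu u0] /nsq1P[_ cv v0] /nsq1P[_ cw w0].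
apply: complexI; rewrite rmorphD /= !nsqE [RHS]rmorphD /= [X in _ = _ + X]rmorphM /= nsqE !(rmorphD, rmorphN) /= cu cv cw.
rewrite ?rmorph_nat ?rmorph1.
by field; rewrite u0 v0 w0.
Qed.

Lemma opposite_of_flip u v w : nsq u = 1 -> nsq v = 1 -> nsq w = 1 ->
  nsq (u + v + w) <= 1 -> nsq (- u + v + w) <= 1 -> w = - v.
Proof.
move=> u1 v1 w1 q1 q2; have := nsq_flip u1 v1 w1 => E.
have : nsq (v + w) = 0 by have := nsq_ge0 (v + w); lra.
by move/eqP; rewrite nsq_eq0 addrC addr_eq0 => /eqP.
Qed.

(** If q and e are the sum and the product of square roots u, v, w of three points,
    then eq and e^2 - e q^3 do not change if (u, v, w) is replaced by its opposite.
    When the three points are multiplied by l = k^2 the former is multiplied by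
    k^4 = l^2 and the conjugate of the latter by k^-6 = l^-3, as the two coordinates
    of the sphere are. The positive factor 1 + |q|^2 is what makes [ratio_mono]
    true. *)
Definition Z1 e q : C := e * q * (1 + q * cj q).
Definition Z2 e q : C := cj (e ^+ 2 - e * q ^+ 3).

Lemma Z1N e q : Z1 (- e) (- q) = Z1 e q.
Proof. by rewrite /Z1 rmorphN /=; ring. Qed.

Lemma Z2N e q : Z2 (- e) (- q) = Z2 e q.
Proof. by rewrite /Z2; congr cj; ring. Qed.

Lemma gainE q : 1 + q * cj q = (1 + nsq q)%:C%C.
Proof. by rewrite rmorphD /= nsqE rmorph1. Qed.

Lemma nsqZ1 e q : nsq e = 1 -> nsq (Z1 e q) = nsq q * (1 + nsq q) ^+ 2.
Proof.
move=> e1; rewrite /Z1 !nsqM e1 mul1r; congr (_ * _).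
by rewrite gainE nsqr.
Qed.

Lemma Z1_eq0 e q : nsq e = 1 -> (Z1 e q == 0) = (q == 0).
Proof.
move=> e1; rewrite -nsq_eq0 nsqZ1// mulf_eq0 nsq_eq0 expf_eq0 /=.
by rewrite (@gt_eqF _ _ (1 + nsq q) 0) ?orbF// ltr_wpDr// nsq_ge0.
Qed.

Definition coords u v w : C * C := (Z1 (u * v * w) (u + v + w), Z2 (u * v * w) (u + v + w)).

Lemma coords12 u v w : coords u v w = coords v u w.
Proof. by rewrite /coords (mulrC u) (addrC u). Qed.

Lemma coords23 u v w : coords u v w = coords u w v.
Proof. by rewrite /coords -!mulrA (mulrC v) -!addrA (addrC v). Qed.

Lemma coordsN u v w : coords (- u) (- v) (- w) = coords u v w.
Proof.
rewrite /coords -[in LHS](_ : - (u + v + w) = - u - v - w); last by ring.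
by rewrite (_ : - u * - v * - w = - (u * v * w)) ?Z1N ?Z2N//; ring.
Qed.

Lemma coords_neq0 u v w : nsq u = 1 -> nsq v = 1 -> nsq w = 1 -> coords u v w <> (0, 0).
Proof.
move=> u1 v1 w1; set e := u * v * w; have e1 : nsq e = 1 by rewrite !nsqM u1 v1 w1 !mulr1.
rewrite /coords -/e => -[/eqP]; rewrite Z1_eq0// => /eqP ->.
rewrite /Z2 expr0n mulr0 subr0 => /(congr1 (@nsq R)).
by rewrite nsqJ nsqX e1 nsq0 expr1n => /eqP; rewrite oner_eq0.
Qed.

(** A triple with two opposite entries represents a set with at most two points,
    on which coords is visibly a function of the set. *)
Lemma coords_opposite x y : nsq x = 1 -> nsq y = 1 ->
  coords x (- x) y = (- 2 * (x ^+ 2 * y ^+ 2), cj (x ^+ 2 * y ^+ 2 * (x ^+ 2 + y ^+ 2))).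
Proof.
move=> x1 y1; have [yc _ _] := nsq1P y1.
by rewrite /coords /Z1 /Z2 subrr add0r yc; congr (_, cj _); ring.
Qed.

(** For hypotheses |a + b + c| <= 1 up to the order of the summands. *)
Ltac nsq_perm H := move: H; congr (nsq _ <= 1); ring.

(** The signs of two admissible triples of roots either all agree, or all differ, or
    one vertex is reversed up to a common sign; in the last case the other two
    vertices are opposite by [opposite_of_flip], and [coords_opposite] applies. *)
Lemma sign_cases u v w u' v' w' :
  nsq u = 1 -> nsq v = 1 -> nsq w = 1 ->
  nsq (u + v + w) <= 1 -> nsq (u' + v' + w') <= 1 ->
  u' ^+ 2 = u ^+ 2 -> v' ^+ 2 = v ^+ 2 -> w' ^+ 2 = w ^+ 2 ->
  coords u v w = coords u' v' w'.
Proof.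
have flip a b c : nsq a = 1 -> nsq b = 1 -> nsq c = 1 ->
    nsq (a + b + c) <= 1 -> nsq (- a + b + c) <= 1 -> coords a b c = coords (- a) b c.
  move=> a1 b1 c1 q1 q2; have -> := opposite_of_flip a1 b1 c1 q1 q2.
  have P s : coords s b (- b) = coords b (- b) s by rewrite coords12 coords23.
  by rewrite !P !coords_opposite// ?nsqN// sqrrN.
move=> u1 v1 w1 q1 q2 /sqr_eq Eu /sqr_eq Ev /sqr_eq Ew; move: q2.
have Nn a b c : nsq (- a - b - c) = nsq (a + b + c).
  by rewrite -nsqN; congr nsq; ring.
case: Eu => ->; case: Ev => ->; case: Ew => -> // q2.
- rewrite coords23 coords12 [RHS]coords23 [RHS]coords12; apply: flip => //.
    by nsq_perm q1.
  by nsq_perm q2.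
- rewrite coords12 [RHS]coords12; apply: flip => //.
    by nsq_perm q1.
  by nsq_perm q2.
- rewrite flip//; first by rewrite -coordsN !opprK.
  by move: q2; rewrite -nsqN; congr (nsq _ <= 1); ring.
- exact: flip.
- rewrite coords12 flip//; first by rewrite -coordsN !opprK coords12.
    by nsq_perm q1.
  by move: q2; rewrite -nsqN; congr (nsq _ <= 1); ring.
- rewrite coords23 coords12 flip//; first by rewrite -coordsN !opprK coords12 coords23.
    by nsq_perm q1.
  by move: q2; rewrite -nsqN; congr (nsq _ <= 1); ring.
- by rewrite coordsN.
Qed.

Definition in3 a b c z : Prop := z = a \/ z = b \/ z = c.

(** If u = v, then |2 u + w| <= 1 leaves only w = - u. *)
Lemma opposite_pair u v w : nsq u = 1 -> nsq v = 1 -> nsq w = 1 ->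
  nsq (u + v + w) <= 1 -> u ^+ 2 = v ^+ 2 -> v = - u \/ (v = u /\ w = - u).
Proof.
move=> u1 v1 w1 q1 /sqr_eq[] uv; last by left; rewrite uv opprK.
right; split=> //; rewrite -uv in q1.
have : nsq (u + w) = 0.
  have E2 : 2 * nsq (u + w) + 1 = nsq (u + u + w).
    apply: complexI; rewrite rmorphD /= rmorphM /= !nsqE !rmorphD /=.
    have [_ -> u0] := nsq1P u1; have [_ -> w0] := nsq1P w1.
    rewrite ?rmorph_nat ?rmorph1.
    by field; rewrite u0 w0.
  by have := nsq_ge0 (u + w); lra.
by move/eqP; rewrite nsq_eq0 addrC addr_eq0 => /eqP.
Qed.

Lemma degenerate u v w : nsq u = 1 -> nsq v = 1 -> nsq w = 1 ->
  nsq (u + v + w) <= 1 ->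
  (u ^+ 2 = v ^+ 2 \/ v ^+ 2 = w ^+ 2 \/ u ^+ 2 = w ^+ 2) ->
  exists x y, [/\ nsq x = 1, nsq y = 1, coords u v w = coords x (- x) y &
    forall z, in3 (u ^+ 2) (v ^+ 2) (w ^+ 2) z <-> z = x ^+ 2 \/ z = y ^+ 2].
Proof.
have main a b c : nsq a = 1 -> nsq b = 1 -> nsq c = 1 ->
    nsq (a + b + c) <= 1 -> a ^+ 2 = b ^+ 2 ->
    exists x y, [/\ nsq x = 1, nsq y = 1, coords a b c = coords x (- x) y &
    forall z, in3 (a ^+ 2) (b ^+ 2) (c ^+ 2) z <-> z = x ^+ 2 \/ z = y ^+ 2].
  move=> a1 b1 c1 q1 ab; have [->|[-> ->]] := opposite_pair a1 b1 c1 q1 ab.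
    by exists a, c; split=> // z; rewrite /in3 sqrrN; tauto.
  exists a, a; split=> //; first by rewrite coords23.
  by move=> z; rewrite /in3 sqrrN; tauto.
move=> u1 v1 w1 q1 [E|[E|E]].
- exact: main.
- have q1' : nsq (v + w + u) <= 1 by nsq_perm q1.
  have [x [y [x1 y1 ZE S]]] := main v w u v1 w1 u1 q1' E.
  exists x, y; split=> //; first by rewrite -ZE coords12 coords23.
  by move=> z; rewrite -S /in3; tauto.
- have q1' : nsq (u + w + v) <= 1 by nsq_perm q1.
  have [x [y [x1 y1 ZE S]]] := main u w v u1 w1 v1 q1' E.
  exists x, y; split=> //; first by rewrite -ZE coords23.
  by move=> z; rewrite -S /in3; tauto.
Qed.

Lemma perm3 a b c a' b' c' : (forall z, in3 a b c z <-> in3 a' b' c' z) ->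
  a <> b -> b <> c -> a <> c ->
  (a = a' /\ b = b' /\ c = c') \/ (a = a' /\ b = c' /\ c = b') \/
  (a = b' /\ b = a' /\ c = c') \/ (a = b' /\ b = c' /\ c = a') \/
  (a = c' /\ b = a' /\ c = b') \/ (a = c' /\ b = b' /\ c = a').
Proof.
move=> S ab bc ac.
have : in3 a b c a by left.
have : in3 a b c b by right; left.
have : in3 a b c c by right; right.
rewrite !S /in3 {S} => -[?|[?|?]] [?|[?|?]] [?|[?|?]];
  first [by exfalso; congruence | tauto].
Qed.

Lemma perm2 (a b a' b' : C) : (forall z, (z = a \/ z = b) <-> (z = a' \/ z = b')) ->
  (a = a' /\ b = b') \/ (a = b' /\ b = a').
Proof.
move=> S.
have := (S a).1 (or_introl erefl); have := (S b).1 (or_intror erefl).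
have := (S a').2 (or_introl erefl); have := (S b').2 (or_intror erefl).
by intuition congruence.
Qed.

(** If the three points are distinct, then the roots are determined up to order and
    signs. Otherwise the triple is x, - x, y up to order and signs, and
    [coords_opposite] is an expression in the points themselves. *)
Lemma coords_set u v w u' v' w' :
  nsq u = 1 -> nsq v = 1 -> nsq w = 1 ->
  nsq u' = 1 -> nsq v' = 1 -> nsq w' = 1 ->
  nsq (u + v + w) <= 1 -> nsq (u' + v' + w') <= 1 ->
  (forall z, in3 (u ^+ 2) (v ^+ 2) (w ^+ 2) z <-> in3 (u' ^+ 2) (v' ^+ 2) (w' ^+ 2) z) ->
  coords u v w = coords u' v' w'.
Proof.
move=> u1 v1 w1 u1' v1' w1' q1 q1' S.
have six a b c : (a = u' ^+ 2 /\ b = v' ^+ 2 /\ c = w' ^+ 2) \/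
    (a = u' ^+ 2 /\ b = w' ^+ 2 /\ c = v' ^+ 2) \/
    (a = v' ^+ 2 /\ b = u' ^+ 2 /\ c = w' ^+ 2) \/
    (a = v' ^+ 2 /\ b = w' ^+ 2 /\ c = u' ^+ 2) \/
    (a = w' ^+ 2 /\ b = u' ^+ 2 /\ c = v' ^+ 2) \/
    (a = w' ^+ 2 /\ b = v' ^+ 2 /\ c = u' ^+ 2) ->
    a = u ^+ 2 -> b = v ^+ 2 -> c = w ^+ 2 -> coords u v w = coords u' v' w'.
  move=> H Ea Eb Ec; rewrite {}Ea {}Eb {}Ec in H; move: H q1'.
  case=> [|[|[|[|[|]]]]] [Eu [Ev Ew]] q';
    [|rewrite [RHS]coords23|rewrite [RHS]coords12|rewrite [RHS]coords12 [RHS]coords23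
    |rewrite [RHS]coords23 [RHS]coords12|rewrite [RHS]coords12 [RHS]coords23 [RHS]coords12];
    apply: sign_cases => //; by nsq_perm q'.
have [D|D] := pselect (u ^+ 2 = v ^+ 2 \/ v ^+ 2 = w ^+ 2 \/ u ^+ 2 = w ^+ 2); last first.
  by apply: six => //; apply: perm3 => // E; apply: D; tauto.
have [D'|D'] := pselect (u' ^+ 2 = v' ^+ 2 \/ v' ^+ 2 = w' ^+ 2 \/ u' ^+ 2 = w' ^+ 2); last first.
  have S' z : in3 (u' ^+ 2) (v' ^+ 2) (w' ^+ 2) z <-> in3 (u ^+ 2) (v ^+ 2) (w ^+ 2) z by rewrite S.
  have P := perm3 S'.
  have : u' ^+ 2 <> v' ^+ 2 /\ v' ^+ 2 <> w' ^+ 2 /\ u' ^+ 2 <> w' ^+ 2 by tauto.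
  by case=> n1 [n2 n3]; have := P n1 n2 n3; intuition congruence.
have [x [y [x1 y1 -> Sx]]] := degenerate u1 v1 w1 q1 D.
have [x' [y' [x1' y1' -> Sx']]] := degenerate u1' v1' w1' q1' D'.
rewrite !coords_opposite//.
have T z : (z = x ^+ 2 \/ z = y ^+ 2) <-> (z = x' ^+ 2 \/ z = y' ^+ 2).
  by rewrite -Sx S Sx'.
have [[-> ->]|[-> ->]] := perm2 T; first by [].
by congr (_, cj _); ring.
Qed.

End orth.

(** * Injectivity *)

Section monotone.
Variable R : realType.
Implicit Types (r c D : R).

(** If h = q^3 / e has modulus r^3 and c is the cosine of the phase of Z1^3 Z2^2, then by
    [kappa_ratio] |Z1 / Z2|^2 = r^2 (1 + r^2)^2 (1 + 2 c r^3 + r^6) / (1 - r^6)^2. For a fixed c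
    this increases with r: it is the product of the increasing function
    (r + r^3)^2 / (1 + r^3)^2 and the nondecreasing one (1 + 2 c r^3 + r^6) / (1 - r^3)^2. *)
Lemma ratio_mono (r r' c : R) : 0 <= r -> r < r' -> r' < 1 -> -1 <= c ->
  r ^+ 2 * (1 + r ^+ 2) ^+ 2 * (1 + 2 * c * r ^+ 3 + r ^+ 6) * (1 - r' ^+ 6) ^+ 2 <
  r' ^+ 2 * (1 + r' ^+ 2) ^+ 2 * (1 + 2 * c * r' ^+ 3 + r' ^+ 6) * (1 - r ^+ 6) ^+ 2.
Proof.
move=> r0 rr r1 c1.
have r'0 : 0 < r' by exact: le_lt_trans rr.
have rlt1 : r < 1 by exact: lt_trans r1.
have r'1 : r' ^+ 2 < 1 by nra.
have x3 : r ^+ 3 < r' ^+ 3 by rewrite ltrXn2r// ltW.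
have y3 : r' ^+ 3 < 1 by rewrite exprn_ilt1// ltW.
have x30 : 0 <= r ^+ 3 by rewrite exprn_ge0.
have M : r * (1 + r ^+ 2) * (1 + r' ^+ 3) < r' * (1 + r' ^+ 2) * (1 + r ^+ 3).
  rewrite -subr_gt0.
  (* The cross difference for the function (r + r^3) / (1 + r^3). *)
  have -> : r' * (1 + r' ^+ 2) * (1 + r ^+ 3) - r * (1 + r ^+ 2) * (1 + r' ^+ 3) =
      (r' - r) * (1 + (r' - r) ^+ 2 + r * r' * (1 + (1 - r) + (1 - r'))) by ring.
  rewrite mulr_gt0 ?subr_gt0// -addrA ltr_wpDr// addr_ge0 ?sqr_ge0// !mulr_ge0//; lra.
have E6 (x : R) : x ^+ 6 = x ^+ 3 ^+ 2 by rewrite -exprM.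
rewrite !E6; move: M x3 y3 x30; set X := r ^+ 3; set Y := r' ^+ 3 => M x3 y3 x30.
pose P := (1 + 2 * c * X + X ^+ 2) * (1 - Y) ^+ 2.
pose Q := (1 + 2 * c * Y + Y ^+ 2) * (1 - X) ^+ 2.
have PQ : P <= Q.
  rewrite -subr_ge0.
  (* The cross difference for the function (1 + 2 c X + X^2) / (1 - X)^2. *)
  have -> : Q - P = 2 * (1 + c) * (Y - X) * (1 - X * Y) by rewrite /P /Q; ring.
  by rewrite !mulr_ge0//; nra.
have Q0 : 0 < Q.
  rewrite /Q mulr_gt0//; last by rewrite exprn_gt0//; lra.
  have -> : 1 + 2 * c * Y + Y ^+ 2 = (1 - Y) ^+ 2 + 2 * (1 + c) * Y by ring.
  by rewrite ltr_wpDr//; [nra | rewrite exprn_gt0//; lra].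
pose s := r * (1 + r ^+ 2) * (1 + Y); pose t := r' * (1 + r' ^+ 2) * (1 + X).
have s0 : 0 <= s by rewrite /s !mulr_ge0//; [rewrite addr_ge0// sqr_ge0 | lra].
have st : s ^+ 2 < t ^+ 2 by rewrite ltrXn2r// ltW// (le_lt_trans s0).
have -> : r ^+ 2 * (1 + r ^+ 2) ^+ 2 * (1 + 2 * c * X + X ^+ 2) * (1 - Y ^+ 2) ^+ 2 = s ^+ 2 * P.
  by rewrite /s /P; ring.
have -> : r' ^+ 2 * (1 + r' ^+ 2) ^+ 2 * (1 + 2 * c * Y + Y ^+ 2) * (1 - X ^+ 2) ^+ 2 = t ^+ 2 * Q.
  by rewrite /t /Q; ring.
apply: (@le_lt_trans _ _ (s ^+ 2 * Q)); first by rewrite ler_wpM2l ?sqr_ge0.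
by rewrite ltr_pM2r.
Qed.

End monotone.

Section cubic.
Variable R : realType.
Local Notation C := R[i].
Local Notation cj := (@conjc R).
Implicit Types (x y z u v w e q h k : C).

Lemma cubic_roots (a b c : C) :
  exists u v w, [/\ u + v + w = a, u * v + v * w + w * u = b & u * v * w = c].
Proof.
have [u uE] : exists u, u ^+ 3 = \sum_(i < 3) nth 0 [:: c; - b; a] i * u ^+ i.
  exact: (@solve_monicpoly C 3 (nth 0 [:: c; - b; a])).
have [v vE] : exists v, v ^+ 2 = \sum_(i < 2) nth 0 [:: - (b - u * (a - u)); a - u] i * v ^+ i.
  exact: (@solve_monicpoly C 2 (nth 0 [:: - (b - u * (a - u)); a - u])).
have {}uE : u ^+ 3 = c - b * u + a * u ^+ 2.
  by rewrite uE !big_ord_recl big_ord0 /= /bump /=; ring.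
have {}vE : v ^+ 2 = (a - u) * v - (b - u * (a - u)).
  by rewrite vE !big_ord_recl big_ord0 /= /bump /=; ring.
exists u, v, (a - u - v); split; first by ring.
  transitivity (u * (a - u) + (a - u) * v - v ^+ 2); first by ring.
  by rewrite vE; ring.
transitivity (u * ((a - u) * v - v ^+ 2)); first by ring.
rewrite vE; transitivity (u ^+ 3 - a * u ^+ 2 + b * u); first by ring.
by rewrite uE; ring.
Qed.

(** For a root |x|^2 |x - q| = |1 - (conj q) x|, whereas |1 - (conj q) x| is less than
    |x - q| if |x| > 1 and greater if |x| < 1. *)
Lemma root_unit e q x : nsq e = 1 -> nsq q < 1 ->
  x ^+ 3 - q * x ^+ 2 + e * cj q * x - e = 0 -> nsq x = 1.
Proof.
move=> e1 q1 xE.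
have E1 : x ^+ 2 * (x - q) = e * (1 - cj q * x).
  by apply/eqP; rewrite -subr_eq0 -xE; apply/eqP; ring.
have E2 := congr1 (@nsq R) E1; rewrite !nsqM e1 mul1r in E2.
have E3 : nsq (1 - cj q * x) - nsq (x - q) = (1 - nsq q) * (1 - nsq x).
  apply: complexI; rewrite rmorphB /= !nsqE rmorphM /= !rmorphB /= !nsqE rmorphM /= conjcK rmorph1.
  have -> : (1 -i* 0)%C = 1 :> C by rewrite oppr0.
  by ring.
have a0 := nsq_ge0 (x - q); have b0 := nsq_ge0 x.
have : (1 - nsq x) * ((1 - nsq q) + nsq (x - q) * (nsq x + 1)) = 0.
  transitivity ((1 - nsq q) * (1 - nsq x) - nsq (x - q) * (nsq x ^+ 2 - 1)); first by ring.
  by rewrite -E3 -E2; ring.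
move/eqP; rewrite mulf_eq0 subr_eq0 => /orP[/eqP//|/eqP]; nra.
Qed.

(** By [conj_e1] the middle coefficient of the cubic equation of u, v, w is determined by
    the two others. *)
Lemma roots_of_eq e q : nsq e = 1 -> nsq q < 1 ->
  exists u v w, [/\ nsq u = 1, nsq v = 1, nsq w = 1, u + v + w = q & u * v * w = e].
Proof.
move=> e1 q1; have [u [v [w [E1 E2 E3]]]] := cubic_roots q (e * cj q) e.
have P x : x ^+ 3 - q * x ^+ 2 + e * cj q * x - e = (x - u) * (x - v) * (x - w).
  by rewrite -E2 -E3 -{1}E1; ring.
by exists u, v, w; split=> //; apply: root_unit e1 q1 _; rewrite P subrr ?(mulr0, mul0r).
Qed.

Lemma in3_of_eq u v w u' v' w' : nsq u = 1 -> nsq v = 1 -> nsq w = 1 ->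
  nsq u' = 1 -> nsq v' = 1 -> nsq w' = 1 ->
  u + v + w = u' + v' + w' -> u * v * w = u' * v' * w' ->
  in3 u v w u' /\ in3 u v w v' /\ in3 u v w w'.
Proof.
move=> u1 v1 w1 u1' v1' w1' E1 E3.
have E2 := conj_e1 u1 v1 w1; have E2' := conj_e1 u1' v1' w1'.
have P x : (x - u) * (x - v) * (x - w) = (x - u') * (x - v') * (x - w').
  transitivity (x ^+ 3 - (u + v + w) * x ^+ 2 + (u * v + v * w + w * u) * x - u * v * w); first by ring.
  by rewrite E2 E1 E3 -E2'; ring.
have Q x : (x - u') * (x - v') * (x - w') = 0 -> in3 u v w x.
  rewrite -P => /eqP; rewrite !mulf_eq0 !subr_eq0 => /orP[/orP[]|] /eqP; rewrite /in3; auto.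
by do ! split; apply: Q; rewrite subrr ?(mulr0, mul0r).
Qed.

Lemma sqr_in3 u v w u' v' w' : nsq u = 1 -> nsq v = 1 -> nsq w = 1 ->
  nsq u' = 1 -> nsq v' = 1 -> nsq w' = 1 ->
  u + v + w = u' + v' + w' -> u * v * w = u' * v' * w' ->
  forall z, in3 (u ^+ 2) (v ^+ 2) (w ^+ 2) z <-> in3 (u' ^+ 2) (v' ^+ 2) (w' ^+ 2) z.
Proof.
move=> u1 v1 w1 u1' v1' w1' E1 E3 z.
have sq a b c x : in3 a b c x -> in3 (a ^+ 2) (b ^+ 2) (c ^+ 2) (x ^+ 2).
  by rewrite /in3 => -[->|[->|->]]; auto.
have [A [B D]] := in3_of_eq u1 v1 w1 u1' v1' w1' E1 E3.
have [A' [B' D']] := in3_of_eq u1' v1' w1' u1 v1 w1 (esym E1) (esym E3).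
by split=> -[->|[->|->]]; exact: sq.
Qed.

End cubic.

Section direction.
Variable R : realType.
Local Notation C := R[i].
Local Notation cj := (@conjc R).
Implicit Types (x y z u v w e q h k : C).

Lemma nsq_1B h : nsq (1 - h) = 1 - 2 * complex.Re h + nsq h.
Proof. by case: h => a b; rewrite /nsq /=; ring. Qed.

(** Z1^3 Z2^2 has weight 3 * 2 - 2 * 3 = 0, so that it is a function of |q| and of the
    rotation invariant h = q^3 / e; its phase is that of kappa h. *)
Definition kappa h : C := h * (1 - cj h) ^+ 2.

Lemma Z32 e q : nsq e = 1 ->
  Z1 e q ^+ 3 * Z2 e q ^+ 2 = ((1 + nsq q) ^+ 3)%:C%C * kappa (q ^+ 3 / e).
Proof.
move=> /nsq1P[_ ec e0]; rewrite /Z1 gainE rmorphXn /= /Z2 /kappa.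
rewrite !(rmorphB, rmorphM, rmorphXn, fmorphV) /= ec invrK.
by field.
Qed.

Lemma nsq_kappa h : nsq (kappa h) = nsq h * nsq (1 - h) ^+ 2.
Proof.
rewrite /kappa nsqM nsqX -(nsqJ (1 - cj h)) rmorphB /= conjcK.
by have -> : (1 -i* 0)%C = 1 :> C by rewrite oppr0.
Qed.

Lemma kappa_id h :
  nsq (1 - h) * (1 + nsq h) + 2 * complex.Re (kappa h) = (1 - nsq h) ^+ 2.
Proof.
by case: h => a b; rewrite /kappa /nsq expr2 /=; simpc; rewrite /=; ring.
Qed.

Lemma nsqZ2 e q : nsq e = 1 -> nsq (Z2 e q) = nsq (1 - q ^+ 3 / e).
Proof.
move=> e1; have [_ _ e0] := nsq1P e1; rewrite /Z2 nsqJ.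
have -> : e ^+ 2 - e * q ^+ 3 = e ^+ 2 * (1 - q ^+ 3 / e) by field.
by rewrite nsqM nsqX e1 expr1n mul1r.
Qed.

(** By [kappa_id] the modulus of 1 - h, on which |Z2| depends, is a function of |h| = r^3
    and of the cosine c of the phase of kappa h. *)
Lemma kappa_ratio h c r : 0 <= r -> nsq h = r ^+ 6 ->
  complex.Re (kappa h) = c * (r ^+ 3 * nsq (1 - h)) ->
  nsq (1 - h) * (1 + 2 * c * r ^+ 3 + r ^+ 6) = (1 - r ^+ 6) ^+ 2.
Proof. by move=> r0 hr E; rewrite -[in RHS]hr -kappa_id hr E; ring. Qed.

(** kappa h / |1 - h|^2 = (h - |h|^2) / (1 - h) is a fractional linear function of h once
    |h| is known. *)
Lemma kappa_inj h h' : nsq h = nsq h' -> nsq h < 1 -> nsq (1 - h) = nsq (1 - h') ->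
  kappa h = kappa h' -> h = h'.
Proof.
move=> hh h1 DD E.
have D0 : 1 - h != 0.
  by apply/eqP => /subr0_eq E1; move: h1; rewrite -E1 nsq1 ltxx.
have D'0 : 1 - h' != 0 by rewrite -nsq_gt0 -DD nsq_gt0.
have dE x : (nsq (1 - x))%:C%C = (1 - x) * (1 - cj x).
  by rewrite nsqE rmorphB /=; have -> : (1 -i* 0)%C = 1 :> C by rewrite oppr0.
have cD0 x : 1 - x != 0 -> 1 - cj x != 0.
  move=> x0; rewrite -nsq_gt0 -nsqJ rmorphB /= conjcK.
  by have -> : (1 -i* 0)%C = 1 :> C; [rewrite oppr0 | rewrite nsq_gt0].
pose k x := kappa x / (nsq (1 - x))%:C%C.
have kE x : 1 - x != 0 -> k x * (1 - x) = x - (nsq x)%:C%C.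
  by move=> x0; rewrite /k dE /kappa nsqE; field; rewrite x0 cD0.
have kk : k h = k h' by rewrite /k E DD.
have k1 : 1 + k h != 0.
  apply/eqP => k1; have kN1 : k h = -1 by apply/eqP; rewrite -addr_eq0 addrC k1.
  have := kE _ D0; rewrite kN1 nsqE => H.
  have : h * cj h = 1 by rewrite -[LHS](subKr h) -H; ring.
  by rewrite -nsqE => /complexI H1; move: h1; rewrite H1 ltxx.
apply: (mulfI k1).
have -> : (1 + k h) * h = k h + (nsq h)%:C%C.
  by rewrite -[(nsq h)%:C%C](subKr h) -(kE _ D0); ring.
have -> : (1 + k h) * h' = k h + (nsq h')%:C%C.
  by rewrite kk -[(nsq h')%:C%C](subKr h') -(kE _ D'0); ring.
by rewrite hh.
Qed.

End direction.

Section injectivity.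
Variable R : realType.
Local Notation C := R[i].
Local Notation cj := (@conjc R).
Implicit Types (x y z u v w e q h k : C) (r s : R).

Let rad q : R := Num.sqrt (nsq q).
Let hh e q : C := q ^+ 3 / e.

Let rad_ge0 q : 0 <= rad q. Proof. exact: sqrtr_ge0. Qed.

Let radX q : rad q ^+ 2 = nsq q. Proof. by rewrite sqr_sqrtr// nsq_ge0. Qed.

Let nsq_hh e q : nsq e = 1 -> nsq (hh e q) = rad q ^+ 6.
Proof. by move=> e1; rewrite nsqM nsqV e1 invr1 mulr1 nsqX -radX -exprM. Qed.

Let pos_sqr1 s : 0 < s -> s ^+ 2 = 1 -> s = 1.
Proof. by move=> s0 /eqP; rewrite sqrf_eq1 => /orP[/eqP//|/eqP s1]; lra. Qed.

(** Two pairs on one ray give the same phase of Z1^3 Z2^2, of cosine c, and the same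
    quotient |Z1| / |Z2|. *)
Lemma same_direction e q e' q' s : nsq e = 1 -> nsq e' = 1 -> 0 < s ->
  Z1 e q = s%:C%C * Z1 e' q' -> Z2 e q = s%:C%C * Z2 e' q' ->
  q' != 0 -> 1 - hh e' q' != 0 ->
  exists c, [/\ -1 <= c, complex.Re (kappa (hh e q)) = c * (rad q ^+ 3 * nsq (1 - hh e q)),
    complex.Re (kappa (hh e' q')) = c * (rad q' ^+ 3 * nsq (1 - hh e' q')) &
    rad q ^+ 2 * (1 + rad q ^+ 2) ^+ 2 * nsq (1 - hh e' q') =
    rad q' ^+ 2 * (1 + rad q' ^+ 2) ^+ 2 * nsq (1 - hh e q)].
Proof.
move=> e1 e1' s0 E1 E2 q'0 D'0.
have N1 := congr1 (@nsq R) E1; rewrite nsqM nsqr !nsqZ1// -!radX in N1.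
have N2 := congr1 (@nsq R) E2; rewrite nsqM nsqr !nsqZ2// in N2.
rewrite -/(hh e q) -/(hh e' q') in N2.
pose D := nsq (1 - hh e q); pose D' := nsq (1 - hh e' q').
have D'p : 0 < D' by rewrite nsq_gt0.
have Dp : 0 < D by rewrite /D N2 mulr_gt0// exprn_gt0.
have r'0 : 0 < rad q' by rewrite sqrtr_gt0 nsq_gt0.
have g0 x : 0 < 1 + nsq x by rewrite ltr_wpDr// nsq_ge0.
(* Z1^3 Z2^2 is homogeneous of degree 5. *)
pose t := s ^+ 5 * (1 + nsq q') ^+ 3 / (1 + nsq q) ^+ 3.
have t0 : 0 < t by rewrite divr_gt0// ?mulr_gt0// exprn_gt0.
have kE : kappa (hh e q) = t%:C%C * kappa (hh e' q').
  have gn0 : ((1 + nsq q) ^+ 3)%:C%C != 0 :> C.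
    by rewrite (inj_eq (@complexI R) _ 0) gt_eqF// exprn_gt0.
  apply: (mulfI gn0); rewrite -Z32// E1 E2.
  transitivity ((s ^+ 5)%:C%C * (Z1 e' q' ^+ 3 * Z2 e' q' ^+ 2)).
    by rewrite rmorphXn /=; ring.
  have tE : (1 + nsq q) ^+ 3 * t = s ^+ 5 * (1 + nsq q') ^+ 3.
    by rewrite /t mulrCA mulfV ?mulr1// gt_eqF// exprn_gt0.
  have tC : ((1 + nsq q) ^+ 3)%:C%C * t%:C%C = (s ^+ 5)%:C%C * ((1 + nsq q') ^+ 3)%:C%C :> C.
    by rewrite -(rcM ((1 + nsq q) ^+ 3) t) tE (rcM (s ^+ 5) ((1 + nsq q') ^+ 3)).
  by rewrite (Z32 q' e1') [LHS]mulrA -tC -[LHS]mulrA.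
have rD' : 0 < rad q' ^+ 3 * D' by rewrite mulr_gt0// exprn_gt0.
have tE : rad q ^+ 3 * D = t * (rad q' ^+ 3 * D').
  have : (rad q ^+ 3 * D) ^+ 2 = (t * (rad q' ^+ 3 * D')) ^+ 2.
    have := congr1 (@nsq R) kE; rewrite nsqM nsqr !nsq_kappa !nsq_hh// -/D -/D' => H.
    by rewrite exprMn -exprM H; ring.
  move=> /eqP; rewrite eqf_sqr => /orP[/eqP//|/eqP H].
  have K := mulr_ge0 (exprn_ge0 3 (rad_ge0 q)) (ltW Dp).
  have L := mulr_gt0 t0 rD'.
  by move: H K L; move: (_ * D) (t * _) => a b; lra.
exists (complex.Re (kappa (hh e' q')) / (rad q' ^+ 3 * D')); split.
- rewrite ler_pdivlMr// mulN1r.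
  have : complex.Re (kappa (hh e' q')) ^+ 2 <= (rad q' ^+ 3 * D') ^+ 2.
    have := nsq_kappa (hh e' q'); rewrite nsq_hh// -/D' /nsq => H.
    by rewrite exprMn -exprM -H lerDl sqr_ge0.
  by move: (complex.Re _) (_ * D') rD' => a b b0 ab; nra.
- rewrite -/D tE kE.
  have -> : complex.Re (t%:C%C * kappa (hh e' q')) = t * complex.Re (kappa (hh e' q')).
    by case: (kappa _) => a b; simpc.
  by rewrite mulrCA divfK// gt_eqF.
- by rewrite -/D' divfK// gt_eqF.
- by rewrite N1 N2; ring.
Qed.

Lemma lt1_neq e q : nsq e = 1 -> nsq q < 1 -> 1 - hh e q != 0.
Proof.
move=> e1 q1; apply/eqP => /subr0_eq E; have H := nsq_hh q e1.
rewrite -E nsq1 (exprM (rad q) 2 3 : rad q ^+ 6 = _) radX in H.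
have : nsq q ^+ 3 < 1 by rewrite exprn_ilt1// nsq_ge0.
by rewrite -H ltxx.
Qed.

Lemma rad_lt1 q : (rad q < 1) = (nsq q < 1).
Proof. by rewrite -(@expr_lt1 _ 2)// radX. Qed.

(** The moduli of q agree by [ratio_mono], then h by [kappa_inj], then e^2 from Z2 and
    eq from Z1. *)
Lemma interior_inj e q e' q' s : nsq e = 1 -> nsq e' = 1 -> nsq q < 1 -> nsq q' < 1 ->
  0 < s -> Z1 e q = s%:C%C * Z1 e' q' -> Z2 e q = s%:C%C * Z2 e' q' ->
  (e = e' /\ q = q') \/ (e = - e' /\ q = - q').
Proof.
move=> e1 e1' q1 q1' s0 E1 E2.
have [q'0|q'0] := eqVneq q' 0.
  have q0 : q = 0.
    by apply/eqP; rewrite -(Z1_eq0 _ e1) E1 q'0 mulf_eq0 (Z1_eq0 _ e1') eqxx orbT.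
  move: E2; rewrite /Z2 q0 q'0 !expr0n !mulr0 !subr0 oppr0 => E2.
  have := congr1 (@nsq R) E2; rewrite nsqM nsqr !nsqJ !nsqX e1 e1' expr1n mulr1.
  move=> /esym/(pos_sqr1 s0) s1.
  move: E2; rewrite s1 rmorph1 mul1r => /(can_inj (@conjcK R))/sqr_eq[]; by [left|right].
have D0 := lt1_neq e1 q1; have D'0 := lt1_neq e1' q1'.
have [c [c1 k1 k2 ratio]] := same_direction e1 e1' s0 E1 E2 q'0 D'0.
have R1 := kappa_ratio (rad_ge0 q) (nsq_hh q e1) k1.
have R2 := kappa_ratio (rad_ge0 q') (nsq_hh q' e1') k2.
have rlt := q1; have rlt' := q1'; rewrite -rad_lt1 in rlt; rewrite -rad_lt1 in rlt'.
have cross r r' a a' b b' d d' : d * b = a -> d' * b' = a' -> r * d' = r' * d ->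
    ~~ (r * b * a' < r' * b' * a).
  move=> <- <- E; rewrite -leNgt (_ : r' * b' * _ = b * b' * (r' * d)); last by ring.
  by rewrite -E (_ : b * b' * (r * d') = r * b * (d' * b')) //; ring.
have rr : rad q = rad q'.
  case: (ltgtP (rad q) (rad q')) => // lt.
  - by have := ratio_mono (rad_ge0 q) lt rlt' c1; rewrite (negbTE (cross _ _ _ _ _ _ _ _ R1 R2 ratio)).
  - by have := ratio_mono (rad_ge0 q') lt rlt c1; rewrite (negbTE (cross _ _ _ _ _ _ _ _ R2 R1 (esym ratio))).
have nn : nsq q = nsq q' by rewrite -!radX rr.
have g0 x : 0 < 1 + nsq x by rewrite ltr_wpDr// nsq_ge0.
have n'0 : 0 < nsq q' by rewrite nsq_gt0.
have s1 : s = 1.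
  have := congr1 (@nsq R) E1; rewrite nsqM nsqr !nsqZ1// nn => H.
  have G0 : nsq q' * (1 + nsq q') ^+ 2 != 0 by rewrite gt_eqF// mulr_gt0// exprn_gt0.
  by apply: (pos_sqr1 s0); apply: (mulIf G0); rewrite mul1r -H.
rewrite s1 rmorph1 !mul1r in E1 E2.
have DD : nsq (1 - hh e q) = nsq (1 - hh e' q') by rewrite -!nsqZ2// E2.
have hE : hh e q = hh e' q'.
  apply: kappa_inj => //; first by rewrite !nsq_hh// rr.
    by rewrite nsq_hh// exprn_ilt1.
  have gn0 : ((1 + nsq q) ^+ 3)%:C%C != 0 :> C.
    by rewrite (inj_eq (@complexI R) _ 0) gt_eqF// exprn_gt0.
  by apply: (mulfI gn0); rewrite -Z32// E1 E2 Z32// nn.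
have [_ _ e0] := nsq1P e1; have [_ _ e0'] := nsq1P e1'.
have ee : e ^+ 2 = e' ^+ 2.
  apply: (mulIf D'0); move: E2 => /(can_inj (@conjcK R)).
  have -> : e ^+ 2 - e * q ^+ 3 = e ^+ 2 * (1 - hh e q) by rewrite /hh; field.
  have -> : e' ^+ 2 - e' * q' ^+ 3 = e' ^+ 2 * (1 - hh e' q') by rewrite /hh; field.
  by rewrite hE.
have eq : e * q = e' * q'.
  have gn0 : (1 + nsq q)%:C%C != 0 :> C by rewrite (inj_eq (@complexI R) _ 0) gt_eqF.
  apply: (mulIf gn0); move: E1; rewrite /Z1 !gainE nn//.
have [Ee|Ee] := sqr_eq ee; [left|right]; split=> //; apply: (mulfI e0).
  by rewrite eq Ee.
by rewrite eq Ee mulrNN.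
Qed.

(** On the boundary c = -1 and |Z2| <= |Z1|, while in the interior c = -1 implies
    |Z1| / |Z2| = (r + r^3) / (1 + r^3) < 1. *)
Lemma boundary_interior e q e' q' s : nsq e = 1 -> nsq e' = 1 -> nsq q = 1 -> nsq q' < 1 ->
  0 < s -> Z1 e q = s%:C%C * Z1 e' q' -> Z2 e q = s%:C%C * Z2 e' q' -> False.
Proof.
move=> e1 e1' q1 q1' s0 E1 E2.
have q'0 : q' != 0.
  apply/eqP => q'0; move/eqP: E1; rewrite q'0 {2}/Z1 mulr0 !mul0r mulr0 Z1_eq0//.
  by rewrite -nsq_eq0 q1 oner_eq0.
have D'0 := lt1_neq e1' q1'.
have [c [c1 k1 k2 ratio]] := same_direction e1 e1' s0 E1 E2 q'0 D'0.
have r1 : rad q = 1 by rewrite /rad q1 sqrtr1.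
have D0 : 0 < nsq (1 - hh e q).
  by rewrite -nsqZ2// E2 nsqM nsqr mulr_gt0 ?exprn_gt0// nsqZ2// nsq_gt0.
have R1 := kappa_id (hh e q); rewrite k1 !nsq_hh// r1 !expr1n in R1.
have cN1 : c = -1.
  apply/eqP; rewrite -addr_eq0; apply/eqP; apply: (mulIf (lt0r_neq0 D0)); rewrite mul0r.
  by move: R1; move: (nsq _) => d; lra.
have R2 := kappa_ratio (rad_ge0 q') (nsq_hh q' e1') k2.
have rlt' := q1'; rewrite -rad_lt1 in rlt'.
have D4 : nsq (1 - hh e q) <= 4.
  have h1 : nsq (hh e q) = 1 by rewrite nsq_hh// r1 expr1n.
  rewrite nsq_1B h1; move: h1; rewrite /nsq.
  by move: (complex.Re _) (complex.Im _) => a b ab; nra.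
have r'0 : 0 < rad q' by rewrite sqrtr_gt0 nsq_gt0.
move: R2 ratio D4 D0 D'0; rewrite r1 cN1 -nsq_gt0.
move: (nsq (1 - hh e q)) (nsq (1 - hh e' q')) (rad q') rlt' r'0 => D D' r rl r0 R2 ratio D4 D0 D'0.
have x1 : r ^+ 3 < 1 by rewrite exprn_ilt1// ltW.
have D'E : D' = (1 + r ^+ 3) ^+ 2.
  have x0 : (1 - r ^+ 3) ^+ 2 != 0 by rewrite sqrf_eq0 subr_eq0 gt_eqF.
  apply: (mulIf x0); transitivity (D' * (1 + 2 * -1 * r ^+ 3 + r ^+ 6)); first by ring.
  by rewrite R2; ring.
have : 4 * (1 + r ^+ 3) ^+ 2 <= 4 * (r * (1 + r ^+ 2)) ^+ 2.
  rewrite -D'E; apply: (@le_trans _ _ (r ^+ 2 * (1 + r ^+ 2) ^+ 2 * D)).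
    by rewrite -ratio !expr1n; lra.
  rewrite [leRHS](_ : _ = r ^+ 2 * (1 + r ^+ 2) ^+ 2 * 4); last by ring.
  by rewrite ler_wpM2l// mulr_ge0// sqr_ge0.
rewrite ler_pM2l// leNgt => /negP; apply; rewrite ltrXn2r//.
  by rewrite mulr_ge0 ?addr_ge0 ?sqr_ge0// ltW.
by rewrite mulrDr mulr1 -exprS; lra.
Qed.

Lemma nsq1_opposite u v w : nsq u = 1 -> nsq v = 1 -> nsq w = 1 ->
  nsq (u + v + w) = 1 -> u ^+ 2 = v ^+ 2 \/ v ^+ 2 = w ^+ 2 \/ u ^+ 2 = w ^+ 2.
Proof.
move=> u1 v1 w1 q1; have := nsq_e1 u1 v1 w1; rewrite q1 rmorph1 subrr => /esym/eqP.
have [_ _ u0] := nsq1P u1; have [_ _ v0] := nsq1P v1; have [_ _ w0] := nsq1P w1.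
rewrite mulf_eq0 invr_eq0 !mulf_eq0 (negbTE u0) (negbTE v0) (negbTE w0) !orbF.
rewrite !addr_eq0 => /orP[/orP[]|] /eqP ->; rewrite ?sqrrN; auto.
Qed.

(** Interior triples are recovered from (e, q) up to sign by the cubic equation; on the
    boundary [coords_opposite] gives the product and the sum of the two points. *)
Lemma coords_inj u v w u' v' w' s :
  nsq u = 1 -> nsq v = 1 -> nsq w = 1 ->
  nsq u' = 1 -> nsq v' = 1 -> nsq w' = 1 ->
  nsq (u + v + w) <= 1 -> nsq (u' + v' + w') <= 1 -> 0 < s ->
  (coords u v w).1 = s%:C%C * (coords u' v' w').1 -> (coords u v w).2 = s%:C%C * (coords u' v' w').2 ->
  forall z, in3 (u ^+ 2) (v ^+ 2) (w ^+ 2) z <-> in3 (u' ^+ 2) (v' ^+ 2) (w' ^+ 2) z.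
Proof.
move=> u1 v1 w1 u1' v1' w1' q1 q1' s0 E1 E2.
have e1 : nsq (u * v * w) = 1 by rewrite !nsqM u1 v1 w1 !mulr1.
have e1' : nsq (u' * v' * w') = 1 by rewrite !nsqM u1' v1' w1' !mulr1.
have [lt|] := ltP (nsq (u + v + w)) 1; have [lt'|] := ltP (nsq (u' + v' + w')) 1.
- have [[Ee Eq]|[Ee Eq]] := interior_inj e1 e1' lt lt' s0 E1 E2.
    exact: sqr_in3.
  have S := @sqr_in3 _ u v w (- u') (- v') (- w') u1 v1 w1.
  rewrite !nsqN !sqrrN in S; apply: S => //; first by rewrite Eq; ring.
  by rewrite Ee; ring.
- move=> ge'; exfalso.
  have q'E : nsq (u' + v' + w') = 1 by apply/eqP; rewrite eq_le q1'.
  have sV : 0 < s^-1 by rewrite invr_gt0.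
  have sn0 : s%:C%C != 0 :> C by rewrite (inj_eq (@complexI R) _ 0) gt_eqF.
  apply: (boundary_interior e1' e1 q'E lt sV).
    by have := E1; rewrite /coords /= fmorphV /= => ->; rewrite mulKf.
  by have := E2; rewrite /coords /= fmorphV /= => ->; rewrite mulKf.
- move=> ge; exfalso.
  have qE : nsq (u + v + w) = 1 by apply/eqP; rewrite eq_le q1.
  exact: (boundary_interior e1 e1' qE lt' s0 E1 E2).
move=> ge' ge.
have qE : nsq (u + v + w) = 1 by apply/eqP; rewrite eq_le q1.
have q'E : nsq (u' + v' + w') = 1 by apply/eqP; rewrite eq_le q1'.
have [x [y [x1 y1 ZE S]]] := degenerate u1 v1 w1 q1 (nsq1_opposite u1 v1 w1 qE).
have [x' [y' [x1' y1' ZE' S']]] := degenerate u1' v1' w1' q1' (nsq1_opposite u1' v1' w1' q'E).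
move: E1 E2; rewrite {}ZE {}ZE' !coords_opposite//= => E1 E2 z; rewrite S S'.
have s1 : s = 1.
  have := congr1 (@nsq R) E1; rewrite !nsqM nsqr x1 y1 x1' y1' !mulr1 nsqN.
  have n2 : nsq (2 : C) != 0 by rewrite nsq_eq0 (eqr_nat _ 2 0).
  by move=> H; apply: (pos_sqr1 s0); apply: (mulIf n2); rewrite mul1r -H.
rewrite s1 rmorph1 !mul1r in E1 E2.
have n2 : (- 2 : C) != 0 by rewrite oppr_eq0 (eqr_nat _ 2 0).
have Ep := mulfI n2 E1; move/(can_inj (@conjcK R)) : E2; rewrite Ep => E2.
have P0 : x' ^+ 2 * y' ^+ 2 != 0 by rewrite -nsq_gt0 !nsqM x1' y1' !mulr1.
have Es := mulfI P0 E2.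
have F t : (t - x ^+ 2) * (t - y ^+ 2) = (t - x' ^+ 2) * (t - y' ^+ 2).
  transitivity (t ^+ 2 - (x ^+ 2 + y ^+ 2) * t + x ^+ 2 * y ^+ 2); first by ring.
  by rewrite Es Ep; ring.
have G (a b t : C) : (t - a) * (t - b) = 0 <-> t = a \/ t = b.
  split=> [/eqP|[->|->]].
  - by rewrite mulf_eq0 !subr_eq0 => /orP[] /eqP; auto.
  - by rewrite subrr mul0r.
  - by rewrite subrr mulr0.
by rewrite -!G F.
Qed.

End injectivity.

(** * Surjectivity *)

Section surjectivity.
Variable R : realType.
Local Notation C := R[i].
Local Notation cj := (@conjc R).
Implicit Types (x y z u v w e q h k : C) (r s c : R).

(** The factor s is the one that radial projection forgets. *)
Definition attained z1 z2 : Prop := exists u v w s,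
  [/\ nsq u = 1, nsq v = 1, nsq w = 1, nsq (u + v + w) <= 1 &
    [/\ 0 < s, z1 = s%:C%C * (coords u v w).1 & z2 = s%:C%C * (coords u v w).2]].

Let mod z : R := Num.sqrt (nsq z).

Let mod2 z : mod z ^+ 2 = nsq z. Proof. by rewrite sqr_sqrtr// nsq_ge0. Qed.

Let mod_gt0 z : z != 0 -> 0 < mod z. Proof. by move=> z0; rewrite sqrtr_gt0 nsq_gt0. Qed.

Let rc_neq0 r : r != 0 -> r%:C%C != 0 :> C.
Proof. by move=> r0; rewrite (inj_eq (@complexI R) _ 0). Qed.

Let mod2C z : (mod z)%:C%C ^+ 2 = z * cj z.
Proof. by rewrite -rcX mod2 nsqE. Qed.

Let nsq_unit z : z != 0 -> nsq (z / (mod z)%:C%C) = 1.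
Proof.
move=> z0; rewrite nsqM nsqV nsqr mod2 mulfV// gt_eqF//.
by rewrite nsq_gt0.
Qed.

Lemma attained_equilateral z2 : z2 != 0 -> attained 0 z2.
Proof.
move=> z20; have m0 := mod_gt0 z20.
pose e := sqrtc (cj z2 / (mod z2)%:C%C).
have n1 : nsq (cj z2 / (mod z2)%:C%C) = 1 by rewrite nsqM nsqJ -nsqM nsq_unit.
have e1 : nsq e = 1 by exact: nsq_sqrtc.
have q1 : nsq (0 : C) < 1 by rewrite nsq0.
have [u [v [w [u1 v1 w1 Eq Ee]]]] := roots_of_eq e1 q1.
exists u, v, w, (mod z2); split=> //; first by rewrite Eq ltW.
split=> //; rewrite /coords /= Eq Ee /Z1 /Z2; first by rewrite mulr0 mul0r mulr0.
rewrite expr0n mulr0 subr0 sqr_sqrtc cjM conjcK cjV cjr.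
by rewrite mulrCA mulfV ?mulr1// rc_neq0// gt_eqF.
Qed.

(** These are the rays of the sets {x^2, y^2}. The product P of the two points is read off
    from Z1 = - 2 P; the square root p0 of P is the direction of their sum, and
    sg = |z2| / |z1| is the cosine of half the angle between them. *)
Lemma attained_boundary z1 z2 : z1 != 0 -> nsq z2 <= nsq z1 ->
  z1 ^+ 3 * z2 ^+ 2 = - (mod z1 ^+ 3 * mod z2 ^+ 2)%:C%C -> attained z1 z2.
Proof.
move=> z10 le21 WE; have m1 := mod_gt0 z10.
have m1n0 : (mod z1)%:C%C != 0 :> C by rewrite rc_neq0// gt_eqF.
pose P := - (z1 / (mod z1)%:C%C); have P1 : nsq P = 1 by rewrite nsqN nsq_unit.
have [_ _ P0] := nsq1P P1.
pose sg := mod z2 / mod z1.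
have sg0 : 0 <= sg by rewrite divr_ge0// sqrtr_ge0.
have sg1 : sg ^+ 2 <= 1.
  by rewrite /sg expr_div_n !mod2 ler_pdivrMr ?nsq_gt0// mul1r.
have [p0 [p0P p0E]] : exists p0, p0 ^+ 2 = P /\ (mod z2)%:C%C * (P * p0) = cj z2.
  have [z20|z20] := eqVneq z2 0.
    exists (sqrtc P); rewrite sqr_sqrtc; split=> //.
    by rewrite z20 /mod nsq0 sqrtr0 mul0r conjc0.
  have m2n0 : (mod z2)%:C%C != 0 :> C by rewrite rc_neq0// gt_eqF// mod_gt0.
  exists (cj z2 / ((mod z2)%:C%C * P)); split; last by field; rewrite P0 m2n0.
  apply: (mulIf (expf_neq0 2 P0)); apply: (mulIf (expf_neq0 2 m2n0)).
  transitivity (cj z2 ^+ 2); first by field; rewrite m2n0 P0.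
  have z2z2 : z2 ^+ 2 != 0 by rewrite expf_neq0.
  apply: (mulIf z2z2).
  transitivity ((mod z2)%:C%C ^+ 2 * (mod z2)%:C%C ^+ 2); first by rewrite mod2C; ring.
  have := WE; rewrite rcM !rcX => W'.
  transitivity (- (z1 ^+ 3 * z2 ^+ 2) * (mod z2)%:C%C ^+ 2 / (mod z1)%:C%C ^+ 3).
    by rewrite W' opprK; field.
  by rewrite /P; field.
have p01 : nsq p0 = 1.
  have : nsq p0 ^+ 2 = 1 by rewrite -nsqX p0P.
  by move=> /eqP; rewrite sqrf_eq1 => /orP[/eqP//|/eqP H]; have := nsq_ge0 p0; rewrite H; lra.
pose ta := Num.sqrt (1 - sg ^+ 2).
have ta2 : ta ^+ 2 = 1 - sg ^+ 2 by rewrite sqr_sqrtr// subr_ge0.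
have rot1 (b : R) : b ^+ 2 = 1 - sg ^+ 2 -> nsq (sg +i* b)%C = 1.
  by move=> bE; rewrite /nsq /= bE; ring.
pose a := p0 * (sg +i* ta)%C; pose b := p0 * (sg +i* - ta)%C.
have a1 : nsq a = 1 by rewrite nsqM p01 rot1 ?mulr1.
have b1 : nsq b = 1 by rewrite nsqM p01 rot1 ?mulr1// sqrrN.
have ab : a * b = P.
  rewrite /a /b mulrACA -expr2 p0P.
  have -> : ((sg +i* ta) * (sg +i* - ta))%C = 1 :> C.
    by simpc; congr (_ +i* _)%C; [rewrite -!expr2 ta2; ring | ring].
  by rewrite mulr1.
have apb : a + b = (2 * sg)%:C%C * p0.
  rewrite /a /b -mulrDr mulrC; congr (_ * _).
  by simpc; congr (_ +i* _)%C; ring.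
have x1 : nsq (sqrtc a) = 1 by exact: nsq_sqrtc.
have y1 : nsq (sqrtc b) = 1 by exact: nsq_sqrtc.
exists (sqrtc a), (- sqrtc a), (sqrtc b), (mod z1 / 2); split=> //.
- by rewrite nsqN.
- by rewrite subrr add0r y1.
rewrite coords_opposite// !sqr_sqrtc ab apb /=; split; first by rewrite divr_gt0.
- by rewrite /P rcM rcV rcn; field.
apply: (can_inj (@conjcK R)); rewrite [RHS]cjM conjcK cjr -p0E.
by rewrite /sg !rcM !rcV rcn; field.
Qed.

(** The radius given by the intermediate value theorem for the function of
    [ratio_mono], which vanishes at 0 and tends to infinity at 1. If c = -1 the limit
    at 1 is 1, and the factor (1 - r^3)^2 is divided out first. *)
Lemma attained_radius z1 z2 c : z1 != 0 -> z2 != 0 -> -1 <= c ->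
  (-1 < c \/ nsq z1 < nsq z2) ->
  exists r, [/\ 0 < r, r < 1 &
    r ^+ 2 * (1 + r ^+ 2) ^+ 2 * (1 + 2 * c * r ^+ 3 + r ^+ 6) * nsq z2 =
    nsq z1 * (1 - r ^+ 6) ^+ 2].
Proof.
move=> z10 z20 c1 H.
have n1 : 0 < nsq z1 by rewrite nsq_gt0.
have n2 : 0 < nsq z2 by rewrite nsq_gt0.
have inside (p : {poly R}) : p.[0] < 0 -> 0 < p.[1] -> exists r, [/\ 0 < r, r < 1 & p.[r] = 0].
  move=> p0 p1; have [r /andP[r0 r1] /rootP rE] := @poly_ivt _ p 0 1 ler01 (introT andP (conj (ltW p0) (ltW p1))).
  exists r; split=> //; rewrite lt_neqAle ?r0 ?r1 andbT; apply/eqP => E.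
    by rewrite -E in rE; rewrite rE ltxx in p0.
  by rewrite E in rE; rewrite rE ltxx in p1.
have [cN1|cN1] := eqVneq c (-1).
  have {H} lt12 : nsq z1 < nsq z2 by case: H => // H; move: H; rewrite cN1 ltxx.
  have m12 : mod z1 < mod z2 by rewrite ltr_sqrt.
  have m1 := mod_gt0 z10.
  have [||r [r0 r1 rE]] := inside ((mod z2) *: ('X * (1 + 'X ^+ 2)) - (mod z1) *: (1 + 'X ^+ 3)).
  - by rewrite !hornerE /= expr0n /=; lra.
  - by rewrite !hornerE /= !expr1n /=; lra.
  exists r; split=> //; move: rE; rewrite !hornerE /= => rE.
  have E : r * (1 + r ^+ 2) * mod z2 = mod z1 * (1 + r ^+ 3).
    by apply/eqP; rewrite -subr_eq0 -rE; apply/eqP; ring.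
  rewrite -!mod2 cN1.
  transitivity ((r * (1 + r ^+ 2) * mod z2) ^+ 2 * (1 - r ^+ 3) ^+ 2); first by ring.
  by rewrite E; ring.
have cgt : -1 < c by rewrite lt_neqAle eq_sym cN1.
have [||r [r0 r1 rE]] := inside (nsq z2 *: ('X ^+ 2 * (1 + 'X ^+ 2) ^+ 2 *
    (1 + (2 * c) *: 'X ^+ 3 + 'X ^+ 6)) - nsq z1 *: (1 - 'X ^+ 6) ^+ 2).
- by rewrite !hornerE /= !expr0n /=; lra.
- rewrite !hornerE /= !expr1n /=.
  have c2 : 0 < 1 + c by lra.
  by have := mulr_gt0 n2 c2; lra.
exists r; split=> //; move: rE; rewrite !hornerE /= => rE.
by apply/eqP; rewrite -subr_eq0 -rE; apply/eqP; ring.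
Qed.

(** The radius r of q comes from [attained_radius]. The phase om of z1^3 z2^2 then
    determines h = q^3 / e by h (1 - conj h) = k (1 - h) with k = r^3 om; given h,
    the equation for Z2 yields e up to sign, and the one for Z1 yields q. *)
Lemma attained_interior z1 z2 c : z1 != 0 -> z2 != 0 -> -1 <= c <= 1 ->
  complex.Re (z1 ^+ 3 * z2 ^+ 2) = c * (mod z1 ^+ 3 * mod z2 ^+ 2) ->
  (-1 < c \/ nsq z1 < nsq z2) -> attained z1 z2.
Proof.
move=> z10 z20 /andP[c1 c2] cE H.
have [r [r0 r1 rE]] := attained_radius z10 z20 c1 H.
have m1 := mod_gt0 z10; have m2 := mod_gt0 z20.
pose mW := mod z1 ^+ 3 * mod z2 ^+ 2.
have mW0 : 0 < mW by rewrite mulr_gt0// exprn_gt0.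
have mWn0 : mW%:C%C != 0 :> C by rewrite rc_neq0// gt_eqF.
pose om := z1 ^+ 3 * z2 ^+ 2 / mW%:C%C.
have nW : nsq (z1 ^+ 3 * z2 ^+ 2) = mW ^+ 2.
  by rewrite nsqM !nsqX -!mod2 /mW; ring.
have om1 : nsq om = 1 by rewrite nsqM nsqV nsqr nW mulfV// gt_eqF// exprn_gt0.
have Re_scale (b : R) z : complex.Re (b%:C%C * z) = b * complex.Re z.
  by case: z => u v; simpc.
have om_re : complex.Re om = c.
  rewrite /om mulrC -rcV Re_scale cE -/mW mulrC mulfK//; exact: lt0r_neq0.
pose k := (r ^+ 3)%:C%C * om; pose M := r ^+ 6.
have M1 : M < 1 by rewrite exprn_ilt1// ltW.
have kn : nsq k = M by rewrite nsqM nsqr om1 mulr1 -exprM.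
have kre : complex.Re k = r ^+ 3 * c by rewrite Re_scale om_re.
pose B := 1 + 2 * c * r ^+ 3 + r ^+ 6.
have BE : nsq (1 + k) = B.
  by have := nsq_1B (- k); rewrite opprK nsqN kn raddfN /= kre /B => ->; rewrite /M; ring.
have k10 : 1 + k != 0.
  rewrite addrC addr_eq0; apply/eqP => k1; move: kn M1; rewrite k1 nsqN nsq1 => <-.
  by rewrite ltxx.
have B0 : 0 < B by rewrite -BE nsq_gt0.
pose h := (k + M%:C%C) / (1 + k).
have kM : nsq (k + M%:C%C) = M * B.
  have : nsq (k + M%:C%C) = nsq k + 2 * M * complex.Re k + M ^+ 2.
    by case: (k) => u v; rewrite /nsq /=; ring.
  by rewrite kn kre /B => ->; rewrite /M; ring.
have hn : nsq h = M by rewrite nsqM nsqV kM BE mulfK// gt_eqF.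
have hE : 1 - h = (1 - M)%:C%C / (1 + k).
  by rewrite rmorphB /= rmorph1 /h; field.
have Dn : nsq (1 - h) = (1 - M) ^+ 2 / B by rewrite hE nsqM nsqV nsqr BE.
have h0 : 1 - h != 0.
  by rewrite -nsq_gt0 Dn divr_gt0// exprn_gt0// subr_gt0.
pose g := 1 + r ^+ 2; have g0 : 0 < g by rewrite ltr_wpDr// sqr_ge0.
have r1' : r != 0 by rewrite gt_eqF.
have g1' : g != 0 by rewrite gt_eqF.
pose s := mod z1 / (r * g).
have s0 : 0 < s by rewrite divr_gt0// mulr_gt0.
have sn0 : s%:C%C != 0 :> C by rewrite rc_neq0// gt_eqF.
have gn0 : g%:C%C != 0 :> C by rewrite rc_neq0// gt_eqF.
pose e2 := cj z2 / (s%:C%C * (1 - h)).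
have e21 : nsq e2 = 1.
  rewrite nsqM nsqV nsqJ nsqM nsqr Dn /s expr_div_n mod2.
  have n1 : nsq z1 != 0 by rewrite nsq_eq0.
  apply/eqP; rewrite -subr_eq0; apply/eqP.
  transitivity ((r ^+ 2 * g ^+ 2 * B * nsq z2 - nsq z1 * (1 - M) ^+ 2) /
     (nsq z1 * (1 - M) ^+ 2)); last by rewrite rE subrr mul0r.
  have M0 : 1 - M != 0 by rewrite subr_eq0 gt_eqF.
  have B1 : B != 0 by rewrite gt_eqF.
  by field; rewrite n1 M0 B1 r1' g1'.
pose e := sqrtc e2; have e1 : nsq e = 1 by exact: nsq_sqrtc.
have ee : e ^+ 2 = e2 by exact: sqr_sqrtc.
have [_ _ e0] := nsq1P e1.
pose q := z1 / (s%:C%C * g%:C%C * e).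
have qn : nsq q = r ^+ 2.
  rewrite nsqM nsqV nsqM e1 mulr1 nsqM !nsqr -mod2 /s.
  have m1' : mod z1 != 0 by rewrite gt_eqF.
  by field; rewrite g1' m1' r1'.
have q1 : nsq q < 1 by rewrite qn exprn_ilt1// ltW.
have [u [v [w [u1 v1 w1 Eq Ee]]]] := roots_of_eq e1 q1.
exists u, v, w, s; split=> //; first by rewrite Eq ltW.
rewrite /coords /= Eq Ee; split=> //.
  by rewrite /Z1 gainE qn -/g /q; field; rewrite e0 sn0 gn0.
rewrite /Z2; apply: (can_inj (@conjcK R)); rewrite cjM conjcK cjr.
have zz2 : cj z2 = s%:C%C * (e ^+ 2 * (1 - h)) by rewrite ee /e2; field; rewrite sn0 h0.
suff q3 : q ^+ 3 = h * e by rewrite zz2; congr (_ * _); rewrite q3; ring.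
have unit_e2 : e2 * cj e2 = 1 by have [] := nsq1P e21.
have cz2 : cj z2 != 0 by rewrite conjc_eq0.
have h0c : 1 - cj h != 0.
  by rewrite -[1 - cj h](_ : cj (1 - h) = _) ?conjc_eq0// rmorphB rmorph1.
have kh : k * (1 - h) = h * (1 - cj h).
  transitivity (h - (nsq h)%:C%C); last by rewrite nsqE; ring.
  by rewrite hn /h; field.
have rn0 : r%:C%C != 0 :> C by rewrite rc_neq0// gt_eqF.
have mE : (mod z1)%:C%C = s%:C%C * r%:C%C * g%:C%C.
  rewrite -!rcM /s; congr (_%:C%C).
  by field; rewrite g1' r1'.
have sD : s%:C%C ^+ 2 * ((1 - h) * (1 - cj h)) = z2 * cj z2.
  move: unit_e2; rewrite /e2 cjM conjcK cjV cjM cjr.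
  have -> : cj (1 - h) = 1 - cj h by rewrite rmorphB rmorph1.
  move=> E; rewrite -[LHS]mulr1 -[X in _ * X = _]E; field.
  by rewrite sn0 h0 h0c.
have WE : z1 ^+ 3 * z2 ^+ 2 = s%:C%C ^+ 3 * r%:C%C ^+ 3 * g%:C%C ^+ 3 * (z2 * cj z2) * om.
  transitivity (mW%:C%C * om); first by rewrite /om [RHS]mulrC divfK.
  congr (_ * _); rewrite /mW (rcM (mod z1 ^+ 3)) (rcX (mod z1)) (rcX (mod z2)) mE mod2C.
  by ring.
have z2n : z2 ^+ 2 != 0 by rewrite expf_neq0.
apply: (mulIf z2n).
have -> : q ^+ 3 = z1 ^+ 3 / (s%:C%C ^+ 3 * g%:C%C ^+ 3 * (e2 * e)).
  by rewrite /q -ee; field; rewrite e0 sn0 gn0.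
transitivity (r%:C%C ^+ 3 * om * (z2 * cj z2) / (e2 * e)).
  have e20 : e2 != 0 by rewrite -ee expf_neq0.
  transitivity ((z1 ^+ 3 * z2 ^+ 2) / (s%:C%C ^+ 3 * g%:C%C ^+ 3 * (e2 * e))); first by ring.
  by rewrite WE; field; rewrite e0 e20 sn0 gn0.
rewrite -rcX -/k.
have -> : h * e * z2 ^+ 2 = h * (e ^+ 2) * z2 ^+ 2 / e by field.
rewrite ee.
have -> : k = h * (1 - cj h) / (1 - h) by rewrite -kh mulfK.
rewrite /e2; apply/eqP; rewrite -subr_eq0.
set L := (X in X == 0).
have -> : L = h * ((1 - cj h) * (1 - h) * s%:C%C ^+ 2 - z2 * cj z2) * z2 / (e * (s%:C%C * (1 - h))).
  by rewrite /L; field; rewrite sn0 h0 e0 cz2.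
by rewrite [X in X - _](_ : _ = z2 * cj z2) ?subrr ?mulr0 ?mul0r// -sD; ring.
Qed.

Lemma attained_all z1 z2 : ~ (z1 = 0 /\ z2 = 0) -> attained z1 z2.
Proof.
move=> zn0; have [z10|z10] := eqVneq z1 0.
  rewrite z10; apply: attained_equilateral; apply/eqP => z20; exact: zn0.
have m1 := mod_gt0 z10.
have [z20|z20] := eqVneq z2 0.
  apply: attained_boundary => //; first by rewrite z20 nsq0 nsq_ge0.
  by rewrite z20 /mod nsq0 sqrtr0 !expr0n !mulr0 oppr0.
have m2 := mod_gt0 z20.
pose mW := mod z1 ^+ 3 * mod z2 ^+ 2.
have mW0 : 0 < mW by rewrite mulr_gt0// exprn_gt0.
have nW : nsq (z1 ^+ 3 * z2 ^+ 2) = mW ^+ 2.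
  by rewrite nsqM !nsqX -!mod2 /mW; ring.
pose c := complex.Re (z1 ^+ 3 * z2 ^+ 2) / mW.
have cE : complex.Re (z1 ^+ 3 * z2 ^+ 2) = c * mW by rewrite /c divfK// gt_eqF.
have ci : c ^+ 2 * mW ^+ 2 + complex.Im (z1 ^+ 3 * z2 ^+ 2) ^+ 2 = mW ^+ 2.
  by rewrite -exprMn -cE -nW.
have c1 : -1 <= c <= 1.
  have : c ^+ 2 <= 1.
    rewrite -(ler_pM2r (exprn_gt0 2 mW0)) mul1r -[leRHS]ci lerDl; exact: sqr_ge0.
  by move: (c) => d d1; apply/andP; split; nra.
have [lt|] := ltP (nsq z1) (nsq z2); first by apply: (attained_interior z10 z20 c1 cE); right.
move=> le21; have [cN1|cN1] := eqVneq c (-1); last first.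
  apply: (attained_interior z10 z20 c1 cE); left; rewrite lt_neqAle eq_sym cN1.
  by case/andP: c1.
apply: attained_boundary => //; rewrite -/mW; apply/eqP; rewrite eq_complex /= oppr0.
rewrite cE cN1 mulN1r eqxx /= -sqrf_eq0; move: ci; rewrite cN1 sqrrN expr1n mul1r.
by move=> ci'; apply/eqP; move: ci'; move: (complex.Im _) (mW) => a b; lra.
Qed.

End surjectivity.

(** * The homeomorphism *)

(** A continuous map from a compact set onto a Hausdorff space is closed, hence
    a quotient map. *)
Lemma continuous_of_quotient (X Y Z : topologicalType) (K : set X)
    (f : X -> Y) (g : Y -> Z) (h : X -> Z) :
  hausdorff_space X -> hausdorff_space Y -> compact K -> continuous f -> continuous h ->
  f @` K = setT -> (forall x, K x -> g (f x) = h x) -> continuous g.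
Proof.
move=> hX hY cK cf ch fK gf; apply/continuous_closedP => A cA.
have -> : g @^-1` A = f @` (K `&` h @^-1` A).
  apply/seteqP; split=> [y Ay|_ [x [Kx Ax] <-]]; last by rewrite /preimage /= gf.
  have [x Kx xy] : (f @` K) y by rewrite fK.
  by exists x => //; split=> //; rewrite /preimage /= -gf// xy.
apply: compact_closed => //; apply: continuous_compact.
  by apply: continuous_subspaceT => x; exact: cf.
apply: (@subclosed_compact _ _ K) => //.
apply: closedI; first exact: compact_closed.
by move/continuous_closedP : ch; exact.
Qed.

Section cis.
Variable R : realType.
Local Notation C := R[i].
Local Notation cj := (@conjc R).

Lemma cisD (a b : R) : cis (a + b) = cis a * cis b.
Proof. by rewrite /cis cosD sinD; simpc; congr (_ +i* _)%C; ring. Qed.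

Lemma nsq_cis (a : R) : nsq (cis a) = 1.
Proof. by rewrite /nsq /= cos2Dsin2. Qed.

Lemma cis0 : cis 0 = 1 :> C.
Proof. by rewrite /cis cos0 sin0. Qed.

Lemma cisN (a : R) : cis (- a) = cj (cis a).
Proof. by rewrite /cis cosN sinN. Qed.

Lemma cispi : cis pi = -1 :> C.
Proof. by rewrite /cis cospi sinpi; apply/eqP; rewrite eq_complex /= oppr0 !eqxx. Qed.

Lemma cis_onto (z : C) : nsq z = 1 -> exists2 t : R, - pi <= t <= pi & cis t = z.
Proof.
case: z => a b; rewrite /nsq /= => z1.
have a1 : -1 <= a <= 1 by apply/andP; split; nra.
have E : 1 - a ^+ 2 = b ^+ 2 by rewrite -z1; ring.
have g0 := acos_ge0 a1; have gp := acos_lepi a1; have p0 := pi_ge0 R.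
have ca : cos (acos a) = a by rewrite acosK// in_itv.
have sa : sin (acos a) = `|b| by rewrite sin_acos// E sqrtr_sqr.
have [b0|b0] := leP 0 b.
  exists (acos a); first by apply/andP; split; lra.
  by rewrite /cis ca sa ger0_norm.
exists (- acos a); first by apply/andP; split; lra.
by rewrite /cis cosN sinN ca sa ltr0_norm// opprK.
Qed.

Lemma S1_cis_val (t : R) : set_val (S1_cis t) = cis t. Proof. by []. Qed.

Lemma S1_inj (a b : S1 R) : set_val a = set_val b -> a = b.
Proof. exact: val_inj. Qed.

Lemma S1_nsq (a : S1 R) : nsq (set_val a) = 1.
Proof.
by have := S1P a; move=> /(congr1 (fun x => x ^+ 2)); rewrite normc2E expr1n => /complexI.
Qed.

Lemma S1_cis_onto (a : S1 R) : exists t, S1_cis t = a.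
Proof. by have [t _ tE] := cis_onto (S1_nsq a); exists t; exact: S1_inj. Qed.

Lemma S1_cis_continuous : continuous (@S1_cis R).
Proof.
move=> t; apply/continuous_set_type/continuousC; split.
  exact: continuous_cos.
exact: continuous_sin.
Qed.

Lemma S1_hausdorff : hausdorff_space (S1 R).
Proof.
apply: (@hausdorff_inj _ R[i]^o set_val); last exact: norm_hausdorff.
  by move=> x; apply: initial_continuous.
by move=> a b; exact: S1_inj.
Qed.

End cis.

Section exp3.
Variable R : realType.
Local Notation X := (S1 R).

Lemma exp_eq (k : nat) (Y : Type) (L M : exp k Y) : set_val L = set_val M -> L = M.
Proof. exact: val_inj. Qed.

Lemma set_val_span (Y : Type) (k : nat) (x : 'I_k.+1 -> Y) : set_val (span x) = range x.
Proof. by []. Qed.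

Lemma span_onto (L : exp 3 X) : exists x : 'I_3 -> X, span x = L.
Proof.
have [[a La] /pcard_leP[f]] := expP L.
pose x (j : 'I_3) := xget a [set y | set_val L y /\ f y = j].
exists x; apply: exp_eq; rewrite set_val_span; apply/seteqP; split=> [_ [j _ <-]|y Ly].
  by rewrite /x; case: xgetP => [y _ []//|_]; exact: La.
have fy : (f y < 3)%N by exact: (@funS _ _ _ _ f y Ly).
exists (Ordinal fy) => //; rewrite /x; case: xgetP => [y' _ [Ly' fy']|/(_ y)/=].
  by apply: (@inj _ _ _ f); rewrite ?inE.
by move=> /not_andP[].
Qed.

Lemma span_continuous : continuous (@span 2 X : prod_topology (fun _ : 'I_3 => X) -> exp 3 X).
Proof. by apply/continuousP => A; exact. Qed.

End exp3.

Section homeo.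
Variable R : realType.
Local Notation C := R[i].
Local Notation cj := (@conjc R).
Local Notation X := (S1 R).
Implicit Types (p : 'rV[R]_3).

Definition cvec (z : C * C) : 'rV[R]_4 :=
  vec4 (complex.Re z.1) (complex.Im z.1) (complex.Re z.2) (complex.Im z.2).

Lemma S3_vecE (z : S3 R) : S3_vec z = cvec (set_val z).
Proof. by []. Qed.

Lemma cvec_inj : injective cvec.
Proof.
move=> [[a b] [c d]] [[a' b'] [c' d']] E.
have F (j : 'I_4) := congr1 (fun M : 'rV_4 => M ord0 j) E.
by have := (F 0, F 1, F 2, F 3); rewrite !mxE /= => -[[[-> ->] ->] ->].
Qed.

Lemma cvecZ (a : R) (z : C * C) : a *: cvec z = cvec (a%:C%C * z.1, a%:C%C * z.2).
Proof.
case: z => -[u v] [x y]; apply/rowP => j; rewrite !mxE /=.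
by simpc; case: j => -[|[|[|[|]]]].
Qed.

Lemma norm2_cvec (z : C * C) : norm2 (cvec z) = nsq z.1 + nsq z.2.
Proof. by rewrite norm2E !mxE /= /nsq !addrA. Qed.

Lemma cvec_eq0 (z : C * C) : (cvec z == 0) = ((z.1 == 0) && (z.2 == 0)).
Proof.
have c0 : cvec (0, 0) = 0 by apply/rowP => j; rewrite !mxE /=; case: j => -[|[|[|[|]]]].
by rewrite -c0 (inj_eq cvec_inj); case: z.
Qed.

Lemma set_val_S3n (z : C * C) : cvec z != 0 ->
  set_val (S3n (cvec z)) =
  ((Num.sqrt (norm2 (cvec z)))^-1%:C%C * z.1, (Num.sqrt (norm2 (cvec z)))^-1%:C%C * z.2).
Proof. by move=> z0; apply: cvec_inj; rewrite -S3_vecE S3nE// cvecZ. Qed.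

Definition angles p : C * C := coords (cis (p ord0 0)) (cis (p ord0 1)) (cis (p ord0 2)).

(** The parameter p stands for the set of the squares of the cis p_j. [phi] and [squares]
    present the sphere and the space of sets as quotients of one compact set. *)
Definition phi p : S3 R := S3n (cvec (angles p)).

Definition squares p : exp 3 X := span (fun j : 'I_3 => S1_cis (2 * p ord0 j)).

Definition orthocentre p : C := cis (p ord0 0) + cis (p ord0 1) + cis (p ord0 2).

Definition acute p : Prop := nsq (orthocentre p) <= 1.

Lemma angles_neq0 p : cvec (angles p) != 0.
Proof.
rewrite cvec_eq0; apply/negP => /andP[/eqP E1 /eqP E2].
apply: (@coords_neq0 _ (cis (p ord0 0)) (cis (p ord0 1)) (cis (p ord0 2))); try exact: nsq_cis.
by move: E1 E2; rewrite /angles; case: coords => a b /= -> ->.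
Qed.

Lemma squaresP p (z : X) : set_val (squares p) z <->
  in3 (cis (p ord0 0) ^+ 2) (cis (p ord0 1) ^+ 2) (cis (p ord0 2) ^+ 2) (set_val z).
Proof.
have E (j : 'I_3) : set_val (S1_cis (2 * p ord0 j)) = cis (p ord0 j) ^+ 2.
  by rewrite S1_cis_val expr2 -cisD; congr cis; ring.
rewrite set_val_span /in3; split.
  move=> [j _ <-]; rewrite -!E.
  case: j => -[|[|[|]]]// lj; [left|right; left|right; right];
  by congr (set_val (S1_cis (2 * p ord0 _))); exact: val_inj.
by rewrite -!E => -[/S1_inj ->|[/S1_inj ->|/S1_inj ->]]; [exists 0|exists 1|exists 2].
Qed.

Lemma in3_unit (a b c z : C) : nsq a = 1 -> nsq b = 1 -> nsq c = 1 ->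
  in3 a b c z -> exists x : X, set_val x = z.
Proof.
move=> a1 b1 c1 H; have z1 : nsq z = 1 by case: H => [->|[->|->]].
by have [t _ <-] := cis_onto z1; exists (S1_cis t).
Qed.

Lemma squares_eq p p' : squares p = squares p' <->
  forall z, in3 (cis (p ord0 0) ^+ 2) (cis (p ord0 1) ^+ 2) (cis (p ord0 2) ^+ 2) z <->
            in3 (cis (p' ord0 0) ^+ 2) (cis (p' ord0 1) ^+ 2) (cis (p' ord0 2) ^+ 2) z.
Proof.
have n2 (t : R) : nsq (cis t ^+ 2) = 1 by rewrite nsqX nsq_cis expr1n.
split=> [E z|E].
  by split=> H; have [x xz] := in3_unit (n2 _) (n2 _) (n2 _) H; move: H; rewrite -xz;
    rewrite -!squaresP E.
by apply: exp_eq; apply/seteqP; split=> x; rewrite !squaresP E.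
Qed.

Lemma phi_squares p p' : acute p -> acute p' -> (phi p = phi p' <-> squares p = squares p').
Proof.
move=> ap ap'; rewrite squares_eq; split=> [|S].
  move=> /(S3n_eq (angles_neq0 p) (angles_neq0 p'))[s s0]; rewrite cvecZ => /cvec_inj E.
  have E1 := congr1 fst E; have E2 := congr1 snd E.
  by apply: (coords_inj _ _ _ _ _ _ ap ap' s0 E1 E2); exact: nsq_cis.
by rewrite /phi /angles (coords_set _ _ _ _ _ _ ap ap' S)//; exact: nsq_cis.
Qed.

Definition box : set 'rV[R]_3 := 
  [set p : 'rV[R]_3 | forall j : 'I_3, - pi <= p ord0 j <= pi] `&` [set p | acute p].

Lemma row3 (a b c : R) : exists p, [/\ p ord0 0 = a, p ord0 1 = b & p ord0 2 = c].
Proof. by exists (\row_(j < 3) nth 0 [:: a; b; c] j); rewrite !mxE. Qed.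

Lemma box_of_units (u v w : C) : nsq u = 1 -> nsq v = 1 -> nsq w = 1 ->
  nsq (u + v + w) <= 1 -> exists p, [/\ box p, cis (p ord0 0) = u, cis (p ord0 1) = v
    & cis (p ord0 2) = w].
Proof.
move=> u1 v1 w1 q1.
have [a aI aE] := cis_onto u1; have [b bI bE] := cis_onto v1; have [c cI cE] := cis_onto w1.
have [p [p0 p1 p2]] := row3 a b c; exists p; rewrite p0 p1 p2; split=> //.
split; last by rewrite /= /acute /orthocentre p0 p1 p2 aE bE cE.
move=> j; suff : p ord0 j \in [:: a; b; c].
  by rewrite !inE => /orP[/eqP->|/orP[/eqP->|/eqP->]].
have : j \in [:: 0; 1; 2] by case: j => -[|[|[|]]].
by rewrite !inE => /orP[/eqP->|/orP[/eqP->|/eqP->]]; rewrite ?p0 ?p1 ?p2 eqxx ?orbT.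
Qed.

Lemma phi_onto : phi @` box = setT.
Proof.
apply/seteqP; split=> // z _.
have zn0 : ~ ((set_val z).1 = 0 /\ (set_val z).2 = 0).
  move=> [E1 E2]; have := S3_vec_neq0 z; rewrite S3_vecE cvec_eq0 E1 E2 eqxx//.
have [u [v [w [s [u1 v1 w1 q1 [s0 E1 E2]]]]]] := attained_all zn0.
have [p [bp pu pv pw]] := box_of_units u1 v1 w1 q1.
exists p => //; rewrite -[z]S3nK S3_vecE /phi.
have -> : cvec (set_val z) = s *: cvec (angles p).
  by rewrite cvecZ /angles pu pv pw -E1 -E2; case: (set_val z).
by rewrite S3nZ// angles_neq0.
Qed.

(** The numbers |u + v + w|^2 - 1 for the four choices of relative signs have the
    product - |x|^2 with x as below, so that one of them is at most 0. *)
Lemma acute_signs (u v w : C) : nsq u = 1 -> nsq v = 1 -> nsq w = 1 ->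
  exists u' v' w', [/\ u' ^+ 2 = u ^+ 2, v' ^+ 2 = v ^+ 2, w' ^+ 2 = w ^+ 2 &
    nsq (u' + v' + w') <= 1].
Proof.
move=> u1 v1 w1; pose N a b c : R := nsq (a + b + c) - 1.
pose x := (u ^+ 2 - v ^+ 2) * (v ^+ 2 - w ^+ 2) * (w ^+ 2 - u ^+ 2) / (u * v * w) ^+ 2.
have [_ cu u0] := nsq1P u1; have [_ cv v0] := nsq1P v1; have [_ cw w0] := nsq1P w1.
have NE a b c : nsq a = 1 -> nsq b = 1 -> nsq c = 1 ->
    (N a b c)%:C%C = (a + b) * (b + c) * (c + a) / (a * b * c) :> C.
  by move=> a1 b1 c1; rewrite rmorphB /= rmorph1 nsq_e1.
have P : N u v w * N (- u) v w * N u (- v) w * N u v (- w) = - nsq x.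
  apply: complexI; rewrite !rmorphM /= !NE ?nsqN//.
  rewrite rmorphN /= nsqE /x rmorphM fmorphV /= !(rmorphM, rmorphB) /= cu cv cw.
  by field; rewrite u0 v0 w0.
have [n0|n0] := leP (N u v w) 0; first by exists u, v, w; split=> //; move: n0; rewrite subr_le0.
have [n1|n1] := leP (N (- u) v w) 0.
  by exists (- u), v, w; rewrite !sqrrN; split=> //; move: n1; rewrite subr_le0.
have [n2|n2] := leP (N u (- v) w) 0.
  by exists u, (- v), w; rewrite !sqrrN; split=> //; move: n2; rewrite subr_le0.
have [n3|n3] := leP (N u v (- w)) 0.
  by exists u, v, (- w); rewrite !sqrrN; split=> //; move: n3; rewrite subr_le0.
have := mulr_gt0 (mulr_gt0 (mulr_gt0 n0 n1) n2) n3.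
by rewrite P oppr_gt0 ltNge nsq_ge0.
Qed.

Lemma tuple_onto (x : 'I_3 -> X) : exists2 p, box p & forall j, S1_cis (2 * p ord0 j) = x j.
Proof.
have r1 j : nsq (sqrtc (set_val (x j))) = 1 by apply: nsq_sqrtc; exact: S1_nsq.
have [u [v [w [uE vE wE q1]]]] := acute_signs (r1 0) (r1 1) (r1 2).
have unit (a : C) (b : X) : a ^+ 2 = sqrtc (set_val b) ^+ 2 -> nsq (a : C) = 1.
  move=> E; have : nsq a ^+ 2 = 1 by rewrite -nsqX E sqr_sqrtc S1_nsq.
  by move=> /eqP; rewrite sqrf_eq1 => /orP[/eqP//|/eqP H]; have := nsq_ge0 a; rewrite H; lra.
have [p [bp pu pv pw]] := box_of_units (unit _ _ uE) (unit _ _ vE) (unit _ _ wE) q1.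
exists p => // j; apply: S1_inj; rewrite S1_cis_val.
have -> : cis (2 * p ord0 j) = cis (p ord0 j) ^+ 2 by rewrite expr2 -cisD; congr cis; ring.
rewrite !sqr_sqrtc in uE vE wE.
case: j => -[|[|[|]]]// lj; set j := Ordinal lj.
- by have -> : j = 0 by [exact: val_inj]; rewrite pu uE.
- by have -> : j = 1 by [exact: val_inj]; rewrite pv vE.
- by have -> : j = 2 by [exact: val_inj]; rewrite pw wE.
Qed.

Lemma squares_onto (L : exp 3 X) : exists2 p, box p & squares p = L.
Proof.
have [x <-] := span_onto L; have [p bp pE] := tuple_onto x; exists p => //.
by rewrite /squares; congr (span _); apply/funext => j; exact: pE.
Qed.

End homeo.

Section smoothC.
Variables (R : realType) (m : nat) (U : set 'rV[R]_m).
Hypothesis oU : open U.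
Local Notation C := R[i].
Implicit Types (f g : 'rV[R]_m -> C) (a : 'rV[R]_m -> R).

Definition smoothC f := smooths U (fun p => complex.Re (f p)) /\
  smooths U (fun p => complex.Im (f p)).

Lemma smoothC_eq f g : (forall p, f p = g p) -> smoothC f -> smoothC g.
Proof. by move=> /funext ->. Qed.

Lemma smoothC_cst (c : C) : smoothC (fun=> c).
Proof. by split=> k; exact: Cks_cst. Qed.

Lemma smoothCD f g : smoothC f -> smoothC g -> smoothC (fun p => f p + g p).
Proof.
move=> [f1 f2] [g1 g2]; split=> k.
  by apply: Cks_eq (CksD oU (f1 k) (g1 k)) => // p _; rewrite raddfD.
by apply: Cks_eq (CksD oU (f2 k) (g2 k)) => // p _; rewrite raddfD.
Qed.

Lemma smoothCM f g : smoothC f -> smoothC g -> smoothC (fun p => f p * g p).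
Proof.
move=> [f1 f2] [g1 g2]; split=> k.
  have := CksD oU (CksM oU (f1 k) (g1 k)) (CksN oU (CksM oU (f2 k) (g2 k))).
  by apply: Cks_eq => // p _; rewrite ReM.
have := CksD oU (CksM oU (f1 k) (g2 k)) (CksM oU (f2 k) (g1 k)).
by apply: Cks_eq => // p _; rewrite ImM.
Qed.

Lemma smoothCJ f : smoothC f -> smoothC (fun p => conjc (f p)).
Proof.
move=> [f1 f2]; split=> k.
  by apply: (Cks_eq (f := fun p => complex.Re (f p))) => // p _; case: (f p).
apply: (Cks_eq (f := fun p => - complex.Im (f p))) => // [p _|]; first by case: (f p).
exact: CksN oU (f2 k).
Qed.

Lemma smoothCX f n : smoothC f -> smoothC (fun p => f p ^+ n).
Proof.
move=> sf; elim: n => [|n IH]; first exact: smoothC_cst.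
by apply: (smoothC_eq (f := fun p => f p * f p ^+ n)) => [p|]; [rewrite exprS | exact: smoothCM].
Qed.

Lemma smoothC_cis a : smooths U a -> smoothC (fun p => cis (a p)).
Proof. by move=> sa; split=> k; have [] := Cks_cos_sin oU (sa k). Qed.

Lemma smoothC_real a : smooths U a -> smoothC (fun p => (a p)%:C%C).
Proof. by move=> sa; split=> k //; exact: Cks_cst. Qed.

Lemma smooth_cvec (f : 'rV[R]_m -> C * C) :
  smoothC (fun p => (f p).1) -> smoothC (fun p => (f p).2) -> smooth_on U (fun p => cvec (f p)).
Proof. by move=> [f1 f2] [f3 f4]; exact: smooth_vec4. Qed.

Lemma smooth_coords (u v w : 'rV[R]_m -> C) : smoothC u -> smoothC v -> smoothC w ->
  smooth_on U (fun p => cvec (coords (u p) (v p) (w p))).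
Proof.
move=> su sv sw.
have se := smoothCM (smoothCM su sv) sw; have sq := smoothCD (smoothCD su sv) sw.
apply: smooth_cvec; rewrite /coords /Z1 /Z2 /=.
  exact: smoothCM (smoothCM se sq) (smoothCD (smoothC_cst 1) (smoothCM sq (smoothCJ sq))).
apply: smoothCJ; apply: (smoothC_eq (f := fun p => (u p * v p * w p) ^+ 2 +
   (-1) * ((u p * v p * w p) * (u p + v p + w p) ^+ 3))) => [p|].
  by rewrite mulN1r.
exact: smoothCD (smoothCX 2 se) (smoothCM (smoothC_cst _) (smoothCM se (smoothCX 3 sq))).
Qed.

End smoothC.

Section homeo2.
Variable R : realType.
Local Notation C := R[i].
Local Notation X := (S1 R).
Implicit Types (p : 'rV[R]_3).

Lemma smooth_angles : smooth_on setT (fun p => cvec (angles p)).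
Proof.
have oT : open [set: 'rV[R]_3] := openT.
by apply: smooth_coords => //; apply: smoothC_cis => // k; exact: Cks_coord.
Qed.

Lemma phi_continuous : continuous (@phi R).
Proof.
move=> p; apply: (@S3n_continuous _ _ setT (fun p => cvec (angles p))) => //.
- exact: openT.
- by move=> q _; exact: angles_neq0.
- exact: smooth_angles.
Qed.


Definition tuple_cis p : prod_topology (fun _ : 'I_3 => X) := fun j => S1_cis (2 * p ord0 j).

Lemma tuple_continuous : continuous tuple_cis.
Proof.
move=> x; apply/cvg_sup; first exact/fmap_filter/nbhs_filter.
move=> i; move: x; apply/(@continuousP _ (initial_topology (@^~ i))) => A [B oB E].
rewrite -E.
have -> : tuple_cis @^-1` ((fun f : {ptws 'I_3 -> X} => f i) @^-1` B) =
  (fun p => S1_cis (2 * p ord0 i)) @^-1` B by [].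
apply: open_comp => // p _.
have c1 : {for p, continuous (fun p : 'rV[R]_3 => 2 * p ord0 i)}.
  exact: (cvgM (cvg_cst (2 : R)) (@coord_continuous _ _ _ ord0 i p)).
exact: continuous_comp c1 (@S1_cis_continuous R _).
Qed.

Lemma squares_continuous : continuous (@squares R).
Proof.
move=> p; have c1 := @tuple_continuous p.
exact: continuous_comp c1 (@span_continuous R _).
Qed.

Lemma closed_acute : closed (@acute R).
Proof.
have oT : open [set: 'rV[R]_3] := openT.
have c1 j : smoothC setT (fun p : 'rV[R]_3 => cis (p ord0 j)).
  by apply: smoothC_cis => // k; exact: Cks_coord.
have [s1 s2] := smoothCD oT (smoothCD oT (c1 0) (c1 1)) (c1 2).
have cN : continuous (fun p => nsq (orthocentre p)).
  move=> p; have C : Cks 0 setT (fun p => nsq (orthocentre p)).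
    apply: (Cks_eq (f := fun p => complex.Re (orthocentre p) ^+ 2 + complex.Im (orthocentre p) ^+ 2)) => //.
    exact: CksD oT (CksX 2 oT (s1 _)) (CksX 2 oT (s2 _)).
  exact: Cks_continuous C I.
have -> : @acute R = (fun p => nsq (orthocentre p)) @^-1` [set x : R | x <= 1] by [].
by move/continuous_closedP : cN; apply; exact: closed_le.
Qed.

Lemma compact_box : compact (@box R).
Proof.
have cS : compact [set p : 'rV[R]_3 | forall j, - pi <= p ord0 j <= pi].
  have := @rV_compact R 3 (fun=> [set` `[- pi, pi]]) (fun=> @segment_compact R _ _).
  by congr compact; apply/seteqP; split=> p H j; have := H j; rewrite /= in_itv.
apply: (@subclosed_compact _ _ _ _ cS); last by move=> p [].
apply: closedI; last exact: closed_acute.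
by apply: compact_closed cS; exact: norm_hausdorff.
Qed.

(** By [phi_squares] the choice of the parameter is immaterial. *)
Definition exp_to_S3 (L : exp 3 X) : S3 R :=
  phi (xget 0 [set p | box p /\ squares p = L]).

Definition S3_to_exp (z : S3 R) : exp 3 X :=
  squares (xget 0 [set p | box p /\ phi p = z]).

Lemma exp_to_S3E p : acute p -> exp_to_S3 (squares p) = phi p.
Proof.
move=> ap; rewrite /exp_to_S3; case: xgetP => [q _ [[_ aq] /(phi_squares aq ap)]//|].
have [q bq qE] := squares_onto (squares p).
by move=> /(_ q) /not_andP[].
Qed.

Lemma S3_to_expE p : acute p -> S3_to_exp (phi p) = squares p.
Proof.
move=> ap; rewrite /S3_to_exp; case: xgetP => [q _ [[_ aq] /(phi_squares aq ap)]//|].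
have [q bq qE] : (@phi R @` @box R) (phi p) by rewrite phi_onto.
by move=> /(_ q) /not_andP[].
Qed.

Lemma exp_to_S3K : cancel exp_to_S3 S3_to_exp.
Proof.
by move=> L; have [p [_ ap] <-] := squares_onto L; rewrite exp_to_S3E// S3_to_expE.
Qed.

Lemma S3_to_expK : cancel S3_to_exp exp_to_S3.
Proof.
move=> z; have [p [_ ap] <-] : (@phi R @` @box R) z by rewrite phi_onto.
by rewrite S3_to_expE// exp_to_S3E.
Qed.

Lemma exp_to_S3_continuous : continuous exp_to_S3.
Proof.
have c1 : continuous ((fun x => exp_to_S3 (span x)) : prod_topology (fun _ : 'I_3 => X) -> S3 R).
  apply: (@continuous_of_quotient _ _ _ (@box R) tuple_cis _ (@phi R)).
  - exact: norm_hausdorff.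
  - by apply: hausdorff_product => _; exact: S1_hausdorff.
  - exact: compact_box.
  - exact: tuple_continuous.
  - exact: phi_continuous.
  - apply/seteqP; split=> // x _; have [p bp pE] := tuple_onto x.
    by exists p => //; apply/funext.
  - by move=> p [_ ap]; rewrite -exp_to_S3E.
by apply/continuousP => A oA; move/continuousP : c1; exact.
Qed.

Lemma S3_to_exp_continuous : continuous S3_to_exp.
Proof.
apply: (@continuous_of_quotient _ _ _ (@box R) (@phi R) _ (@squares R)).
- exact: norm_hausdorff.
- exact: S3_hausdorff.
- exact: compact_box.
- exact: phi_continuous.
- exact: squares_continuous.
- exact: phi_onto.
- by move=> p [_ ap]; rewrite S3_to_expE.
Qed.

Lemma set_val_S3_act (l : X) (z : S3 R) : set_val (S3_act l z) =
  ((set_val l : C) ^+ 2 * (set_val z).1, (set_val l : C) ^- 3 * (set_val z).2).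
Proof. by []. Qed.

(** Turning the set by l turns the square roots by a square root k of l; this
    multiplies Z1, of weight 4, by k^4 and Z2, of weight -6, by k^-6. *)
Lemma exp_to_S3_act (l : X) (L : exp 3 X) :
  exp_to_S3 (expS1_act l L) = S3_act l (exp_to_S3 L).
Proof.
have [t <-] := S1_cis_onto l; have [p [_ ap] <-] := squares_onto L.
pose h := t / 2; pose k : C := cis h.
have kt : k ^+ 2 = cis t by rewrite expr2 -cisD /h; congr cis; lra.
have k1 : nsq k = 1 by exact: nsq_cis.
have [q [q0 q1 q2]] := row3 (p ord0 0 + h) (p ord0 1 + h) (p ord0 2 + h).
have cq (j : 'I_3) : cis (q ord0 j) = k * cis (p ord0 j).
  have -> : q ord0 j = p ord0 j + h; last by rewrite cisD mulrC.
  by case: j => -[|[|[|]]]// lj; set j := Ordinal lj;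
    [have -> : j = 0 by [exact: val_inj] |have -> : j = 1 by [exact: val_inj]
    | have -> : j = 2 by [exact: val_inj]].
have oq : orthocentre q = k * orthocentre p by rewrite /orthocentre !cq; ring.
clearbody k; have aq : acute q by rewrite /acute oq nsqM k1 mul1r.
have -> : expS1_act (S1_cis t) (squares p) = squares q.
  apply: exp_eq; rewrite set_val_span.
  have -> : (fun j : 'I_3 => S1_cis (2 * q ord0 j)) = S1mul (S1_cis t) \o (fun j : 'I_3 => S1_cis (2 * p ord0 j)).
    apply/funext => j; apply: S1_inj.
    change (cis (2 * q ord0 j) = cis t * cis (2 * p ord0 j)); rewrite -kt.
    have E2 (x : R) : cis (2 * x) = cis x ^+ 2 by rewrite expr2 -cisD; congr cis; ring.
    by rewrite !E2 cq exprMn.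
  by rewrite -image_comp.
rewrite !exp_to_S3E//; apply: S3_vec_inj; rewrite !S3_vecE; congr cvec.
have [kJ kc k0] := nsq1P k1.
have E : angles q = (cis t ^+ 2 * (angles p).1, cis t ^- 3 * (angles p).2).
  have eq1 : cis (q ord0 0) * cis (q ord0 1) * cis (q ord0 2) =
    k ^+ 3 * (cis (p ord0 0) * cis (p ord0 1) * cis (p ord0 2)) by rewrite !cq; ring.
  rewrite -kt /angles /coords eq1 -!/(orthocentre _) oq /=; congr (_, _).
    by rewrite /Z1 rmorphM /= kc; field; exact: k0.
  rewrite /Z2.
  set e := cis _ * _ * _; set x := orthocentre p.
  have -> : (k ^+ 3 * e) ^+ 2 - k ^+ 3 * e * (k * x) ^+ 3 = k ^+ 6 * (e ^+ 2 - e * x ^+ 3) by ring.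
  by rewrite rmorphM rmorphXn /= kc -exprVn; congr (_ * _); rewrite -!exprVn -exprM.
have nE : norm2 (cvec (angles q)) = norm2 (cvec (angles p)).
  have c2 : nsq (cis t ^+ 2 : C) = 1 by rewrite nsqX nsq_cis expr1n.
  have c3 : nsq (cis t ^- 3 : C) = 1 by rewrite nsqV nsqX nsq_cis expr1n invr1.
  by rewrite !norm2_cvec E [nsq (_ ^+ 2 * _)]nsqM c2 [nsq (_ ^- 3 * _)]nsqM c3 !mul1r.
rewrite set_val_S3_act (set_val_S3n (angles_neq0 p)).
apply: etrans (set_val_S3n (angles_neq0 q)) _.
by rewrite nE E; congr (_, _); rewrite mulrCA.
Qed.

End homeo2.

(** * The Jacobian on sets of three points *)

Section complex_derivative.
Variables (R : realType) (m : nat).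
Local Notation C := R[i].
Local Notation cj := (@conjc R).
Implicit Types (f g : 'rV[R]_m -> C) (p v : 'rV[R]_m).

Definition isdC p v f (df : C) :=
  is_derive p v (fun q => complex.Re (f q)) (complex.Re df) /\
  is_derive p v (fun q => complex.Im (f q)) (complex.Im df).

Lemma isdC_cst (c : C) p v : isdC p v (fun=> c) 0.
Proof. by split; exact: isd_cst. Qed.

Lemma isdCD f g p v (df dg : C) : isdC p v f df -> isdC p v g dg ->
  isdC p v (fun q => f q + g q) (df + dg).
Proof.
move=> [f1 f2] [g1 g2]; rewrite /isdC !raddfD; split.
  by rewrite (_ : (fun q => _) = fun q => complex.Re (f q) + complex.Re (g q));
    [exact: isdD f1 g1 | apply/funext => q; rewrite raddfD].
by rewrite (_ : (fun q => _) = fun q => complex.Im (f q) + complex.Im (g q));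
  [exact: isdD f2 g2 | apply/funext => q; rewrite raddfD].
Qed.

Lemma isdCM f g p v (df dg : C) : isdC p v f df -> isdC p v g dg ->
  isdC p v (fun q => f q * g q) (f p * dg + g p * df).
Proof.
move=> [f1 f2] [g1 g2]; rewrite /isdC !raddfD /= !ReM !ImM; split.
  rewrite (_ : (fun q => _) = fun q => complex.Re (f q) * complex.Re (g q) +
      - (complex.Im (f q) * complex.Im (g q))); last by apply/funext => q; rewrite ReM.
  by have := isdD (isdM f1 g1) (isdN (isdM f2 g2)); congr is_derive; ring.
rewrite (_ : (fun q => _) = fun q => complex.Re (f q) * complex.Im (g q) +
    complex.Im (f q) * complex.Re (g q)); last by apply/funext => q; rewrite ImM.
by have := isdD (isdM f1 g2) (isdM f2 g1); congr is_derive; ring.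
Qed.

Lemma isdCJ f p v (df : C) : isdC p v f df -> isdC p v (fun q => cj (f q)) (cj df).
Proof.
move=> [f1 f2]; split.
  have -> : (fun q => complex.Re (cj (f q))) = (fun q => complex.Re (f q)).
    by apply/funext => q; case: (f q).
  by move: f1; congr is_derive; case: df {f2}.
have -> : (fun q => complex.Im (cj (f q))) = (fun q => - complex.Im (f q)).
  by apply/funext => q; case: (f q).
by have := isdN f2; congr is_derive; case: df {f1 f2}.
Qed.

Lemma isdC_cis (a : 'rV[R]_m -> R) p v (da : R) : is_derive p v a da ->
  isdC p v (fun q => cis (a q)) ((0 +i* da)%C * cis (a p)).
Proof.
move=> Da; split.
  by have := isd_cos Da; congr is_derive; rewrite /= mul0r sub0r mulrC mulrN.
by have := isd_sin Da; congr is_derive; rewrite /= mul0r add0r mulrC.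
Qed.

Lemma isdC_real (a : 'rV[R]_m -> R) p v (da : R) : is_derive p v a da ->
  isdC p v (fun q => (a q)%:C%C) da%:C%C.
Proof. by move=> Da; split=> //; exact: isd_cst. Qed.

End complex_derivative.

Section complex_frame.
Variable R : realType.
Local Notation C := R[i].
Local Notation cj := (@conjc R).

Lemma frame_cvec (U : set 'rV[R]_3) (f : 'rV[R]_3 -> C * C) (D1 D2 : 'rV[R]_3 -> C) p :
  open U -> U p -> smooth_on U (fun q => cvec (f q)) ->
  (forall v, isdC p v (fun q => (f q).1) (D1 v)) ->
  (forall v, isdC p v (fun q => (f q).2) (D2 v)) ->
  let e (i : 'I_3) : 'rV[R]_3 := delta_mx ord0 i in
  let z1 i := nth 0 [:: (f p).1; D1 (e 0); D1 (e 1); D1 (e 2)] i in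
  let z2 i := nth 0 [:: (f p).2; D2 (e 0); D2 (e 1); D2 (e 2)] i in
  frame (fun q => cvec (f q)) p =
  \det (\matrix_(i < 4, j < 4) nth 0 [:: complex.Re (z1 i); complex.Im (z1 i);
      complex.Re (z2 i); complex.Im (z2 i)] j).
Proof.
move=> oU Up sf d1 d2 e z1 z2.
rewrite (frame_vec4 oU Up sf (fun v => (d1 v).1) (fun v => (d1 v).2)
  (fun v => (d2 v).1) (fun v => (d2 v).2)) /=.
by congr (\det _); apply/matrixP => i j; rewrite !mxE; case: i => -[|[|[|[|]]]].
Qed.

(** In the basis (z1, z1^*, z2, z2^* ) the real determinant of four vectors of
    C^2 is multiplied by (-2i)^2. *)
Lemma det_complex (z1 z2 : nat -> C) :
  (\det (\matrix_(i < 4, j < 4) nth 0 [:: complex.Re (z1 i); complex.Im (z1 i);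
      complex.Re (z2 i); complex.Im (z2 i)] j) : R)%:C%C * -4 =
  \det (\matrix_(i < 4, j < 4) nth 0 [:: z1 i; cj (z1 i); z2 i; cj (z2 i)] j).
Proof.
rewrite (det4 (fun i j => nth 0 [:: complex.Re (z1 i); complex.Im (z1 i);
      complex.Re (z2 i); complex.Im (z2 i)] j)) /=.
rewrite (det4 (fun i j => nth 0 [:: z1 i; cj (z1 i); z2 i; cj (z2 i)] j)) /=.
have fold (F : nat -> R) : exists a, forall i, F i = a i by exists F.
have [a aE] := fold (fun i => complex.Re (z1 i)).
have [b bE] := fold (fun i => complex.Im (z1 i)).
have [c cE] := fold (fun i => complex.Re (z2 i)).
have [d dE] := fold (fun i => complex.Im (z2 i)).
have z1E i : z1 i = (a i)%:C%C + 'i%C * (b i)%:C%C.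
  by rewrite -aE -bE; case: (z1 i) => x y /=; simpc.
have z1J i : cj (z1 i) = (a i)%:C%C - 'i%C * (b i)%:C%C.
  by rewrite -aE -bE; case: (z1 i) => x y /=; simpc.
have z2E i : z2 i = (c i)%:C%C + 'i%C * (d i)%:C%C.
  by rewrite -cE -dE; case: (z2 i) => x y /=; simpc.
have z2J i : cj (z2 i) = (c i)%:C%C - 'i%C * (d i)%:C%C.
  by rewrite -cE -dE; case: (z2 i) => x y /=; simpc.
rewrite !aE !bE !cE !dE !z1J !z2J !z1E !z2E.
(* In this form the two sides agree as polynomials. *)
have -> : -4 = 4 * 'i%C ^+ 2 :> C by rewrite sqr_i mulrN1.
rewrite !(rmorphD, rmorphN, rmorphM) /=; ring.
Qed.

(** The three derivatives are affine in t and conj t, so the determinant splits off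
    that of the rows (1, t, - conj t). *)
Lemma det_rows (k u u' v v' w w' : C) (z a b c : nat -> C) :
  \det (\matrix_(i < 4, j < 4) nth 0 [:: z j;
      k * (a j + u * b j - u' * c j); k * (a j + v * b j - v' * c j);
      k * (a j + w * b j - w' * c j)] i) =
  k ^+ 3 * (v' * w - v * w' + u * w' - u' * w + u' * v - u * v') *
  \det (\matrix_(i < 4, j < 4) nth 0 [:: z j; a j; b j; c j] i).
Proof.
rewrite (det4 (fun i j => nth 0 [:: z j;
      k * (a j + u * b j - u' * c j); k * (a j + v * b j - v' * c j);
      k * (a j + w * b j - w' * c j)] i)) /=.
rewrite (det4 (fun i j => nth 0 [:: z j; a j; b j; c j] i)) /=.
ring.
Qed.

Lemma det_invariants (e f q r : C) : e * f = 1 ->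
  let N := q * r in let g := 1 + N in
  let z j := nth 0 [:: e * q * g; f * r * g; f ^+ 2 - f * r ^+ 3; e ^+ 2 - e * q ^+ 3] j in
  let a j := nth 0 [:: e * q * g; - (f * r * g); - 2 * f ^+ 2 + f * r ^+ 3;
    2 * e ^+ 2 - e * q ^+ 3] j in
  let b j := nth 0 [:: e * (g + N); f * r ^+ 2; 0; - 3 * e * q ^+ 2] j in
  let c j := nth 0 [:: e * q ^+ 2; f * (g + N); - 3 * f * r ^+ 2; 0] j in
  \det (\matrix_(i < 4, j < 4) nth 0 [:: z j; a j; b j; c j] i) =
  4 + 16 * N + 12 * N ^+ 2 + 8 * N ^+ 3 + 8 * N ^+ 4 +
  6 * (q ^+ 3 * f + r ^+ 3 * e) * (1 + N) ^+ 2.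
Proof.
move=> ef; have e0 : e != 0 by apply: contra_eq_neq ef => ->; rewrite mul0r eq_sym oner_neq0.
have -> : f = e^-1 by rewrite -[RHS]mulr1 -ef mulKf.
move=> N g z a b c; rewrite (det4 (fun i j => nth 0 [:: z j; a j; b j; c j] i)) /= /z /a /b /c /= /g /N.
by field.
Qed.

(** [turn1] and [turn2] are the derivatives of Z1 and Z2, up to the factor i, when the
    vertex t alone turns at unit speed. *)
Definition turn1 (e q t : C) : C :=
  e * q * (1 + q * cj q) + t * (e * (1 + 2 * (q * cj q))) - cj t * (e * q ^+ 2).
Definition turn2 (e q t : C) : C :=
  - 2 * cj e ^+ 2 + cj e * cj q ^+ 3 - cj t * (- 3 * cj e * cj q ^+ 2).

(** The four vectors are combinations of Z and its three derivatives with respect to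
    the argument of e, to q and to conj q, whose determinant is [det_invariants]. *)
Lemma det_turns (k u v w e q : C) : cj k = - k -> nsq e = 1 ->
  let z1 i := nth 0 [:: Z1 e q; k * turn1 e q u; k * turn1 e q v; k * turn1 e q w] i in
  let z2 i := nth 0 [:: Z2 e q; k * turn2 e q u; k * turn2 e q v; k * turn2 e q w] i in
  let N := q * cj q in
  \det (\matrix_(i < 4, j < 4) nth 0 [:: z1 i; cj (z1 i); z2 i; cj (z2 i)] j) =
  k ^+ 3 * (cj v * w - v * cj w + u * cj w - cj u * w + cj u * v - u * cj v) *
  (4 + 16 * N + 12 * N ^+ 2 + 8 * N ^+ 3 + 8 * N ^+ 4 +
  6 * (q ^+ 3 * cj e + cj q ^+ 3 * e) * (1 + N) ^+ 2).
Proof.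
move=> kJ e1 z1 z2 N; have [ef _ _] := nsq1P e1.
rewrite -(det_invariants q (cj q) ef) -det_rows.
have cjE := (@cjM R, @cjD R, @cjN R, @cjX R, @cjn R, @cj1 R, @conjcK R, kJ).
have J1 : cj (Z1 e q) = cj e * cj q * (1 + N) by rewrite /Z1 !cjE /N; ring.
have J2 : Z2 e q = cj e ^+ 2 - cj e * cj q ^+ 3 by rewrite /Z2 !cjE.
have J2' : cj (Z2 e q) = e ^+ 2 - e * q ^+ 3 by rewrite /Z2 conjcK.
have J3 t : cj (k * turn1 e q t) = k * (- (cj e * cj q * (1 + N)) +
    t * (cj e * cj q ^+ 2) - cj t * (cj e * (1 + N + N))).
  by rewrite /turn1 !cjE /N; ring.
have J4 t : cj (k * turn2 e q t) = k * (2 * e ^+ 2 - e * q ^+ 3 + t * (- 3 * e * q ^+ 2) - cj t * 0).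
  by rewrite /turn2 !cjE; ring.
congr (\det _); apply/matrixP => i j; rewrite !mxE /z1 /z2.
case: i => -[|[|[|[|]]]]// hi; case: j => -[|[|[|[|]]]]// hj; rewrite /= ?J1 ?J2' ?J2 ?J3 ?J4 //
  /turn1 /turn2 /N /Z1; ring.
Qed.

End complex_frame.


Section triples.
Variables (R : realType) (s : R).
Hypothesis s1 : s ^+ 2 = 1.
Local Notation C := R[i].
Local Notation cj := (@conjc R).
Implicit Types (p : 'rV[R]_3).

Definition tri_u p : C := cis (s / 2 * p ord0 0).
Definition tri_v p : C := - cis (s / 2 * p ord0 1).
Definition tri_w p : C := cis (s / 2 * p ord0 2).

Definition tri p : C * C := coords (tri_u p) (tri_v p) (tri_w p).

Lemma isdC_tri p x (u v w : 'rV[R]_3 -> C) (k a b c : C) :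
  cj (k * a) = - (k * a) -> cj (k * b) = - (k * b) -> cj (k * c) = - (k * c) ->
  isdC p x u (k * a * u p) -> isdC p x v (k * b * v p) -> isdC p x w (k * c * w p) ->
  let e := u p * v p * w p in let q := u p + v p + w p in
  let f := cj e in let r := cj q in let N := q * r in let g := 1 + N in
  let y := a * u p + b * v p + c * w p in
  let y' := a * cj (u p) + b * cj (v p) + c * cj (w p) in
  isdC p x (fun q => (coords (u q) (v q) (w q)).1)
    (k * ((a + b + c) * (e * q * g) + y * (e * (g + N)) - y' * (e * q ^+ 2))) /\
  isdC p x (fun q => (coords (u q) (v q) (w q)).2)
    (k * ((a + b + c) * (- 2 * f ^+ 2 + f * r ^+ 3) - y' * (- 3 * f * r ^+ 2))).
Proof.
move=> ka kb kc Du Dv Dw e q f r N g y y'.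
have Du' : isdC p x (fun z => cj (u z)) (- (k * a * cj (u p))).
  by have := isdCJ Du; congr isdC; rewrite [in LHS]rmorphM /= ka mulNr.
have Dv' : isdC p x (fun z => cj (v z)) (- (k * b * cj (v p))).
  by have := isdCJ Dv; congr isdC; rewrite [in LHS]rmorphM /= kb mulNr.
have Dw' : isdC p x (fun z => cj (w z)) (- (k * c * cj (w p))).
  by have := isdCJ Dw; congr isdC; rewrite [in LHS]rmorphM /= kc mulNr.
have Dq := isdCD (isdCD Du Dv) Dw; have Dr := isdCD (isdCD Du' Dv') Dw'.
have fE : f = cj (u p) * cj (v p) * cj (w p) by rewrite /f /e !rmorphM.
have rE : r = cj (u p) + cj (v p) + cj (w p) by rewrite /r /q !rmorphD.
split.
  have -> : (fun q => (coords (u q) (v q) (w q)).1) = (fun q => (u q * v q * w q) *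
      (u q + v q + w q) * (1 + (u q + v q + w q) * (cj (u q) + cj (v q) + cj (w q)))).
    by apply/funext => z; rewrite /coords /Z1 /= !rmorphD.
  have := isdCM (isdCM (isdCM (isdCM Du Dv) Dw) Dq) (isdCD (isdC_cst 1 p x) (isdCM Dq Dr)).
  by congr isdC; rewrite /y /y' /g /N rE /e /q; ring.
have -> : (fun q => (coords (u q) (v q) (w q)).2) = (fun q =>
    (cj (u q) * cj (v q) * cj (w q)) * ((cj (u q) * cj (v q) * cj (w q)) +
    (-1) * ((cj (u q) + cj (v q) + cj (w q)) * ((cj (u q) + cj (v q) + cj (w q)) *
    (cj (u q) + cj (v q) + cj (w q)))))).
  have J (E Q : C) : cj (E ^+ 2 - E * Q ^+ 3) = cj E * (cj E + (-1) * (cj Q * (cj Q * cj Q))).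
    have -> : E ^+ 2 - E * Q ^+ 3 = E * (E + (-1) * (Q * (Q * Q))) by ring.
    by rewrite cjM cjD 3!cjM cjN cj1.
  apply/funext => z; rewrite /coords /Z2 /= J.
  by rewrite cjM cjM cjD cjD.
have Df := isdCM (isdCM Du' Dv') Dw'.
have := isdCM Df (isdCD Df (isdCM (isdC_cst (-1) p x) (isdCM Dr (isdCM Dr Dr)))).
by congr isdC; rewrite /y' rE fE; ring.
Qed.


Lemma tri_nsq p : [/\ nsq (tri_u p) = 1, nsq (tri_v p) = 1 & nsq (tri_w p) = 1].
Proof. by rewrite /tri_v nsqN !nsq_cis. Qed.

Lemma smooth_tri : smooth_on setT (fun p => cvec (tri p)).
Proof.
have oT : open [set: 'rV[R]_3] := openT.
have c1 j : smoothC setT (fun p : 'rV[R]_3 => cis (s / 2 * p ord0 j)).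
  apply: smoothC_cis => // k; exact: CksM oT (Cks_cst _ _ _) (Cks_coord _ _ oT).
apply: smooth_coords => //; [exact: c1| |exact: c1].
have := smoothCM oT (smoothC_cst setT (-1)) (c1 1).
by apply: smoothC_eq => p; rewrite mulN1r.
Qed.

Let k : C := (0 +i* (s / 2))%C.

Lemma isdC_edge p x (j : 'I_3) :
  isdC p x (fun q => cis (s / 2 * q ord0 j)) (k * (x ord0 j)%:C%C * cis (s / 2 * p ord0 j)).
Proof.
have Dj : is_derive p x (fun q : 'rV[R]_3 => q ord0 j) (x ord0 j) by exact: is_derive_rVcoord.
have := isdC_cis (isdM (isd_cst (s / 2) p x) Dj).
by congr isdC; congr (_ * _); rewrite /k; simpc.
Qed.

(** Up to sign the imaginary parts add up to twice the area of the triangle u, v, w,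
    and T = 2 Re h with h = q^3 / e. *)
Lemma frame_tri p :
  let u := tri_u p in let v := tri_v p in let w := tri_w p in
  let q := u + v + w in let N := nsq q in
  let T := complex.Re (q ^+ 3 * cj (u * v * w)) *+ 2 in
  frame (fun q => cvec (tri q)) p =
  s / 16 * - (complex.Im (cj v * w) + complex.Im (cj w * u) + complex.Im (cj u * v)) *
  (4 + 16 * N + 12 * N ^+ 2 + 8 * N ^+ 3 + 8 * N ^+ 4 + 6 * T * (1 + N) ^+ 2).
Proof.
move=> u v w q N T.
have oT : open [set: 'rV[R]_3] := openT.
have kx (x : R) : cj (k * x%:C%C) = - (k * x%:C%C).
  by apply/eqP; rewrite eq_complex /=; apply/andP; split; apply/eqP; ring.
have Dv x : isdC p x tri_v (k * (x ord0 1)%:C%C * tri_v p).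
  have := isdCM (isdC_cst (-1) p x) (isdC_edge p x 1).
  have -> : (fun q : 'rV[R]_3 => -1 * cis (s / 2 * q ord0 1)) = tri_v.
    by apply/funext => z; rewrite mulN1r.
  by congr isdC; rewrite /tri_v; ring.
have D x := isdC_tri (kx _) (kx _) (kx _) (isdC_edge p x 0) (Dv x) (isdC_edge p x 2).
have dd (i j : 'I_3) : (delta_mx ord0 i : 'rV[R]_3) ord0 j = (j == i)%:R by rewrite mxE eqxx.
pose e := u * v * w.
have [D1 [D2 [d1 d2 [E10 E11 E12] [E20 E21 E22]]]] : exists D1 D2 : 'rV[R]_3 -> C,
  [/\ forall x, isdC p x (fun q => (tri q).1) (D1 x), forall x, isdC p x (fun q => (tri q).2) (D2 x),
    [/\ D1 (delta_mx ord0 0) = k * turn1 e q u, D1 (delta_mx ord0 1) = k * turn1 e q v &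
       D1 (delta_mx ord0 2) = k * turn1 e q w] &
    [/\ D2 (delta_mx ord0 0) = k * turn2 e q u, D2 (delta_mx ord0 1) = k * turn2 e q v &
       D2 (delta_mx ord0 2) = k * turn2 e q w]].
  eexists; eexists; split; [exact: (fun x => (D x).1)|exact: (fun x => (D x).2)| |];
    split; rewrite !dd -!/(tri_u p) -!/(tri_w p) -!/u -!/v -!/w -!/e -!/q /turn1 /turn2
      ?eqxx; clear; rewrite ?[_ == _ :> 'I_3]/= ?rmorph1 ?rmorph0; ring.
have kJ : cj k = - k by have := kx 1; rewrite rmorph1 mulr1.
have e1 : nsq e = 1 by have [U1 V1 W1] := tri_nsq p; rewrite /e !nsqM U1 V1 W1 !mulr1.
pose z1 i := nth 0 [:: Z1 e q; k * turn1 e q u; k * turn1 e q v; k * turn1 e q w] i.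
pose z2 i := nth 0 [:: Z2 e q; k * turn2 e q u; k * turn2 e q v; k * turn2 e q w] i.
have H := etrans (det_complex z1 z2) (det_turns u v w q kJ e1).
have -> : frame (fun q => cvec (tri q)) p = \det (\matrix_(i < 4, j < 4)
    nth 0 [:: complex.Re (z1 i); complex.Im (z1 i); complex.Re (z2 i); complex.Im (z2 i)] j).
  by rewrite (frame_cvec oT I smooth_tri d1 d2) E10 E11 E12 E20 E21 E22.
apply: complexI; apply: (@mulIf C (-4)); first by rewrite oppr_eq0 pnatr_eq0.
apply: (etrans H).
have NE : q * cj q = N%:C%C by rewrite /N nsqE.
have TE : q ^+ 3 * cj e + cj q ^+ 3 * e = T%:C%C.
  have -> : cj q ^+ 3 * e = cj (q ^+ 3 * cj e).
    by rewrite cjM cjX conjcK.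
  by rewrite /T -/e; case: (q ^+ 3 * cj e) => a b; simpc; rewrite mulr2n.
have VE (x y : C) : cj x * y - x * cj y = 2 * 'i%C * (complex.Im (cj x * y))%:C%C.
  by case: x y => a b [c d]; apply/eqP; rewrite eq_complex /=; apply/andP; split; apply/eqP; ring.
have -> : cj v * w - v * cj w + u * cj w - cj u * w + cj u * v - u * cj v =
  2 * 'i%C * (complex.Im (cj v * w) + complex.Im (cj w * u) + complex.Im (cj u * v))%:C%C.
  transitivity ((cj v * w - v * cj w) + (cj w * u - w * cj u) + (cj u * v - u * cj v)); first by ring.
  by rewrite !VE !rcD; ring.
rewrite TE NE.
set S := complex.Im _ + _ + _.
have -> : (4 + 16 * N%:C%C + 12 * N%:C%C ^+ 2 + 8 * N%:C%C ^+ 3 + 8 * N%:C%C ^+ 4 +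
    6 * T%:C%C * (1 + N%:C%C) ^+ 2) =
  (4 + 16 * N + 12 * N ^+ 2 + 8 * N ^+ 3 + 8 * N ^+ 4 + 6 * T * (1 + N) ^+ 2)%:C%C :> C.
  by rewrite !(@rcD R, @rcM R, @rcX R, @rcn R, @rc1 R).
set P := 4 + 16 * N + 12 * N ^+ 2 + 8 * N ^+ 3 + 8 * N ^+ 4 + 6 * T * (1 + N) ^+ 2.
have kE : k = 'i%C * (s / 2)%:C%C by rewrite /k; simpc.
have s3 : s%:C%C ^+ 2 = 1 :> C by rewrite -rcX s1.
rewrite kE !(@rcM R, @rcN R, @rcV R, @rcn R).
have I2 : 'i%C ^+ 2 = -1 :> C by rewrite sqr_i.
transitivity (('i%C ^+ 2) ^+ 2 * (s%:C%C ^+ 2 * s%:C%C) / 4 * S%:C%C * P%:C%C); first by field.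
by rewrite I2 s3; field.
Qed.


(** With h = a + i b of modulus N^(3/2), 2 a >= - 2 N^(3/2) >= - N (1 + N), and the value of
    the expression for 2 a = - N (1 + N) is a multiple of 1 - N. *)
Lemma jacobian_factor_gt0 (N a b : R) : 0 <= N < 1 -> a ^+ 2 + b ^+ 2 = N ^+ 3 ->
  0 < 4 + 16 * N + 12 * N ^+ 2 + 8 * N ^+ 3 + 8 * N ^+ 4 + 6 * (a *+ 2) * (1 + N) ^+ 2.
Proof.
move=> /andP[N0 N1] ab; rewrite mulr2n.
have aN : - (N * (1 + N)) <= a + a.
  have n0 : 0 <= N * (1 + N) by nra.
  have := sqr_ge0 b; have := sqr_ge0 (N * (1 - N)) => h1 h2.
  have h3 : (a + a) ^+ 2 <= (N * (1 + N)) ^+ 2.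
    have -> : (a + a) ^+ 2 = 4 * (a ^+ 2) by ring.
    have -> : (N * (1 + N)) ^+ 2 = (N * (1 - N)) ^+ 2 + 4 * N ^+ 3 by ring.
    by rewrite -ab; lra.
  have : `|a + a| <= N * (1 + N) by rewrite -(ger0_norm n0) -ler_sqr ?nnegrE ?normr_ge0// !real_normK ?num_real.
  by rewrite ler_norml => /andP[].
have h : 0 <= (a + a + N * (1 + N)) * (1 + N) ^+ 2 by apply: mulr_ge0; [lra | exact: sqr_ge0].
have -> : 4 + 16 * N + 12 * N ^+ 2 + 8 * N ^+ 3 + 8 * N ^+ 4 + 6 * (a + a) * (1 + N) ^+ 2 =
  (1 - N) * (4 + 14 * N + 6 * N ^+ 2 + 2 * (N ^+ 2 * (1 - N))) + 6 * ((a + a + N * (1 + N)) * (1 + N) ^+ 2).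
  by ring.
apply: ltr_wpDr; first by rewrite mulr_ge0.
apply: mulr_gt0; first by lra.
have : 0 <= N ^+ 2 * (1 - N) by apply: mulr_ge0; [exact: sqr_ge0 | lra].
have := sqr_ge0 N; lra.
Qed.

Lemma sin_sign t : sin (s * t) = s * sin t.
Proof.
by move/eqP: s1; rewrite sqrf_eq1 => /orP[]/eqP ->; rewrite ?mul1r// !mulN1r sinN.
Qed.

Lemma cos_sign t : cos (s * t) = cos t.
Proof.
by move/eqP: s1; rewrite sqrf_eq1 => /orP[]/eqP ->; rewrite ?mul1r// mulN1r cosN.
Qed.

Lemma tri_products p : [/\ cj (tri_v p) * tri_w p = - cis (s * ((p ord0 2 - p ord0 1) / 2)),
  cj (tri_w p) * tri_u p = cis (- (s * ((p ord0 2 - p ord0 0) / 2))) &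
  cj (tri_u p) * tri_v p = - cis (s * ((p ord0 1 - p ord0 0) / 2))].
Proof.
split; rewrite /tri_u /tri_v /tri_w ?cjN -cisN ?mulNr ?mulrN -cisD.
- by congr (- cis _); lra.
- by congr cis; lra.
- by congr (- cis _); lra.
Qed.

(** If s = 1, the arcs between the vertices cis p_0/2, cis p_2/2 and - cis p_1/2 are
    (p_2 - p_0)/2, pi - (p_2 - p_1)/2 and pi - (p_1 - p_0)/2, all less than pi, so that
    the triangle is acute; s = -1 gives its mirror image. With the quarters
    x, y of the gaps between the p_j,
    |u + v + w|^2 = 1 - 8 (sin x) (sin y) (cos (x + y)). *)
Lemma tri_norm_lt1 p : cyclic_triples p -> nsq (tri_u p + tri_v p + tri_w p) < 1.
Proof.
move=> [p01 p12 p20].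
have [U1 V1 W1] := tri_nsq p; have [Eb Ec Ea] := tri_products p.
pose x := (p ord0 1 - p ord0 0) / 4; pose y := (p ord0 2 - p ord0 1) / 4.
have x0 : 0 < x by rewrite /x; lra.
have y0 : 0 < y by rewrite /y; lra.
have xy : x + y < pi / 2 by rewrite /x /y; lra.
rewrite (_ : (p ord0 2 - p ord0 1) / 2 = 2 * y) in Eb; last by rewrite /y; lra.
rewrite (_ : (p ord0 2 - p ord0 0) / 2 = 2 * (x + y)) in Ec; last by rewrite /x /y; lra.
rewrite (_ : (p ord0 1 - p ord0 0) / 2 = 2 * x) in Ea; last by rewrite /x; lra.
move: (tri_u p) (tri_v p) (tri_w p) U1 V1 W1 Eb Ec Ea => u v w U1 V1 W1 Eb Ec Ea.
have cE : nsq (u + v + w) = 3 + 2 * (cos (2 * (x + y)) - cos (2 * x) - cos (2 * y)).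
  have : nsq (u + v + w) = 3 + 2 * (complex.Re (cj v * w) + complex.Re (cj w * u) + complex.Re (cj u * v)).
    by move: U1 V1 W1; case: (u) (v) (w) => a b [c d] [a' b']; rewrite /nsq /=; lra.
  by move=> ->; rewrite Eb Ec Ea /= cosN !cos_sign; ring.
have sx : 0 < sin x by apply: sin_gt0_pi; lra.
have sy : 0 < sin y by apply: sin_gt0_pi; lra.
have cxy : 0 < cos (x + y) by apply: cos_gt0_pihalf; apply/andP; split; lra.
suff -> : nsq (u + v + w) = 1 - 8 * (sin x * sin y * cos (x + y)).
  by have := mulr_gt0 (mulr_gt0 sx sy) cxy; lra.
have c2 t : cos (2 * t) = 1 - 2 * sin t ^+ 2.
  by have := cos2Dsin2 t; rewrite (_ : 2 * t = t + t) ?cosD; [lra | ring].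
rewrite cE !c2 cosD sinD.
have := cos2Dsin2 x; have := cos2Dsin2 y.
move: (cos x) (sin x) (cos y) (sin y) => a b c d h1 h2.
have h3 : 1 - c ^+ 2 = d ^+ 2 by lra.
have h4 : 1 - a ^+ 2 = b ^+ 2 by lra.
transitivity (1 - 8 * (b * d * (a * c - b * d)) + 4 * b ^+ 2 * (1 - c ^+ 2) +
  4 * d ^+ 2 * (1 - a ^+ 2) - 8 * b ^+ 2 * d ^+ 2); first by ring.
by rewrite h3 h4; ring.
Qed.

Lemma frame_tri_gt0 p : cyclic_triples p -> 0 < frame (fun q => cvec (tri q)) p.
Proof.
move=> tp; have [p01 p12 p20] := tp; rewrite frame_tri.
have [U1 V1 W1] := tri_nsq p; have [Eb Ec Ea] := tri_products p.
apply: mulr_gt0; last first.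
  set h := (tri_u p + tri_v p + tri_w p) ^+ 3 * cj (tri_u p * tri_v p * tri_w p).
  apply: (jacobian_factor_gt0 (b := complex.Im h)); first by rewrite nsq_ge0/= tri_norm_lt1.
  transitivity (nsq h) => //.
  rewrite /h nsqM nsqX nsqJ [nsq (_ * tri_w p)]nsqM [nsq (_ * tri_v p)]nsqM.
  by rewrite U1 V1 W1 !mulr1.
rewrite Eb Ec Ea /= sinN !sin_sign.
set x := _ / 2; set z := _ / 2; set y := _ / 2.
have S1 : sin x > 0 by apply: sin_gt0_pi; rewrite /x; lra.
have S2 : sin y > 0 by apply: sin_gt0_pi; rewrite /y; lra.
have S3 : sin z > 0 by apply: sin_gt0_pi; rewrite /z; lra.
have -> : s / 16 * - (- (s * sin x) - s * sin z - s * sin y) =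
  s ^+ 2 * (sin x + sin y + sin z) / 16 by field.
by rewrite s1; lra.
Qed.

End triples.

Section on_triples.
Variable R : realType.
Local Notation C := R[i].
Implicit Types (p : 'rV[R]_3).

Lemma open_cyclic_triples : open (@cyclic_triples R).
Proof.
have oT : open [set: 'rV[R]_3] := openT.
have cj j : continuous (fun p : 'rV[R]_3 => p ord0 j) by move=> p; exact: coord_continuous.
have op (f : 'rV[R]_3 -> R) : Cks 0 setT f -> open [set p | 0 < f p].
  move=> [cf _]; have cf' : continuous f by move=> p; exact: cf.
  by move/continuousP : cf' => /(_ _ (@open_gt R 0)).
have Cc j := @Cks_coord R 3 0 setT j oT.
have -> : @cyclic_triples R = [set p | 0 < p ord0 1 + - p ord0 0] `&`
  ([set p | 0 < p ord0 2 + - p ord0 1] `&` [set p | 0 < p ord0 0 + 2 * pi + - p ord0 2]).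
  by apply/seteqP; split=> p /=; rewrite !subr_gt0 => -[] ; [|move=> ? []]; split.
apply: openI; first exact: op (CksD oT (Cc _) (CksN oT (Cc _))).
apply: openI; first exact: op (CksD oT (Cc _) (CksN oT (Cc _))).
exact: op (CksD oT (CksD oT (Cc _) (Cks_cst _ _ _)) (CksN oT (Cc _))).
Qed.

(** The sign of the middle root makes the triple admissible, see [tri_norm_lt1]. *)
Lemma exp_to_S3_triple eps p : cyclic_triples p ->
  exp_to_S3 (triple_param eps p) = S3n (cvec (tri ((-1) ^+ eps) p)).
Proof.
move=> tp; set s : R := (-1) ^+ eps.
have s1 : s ^+ 2 = 1 by rewrite sqrr_sign.
have [q [q0 q1 q2]] := row3 (s / 2 * p ord0 0) (s / 2 * p ord0 1 + pi) (s / 2 * p ord0 2).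
have cq : cis (s / 2 * p ord0 1 + pi) = tri_v s p by rewrite cisD cispi mulrN1.
have aq : acute q by rewrite /acute /orthocentre q0 q1 q2 cq ltW// tri_norm_lt1.
have -> : triple_param eps p = squares q.
  rewrite /triple_param /squares; congr span; apply/funext => j; rewrite /S1_param -/s.
  have c2 (x : R) : cis (2 * x) = cis x ^+ 2 by rewrite expr2 -cisD; congr cis; ring.
  apply: S1_inj; rewrite !S1_cis_val c2.
  have -> : s * p ord0 j = 2 * (s / 2 * p ord0 j) by field.
  rewrite c2; case: j => -[|[|[|]]]// lj; set j := Ordinal lj.
  - by have -> : j = 0 by [exact: val_inj]; rewrite q0.
  - by have -> : j = 1 by [exact: val_inj]; rewrite q1 cq sqrrN.
  - by have -> : j = 2 by [exact: val_inj]; rewrite q2.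
by rewrite exp_to_S3E// /phi /angles q0 q1 q2 cq.
Qed.

End on_triples.

(** * The Seifert fibration of the sphere *)

Section cis_period.
Variable R : realType.
Local Notation C := R[i].

Lemma cis_2pi_nat (n : nat) : cis (2 * pi * n%:R) = 1 :> C.
Proof.
elim: n => [|n IH]; first by rewrite mulr0 cis0.
have -> : 2 * pi * n.+1%:R = 2 * pi * n%:R + (pi + pi) :> R by rewrite -natr1; ring.
by rewrite cisD IH mul1r cisD cispi mulrNN mulr1.
Qed.

Lemma cis_2pi_int (m : int) : cis (2 * pi * m%:~R) = 1 :> C.
Proof.
case: m => n; first exact: cis_2pi_nat.
rewrite NegzE mulrNz mulrN cisN -pmulrn cis_2pi_nat.
exact: rmorph1.
Qed.

(** After subtraction of a multiple of 2 pi the angle lies in [0, 2 pi[, and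
    1 - cos t = 2 (sin (t / 2))^2 is positive inside. *)
Lemma cis_eq1 (t : R) : cis t = 1 -> exists m : int, t = 2 * pi * m%:~R.
Proof.
move=> t1; have p0 := pi_gt0 R.
pose m := Num.floor (t / (2 * pi)); exists m.
have [m1 m2] : 2 * pi * m%:~R <= t /\ t < 2 * pi * m%:~R + 2 * pi.
  have := floor_itv (t / (2 * pi)); rewrite -/m intrD1 ler_pdivlMr ?ltr_pdivrMr ?mulr_gt0//.
  by move=> /andP[]; lra.
pose x := (t - 2 * pi * m%:~R) / 2.
have cx : cos (x + x) = 1.
  have : cis (x + x) = 1 :> C.
    rewrite (_ : x + x = t - 2 * pi * m%:~R); last by rewrite /x; field.
    by rewrite cisD cisN t1 cis_2pi_int mul1r rmorph1.
  by move=> [].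
have [x0|x0] := ltP 0 x; last by move: x0; rewrite /x; lra.
have sx : 0 < sin x by apply: sin_gt0_pi; rewrite x0 /x; lra.
by move: cx; rewrite cosD; have := cos2Dsin2 x; nra.
Qed.

Lemma cis_mod (m : int) (x y : R) : x = y + 2 * pi * m%:~R -> cis x = cis y :> C.
Proof. by move=> ->; rewrite cisD cis_2pi_int mulr1. Qed.

Lemma cis_move (x y : R) (z z' : C) : cis x * z = cis y * z' <-> z' = cis (x - y) * z.
Proof.
have yy : cis y * cis (- y) = 1 :> C by rewrite -cisD subrr cis0.
split=> [E|->]; last by rewrite mulrA -cisD addrC subrK.
by rewrite addrC cisD -mulrA E mulrA [cis (- y) * _]mulrC yy mul1r.
Qed.

End cis_period.

Section torus_algebra.
Variable K : fieldType.

(** The real coordinates of r cis (k t) and (x + i y) cis (m t), where r^2 + x^2 + y^2 = 1,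
    and their derivatives with respect to x, y and t; a, a' and c, c' are the cosines
    and sines of the two angles, and [b] tells which of the two comes first. *)
Definition torus_rows (b : bool) (a a' c c' r x y k m : K) : nat -> nat -> K :=
  let core := [:: [:: a * r; a' * r]; [:: - (a * x / r); - (a' * x / r)];
    [:: - (a * y / r); - (a' * y / r)]; [:: - (k * a' * r); k * a * r]] in
  let disc := [:: [:: c * x - c' * y; c * y + c' * x]; [:: c; c']; [:: - c'; c];
    [:: - (m * (c * y + c' * x)); m * (c * x - c' * y)]] in
  fun i j => nth 0 (if b then nth [::] disc i ++ nth [::] core i
                    else nth [::] core i ++ nth [::] disc i) j.

(** Multiplying by the inverses of the two rotations reduces to the angles 0. *)
Lemma det_torus b a a' c c' r x y k m : r != 0 ->
  \det (\matrix_(i < 4, j < 4) torus_rows b a a' c c' r x y k m i j) =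
  k * (a ^+ 2 + a' ^+ 2) * (c ^+ 2 + c' ^+ 2) * (r ^+ 2 + x ^+ 2 + y ^+ 2).
Proof.
by move=> r0; rewrite (det4 (torus_rows b a a' c c' r x y k m)) /torus_rows; case: b => /=; field.
Qed.

End torus_algebra.

Section torus.
Variables (R : realType) (b : bool).
Local Notation C := R[i].
Implicit Types (p : 'rV[R]_3).

(** The orbit through the centre of the disc is covered once as the last
    coordinate grows by 1: it is traversed twice by l |-> l^2, and three times
    by l |-> l^-3. *)
Definition speed : R := if b then 2 * pi / 3 else pi.

Definition radius p : R := Num.sqrt (1 - (p ord0 0 ^+ 2 + p ord0 1 ^+ 2)).

(** The complement of one of the two circles z_i = 0, fibred over the disc: [b] tells
    whether the central orbit of the torus is z1 = 0 or z2 = 0. *)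
Definition torus_vec p : C * C :=
  (cis (2 * speed * p ord0 2) * (if b then disc_coord p else (radius p)%:C%C),
   cis (- 3 * speed * p ord0 2) * (if b then (radius p)%:C%C else disc_coord p)).

Definition torus p : S3 R := S3n (cvec (torus_vec p)).

Let inside p := 1 - (p ord0 0 ^+ 2 + p ord0 1 ^+ 2).

Lemma inside_gt0 p : open_cylinder p -> 0 < inside p.
Proof. by rewrite /open_cylinder /inside /= => h; lra. Qed.

Lemma nsq_disc p : nsq (disc_coord p) = p ord0 0 ^+ 2 + p ord0 1 ^+ 2.
Proof. by []. Qed.

Lemma nsq_radius p : open_cylinder p -> nsq ((radius p)%:C%C : C) = 1 - nsq (disc_coord p).
Proof. by move=> /inside_gt0/ltW h; rewrite nsqr sqr_sqrtr. Qed.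

Lemma norm_torus_vec p : open_cylinder p -> norm2 (cvec (torus_vec p)) = 1.
Proof.
move=> pU; rewrite norm2_cvec /torus_vec /= !nsqM !nsq_cis !mul1r.
by case: b; rewrite nsq_radius//; ring.
Qed.

Lemma smooth_inside k : Cks k setT inside.
Proof.
have oT : open [set: 'rV[R]_3] := openT.
have Cc j := @Cks_coord R 3 k setT j oT.
apply: (Cks_eq (f := fun p => 1 + - (p ord0 0 ^+ 2 + p ord0 1 ^+ 2))) => //.
exact: CksD oT (Cks_cst _ _ _) (CksN oT (CksD oT (CksX 2 oT (Cc 0)) (CksX 2 oT (Cc 1)))).
Qed.

Lemma open_open_cylinder : open (@open_cylinder R).
Proof.
have [cf _] := smooth_inside 0.
have -> : @open_cylinder R = inside @^-1` [set x | 0 < x].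
  by apply/seteqP; split=> p; rewrite /open_cylinder /inside /= subr_gt0.
have cf' : continuous inside by move=> p; exact: cf.
by move/continuousP : cf' => /(_ _ (@open_gt R 0)).
Qed.

Let oU := open_open_cylinder.

Lemma smooth_torus_vec : smooth_on (@open_cylinder R) (fun p => cvec (torus_vec p)).
Proof.
have Cc j k := @Cks_coord R 3 k (@open_cylinder R) j oU.
have sl c : smoothC (@open_cylinder R) (fun p => cis (c * p ord0 2)).
  by apply: smoothC_cis => // k; exact: CksM oU (Cks_cst _ _ _) (Cc _ _).
have sr : smoothC (@open_cylinder R) (fun p => (radius p)%:C%C).
  apply: smoothC_real => // k; apply: Cks_sqrt => // [p|]; first exact: inside_gt0.
  exact: Cks_sub (smooth_inside k).
have sw : smoothC (@open_cylinder R) (@disc_coord R) by split=> k; exact: Cc.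
by apply: smooth_cvec => //=; apply: smoothCM => //; case: b.
Qed.

Lemma torus_vec_neq0 p : open_cylinder p -> cvec (torus_vec p) != 0.
Proof.
move=> /norm_torus_vec h; apply/eqP => E; move: h; rewrite E norm2E !mxE.
by rewrite expr0n /= !addr0 => /esym/eqP; rewrite oner_eq0.
Qed.

Lemma torus_continuous p : open_cylinder p -> {for p, continuous torus}.
Proof.
exact: (@S3n_continuous _ _ _ (fun p => cvec (torus_vec p)) p oU torus_vec_neq0 smooth_torus_vec).
Qed.

Lemma set_val_torus p : open_cylinder p -> set_val (torus p) = torus_vec p.
Proof.
move=> pU; rewrite /torus set_val_S3n ?torus_vec_neq0// norm_torus_vec// sqrtr1 invr1.
by rewrite rmorph1 !mul1r; case: torus_vec.
Qed.


Lemma speed_neq0 : speed != 0.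
Proof. by rewrite /speed; case: b; rewrite gt_eqF ?divr_gt0 ?mulr_gt0 ?pi_gt0. Qed.

Lemma frame_torus p : open_cylinder p -> frame (fun q => cvec (torus_vec q)) p != 0.
Proof.
move=> pU; have r0 : radius p != 0 by rewrite gt_eqF// sqrtr_gt0 inside_gt0.
have rE : radius p ^+ 2 + p ord0 0 ^+ 2 + p ord0 1 ^+ 2 = 1.
  by rewrite sqr_sqrtr ?ltW ?inside_gt0// /inside; ring.
have Dj x j : is_derive p x (fun q : 'rV[R]_3 => q ord0 j) (x ord0 j) by exact: is_derive_rVcoord.
have Dc c x := isdC_cis (isdM (isd_cst c p x) (Dj x 2)).
have Dr x : isdC p x (fun q => (radius q)%:C%C)
    (- (p ord0 0 * x ord0 0 + p ord0 1 * x ord0 1) / radius p)%:C%C.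
  have := isdC_real (isd_sqrt (inside_gt0 pU) (isdD (isd_cst 1 p x)
    (isdN (isdD (isdM (Dj x 0) (Dj x 0)) (isdM (Dj x 1) (Dj x 1)))))).
  by congr isdC; congr (_%:C%C); rewrite -/(radius p); field.
have Dw x : isdC p x (@disc_coord R) (x ord0 0 +i* x ord0 1)%C by split; exact: Dj.
pose k := if b then - 3 * speed else 2 * speed; pose m := if b then 2 * speed else - 3 * speed.
have k0 : k != 0.
  by rewrite /k; case: b; rewrite mulf_neq0 ?speed_neq0// ?oppr_eq0 pnatr_eq0.
have D1 x : isdC p x (fun q => if b then disc_coord q else (radius q)%:C%C)
    (if b then (x ord0 0 +i* x ord0 1)%C
     else (- (p ord0 0 * x ord0 0 + p ord0 1 * x ord0 1) / radius p)%:C%C) by case: (b).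
have D2 x : isdC p x (fun q => if b then (radius q)%:C%C else disc_coord q)
    (if b then (- (p ord0 0 * x ord0 0 + p ord0 1 * x ord0 1) / radius p)%:C%C
     else (x ord0 0 +i* x ord0 1)%C) by case: (b).
have -> : frame (fun q => cvec (torus_vec q)) p = \det (\matrix_(i < 4, j < 4) torus_rows b
    (cos (k * p ord0 2)) (sin (k * p ord0 2)) (cos (m * p ord0 2)) (sin (m * p ord0 2))
    (radius p) (p ord0 0) (p ord0 1) k m i j).
  rewrite (frame_cvec oU pU smooth_torus_vec
    (fun x => isdCM (Dc (2 * speed) x) (D1 x)) (fun x => isdCM (Dc (- 3 * speed) x) (D2 x))); congr (\det _); apply/matrixP => i j.
  rewrite !mxE /torus_vec /disc_coord /k /m.
  case: i => -[|[|[|[|]]]]// hi; case: j => -[|[|[|[|]]]]// hj;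
    by rewrite /torus_rows; case: (b) => /=; field; rewrite ?r0.
by rewrite det_torus// !cos2Dsin2 rE !mulr1.
Qed.


Lemma radius_gt0 p : open_cylinder p -> 0 < radius p.
Proof. by move=> pU; rewrite sqrtr_gt0 inside_gt0. Qed.

Lemma torus_eq p p' : open_cylinder p -> open_cylinder p' ->
  (torus p = torus p' <-> exists m : int,
    disc_coord p' = cis (2 * pi * m%:~R * (if b then 1 else 3)%N%:R / (if b then 3 else 2)%N%:R)
      * disc_coord p /\ height p' = height p + m%:~R).
Proof.
move=> pU pU'; have r0 := radius_gt0 pU; have r0' := radius_gt0 pU'.
have tE : torus p = torus p' <-> torus_vec p = torus_vec p'.
  split=> [/(congr1 set_val)|E]; first by rewrite !set_val_torus.
  by rewrite /torus E.
have coreP (x y : R) : cis x * (radius p)%:C%C = cis y * (radius p')%:C%C :> C ->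
    radius p = radius p' /\ cis (x - y) = 1 :> C.
  move=> E; have rr : radius p = radius p'.
    have := congr1 (@nsq R) E; rewrite !nsqM !nsq_cis !mul1r !nsqr => /eqP.
    by rewrite eqrXn2 ?ltW// => /eqP.
  split=> //; move/cis_move : E; rewrite -rr => /esym/eqP.
  rewrite -[X in _ == X]mul1r (inj_eq (mulIf _)) => [/eqP//|].
  by rewrite (inj_eq (@complexI R)) gt_eqF.
have rE : nsq (disc_coord p') = nsq (disc_coord p) -> radius p' = radius p.
  by rewrite !nsq_disc /radius => ->.
rewrite tE /torus_vec /speed /height; move: (p ord0 2) (p' ord0 2) => t t'.
case: b; split.
- move=> E; have /cis_move -> := congr1 fst E.
  have /coreP[_ /cis_eq1[m mE]] := congr1 snd E; exists m; split.
    congr (_ * _); apply: (@cis_mod _ (- m)).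
    have tt : t' - t = m%:~R.
      by apply: (@mulfI _ (2 * pi)); [rewrite gt_eqF// mulr_gt0 ?pi_gt0 | rewrite -mE; field].
    by rewrite mulrNz -tt; field.
  suff : t' - t = m%:~R by move=> <-; ring.
  by apply: (@mulfI _ (2 * pi)); [rewrite gt_eqF// mulr_gt0 ?pi_gt0 | rewrite -mE; field].
- move=> [m [wE ->]]; congr (_, _); last first.
    rewrite rE; last by rewrite wE nsqM nsq_cis mul1r.
    by congr (_ * _); apply: (@cis_mod _ m); field.
  by apply/cis_move; rewrite wE; congr (_ * _); apply: (@cis_mod _ m); field.
- move=> E; have /cis_move -> := congr1 snd E.
  have /coreP[_ /cis_eq1[m mE]] := congr1 fst E; exists (- m).
  have tt : t' - t = - m%:~R.
    by apply: (@mulfI _ (2 * pi)); [rewrite gt_eqF// mulr_gt0 ?pi_gt0 | rewrite mulrN -mE; field].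
  rewrite mulrNz -tt; split; last by ring.
  by congr (cis _ * _); field.
- move=> [m [wE ->]]; congr (_, _).
    rewrite rE; last by rewrite wE nsqM nsq_cis mul1r.
    by congr (_ * _); apply: (@cis_mod _ (- m)); rewrite mulrNz; field.
  by apply/cis_move; rewrite wE; congr (cis _ * _); field.
Qed.

Lemma disc_row (w : C) (t : R) : exists p, disc_coord p = w /\ height p = t.
Proof.
have [p [p0 p1 p2]] := row3 (complex.Re w) (complex.Im w) t.
by exists p; rewrite /disc_coord /height p0 p1 p2; case: w {p0 p1}.
Qed.

Lemma torus_image : torus @` @open_cylinder R =
  [set z | (if b then (set_val z).2 else (set_val z).1 : C) != 0].
Proof.
apply/seteqP; split=> [_ [p pU <-]|z] /=.
  have r0 := radius_gt0 pU; rewrite set_val_torus// /torus_vec; case: b => /=;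
  by rewrite -nsq_gt0 nsqM nsq_cis mul1r nsqr exprn_gt0.
have Hz : nsq (set_val z).1 + nsq (set_val z).2 = 1.
  by rewrite -norm2_cvec -S3_vecE norm2_S3_vec.
set c : C := (if b then (set_val z).2 else (set_val z).1).
set o : C := (if b then (set_val z).1 else (set_val z).2) => c0.
have nco : nsq c + nsq o = 1 by rewrite /c /o; case: b => //; rewrite addrC.
have nc0 : 0 < nsq c by rewrite nsq_gt0.
pose r := Num.sqrt (nsq c).
have r0 : 0 < r by rewrite sqrtr_gt0.
have rC : (r%:C%C : C) != 0 by rewrite (inj_eq (@complexI R)) gt_eqF.
have n1 : nsq (c / r%:C%C) = 1 by rewrite nsqM nsqV nsqr sqr_sqrtr ?mulfV ?gt_eqF// ltW.
have [a _ aE] := cis_onto n1.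
pose kc := if b then - 3 * speed else 2 * speed.
pose ko := if b then 2 * speed else - 3 * speed.
have kc0 : kc != 0.
  by rewrite /kc; case: b; rewrite mulf_neq0 ?speed_neq0// ?oppr_eq0 pnatr_eq0.
have [p [pw pt]] := disc_row (cis (- (ko * (a / kc))) * o) (a / kc).
have nw : nsq (disc_coord p) = nsq o by rewrite pw nsqM nsq_cis mul1r.
have pU : open_cylinder p by rewrite /open_cylinder /= -nsq_disc nw; lra.
exists p => //; apply: val_inj; rewrite [LHS]set_val_torus// /torus_vec -/(height p) pt.
have -> : radius p = r by rewrite /radius -nsq_disc nw /r; congr Num.sqrt; lra.
have oE : cis (ko * (a / kc)) * disc_coord p = o by rewrite pw mulrA -cisD subrr cis0 mul1r.
have cE : cis (kc * (a / kc)) * r%:C%C = c.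
  by rewrite [kc * _]mulrC mulfVK// aE mulfVK.
move: oE cE; rewrite /ko /kc /o /c; by case: b => -> ->; exact: esym (surjective_pairing _).
Qed.

Lemma cis_sqr (x : R) : cis x ^+ 2 = cis (2 * x) :> C.
Proof. by rewrite expr2 -cisD; congr cis; ring. Qed.

Lemma cis_cubeV (x : R) : cis x ^- 3 = cis (- 3 * x) :> C.
Proof.
apply: mulr1_eq; rewrite exprS cis_sqr -!cisD (_ : _ + _ = 0) ?cis0//; ring.
Qed.

(** Along the last coordinate [torus] follows the orbits of the action. *)
Lemma torus_act p p' : open_cylinder p -> disc_coord p' = disc_coord p ->
  torus p' = S3_act (S1_cis (speed * (height p' - height p))) (torus p).
Proof.
move=> pU E; have pU' : open_cylinder p' by rewrite /open_cylinder /= -nsq_disc E nsq_disc.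
have rr : radius p' = radius p by rewrite /radius -!nsq_disc E.
apply: val_inj; rewrite [LHS]set_val_torus// [RHS]set_val_S3_act set_val_torus//.
rewrite S1_cis_val cis_sqr cis_cubeV /torus_vec /= E rr !mulrA -!cisD.
by congr (cis _ * _, cis _ * _); rewrite /height; ring.
Qed.

Lemma torus_fibre p : open_cylinder p ->
  torus @` [set p' | disc_coord p' = disc_coord p] = [set S3_act g (torus p) | g in [set: S1 R]].
Proof.
move=> pU; apply/seteqP; split=> [_ [p' E <-]|_ [g _ <-]].
  by exists (S1_cis (speed * (height p' - height p))) => //; rewrite -torus_act.
have [t <-] := S1_cis_onto g.
have [p' [wE tE]] := disc_row (disc_coord p) (height p + t / speed).
exists p' => //; rewrite (torus_act pU wE) tE; congr (S3_act (S1_cis _) _).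
by field; exact: speed_neq0.
Qed.

End torus.

Section sphere_seifert.
Variable R : realType.
Local Notation C := R[i].

Lemma open_coord_neq0 (b : bool) :
  open [set z : S3 R | (if b then (set_val z).2 else (set_val z).1 : C) != 0].
Proof.
have oT : open [set: 'rV[R]_4] := openT.
pose f (x : 'rV[R]_4) : R := if b then x ord0 2 ^+ 2 + x ord0 3 ^+ 2 else x ord0 0 ^+ 2 + x ord0 1 ^+ 2.
have cf : continuous f.
  move=> x; have C : Cks 0 setT f.
    by rewrite /f; case: (b); exact: CksD oT (CksX 2 oT (Cks_coord _ _ oT)) (CksX 2 oT (Cks_coord _ _ oT)).
  exact: Cks_continuous C I.
have cfS : continuous (f \o @S3_vec R).
  by move=> z; apply: continuous_comp; [exact: S3_vec_continuous | exact: cf].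
have -> : [set z : S3 R | (if b then (set_val z).2 else (set_val z).1 : C) != 0] =
    (f \o @S3_vec R) @^-1` [set x | 0 < x].
  by apply/funext => z; apply/propext; rewrite /mkset -nsq_gt0 /preimage /f /= !mxE; case: (b).
by move/continuousP : cfS => /(_ _ (@open_gt R 0)).
Qed.

Lemma torus_fibred (b : bool) : fibred_solid_torus (@S3_atlas R) (orbits (@S3_act R))
  (if b then 3 else 2) (if b then 1 else 3) (torus b).
Proof.
have oU := @open_open_cylinder R; have sv := @smooth_torus_vec R b.
have v0 := @torus_vec_neq0 R b.
split.
- split; first exact: torus_continuous.
  by rewrite torus_image; exact: open_coord_neq0.
- move=> c Ac V.
  have sf : smooth_on (@open_cylinder R) (@S3_vec R \o torus b) := smooth_S3n oU v0 sv.
  split; first exact: chart_smooth Ac oU sf.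
  move=> p [pU pc]; apply: (chart_jac_neq0 Ac oU sf pU pc).
  by rewrite (frame_S3n_neq0 oU v0 sv pU) frame_torus.
- by move=> p p' pU pU'; exact: torus_eq.
- by move=> p pU; exists (torus b p) => //; rewrite torus_fibre.
Qed.

Lemma S3_act_cis0 (z : S3 R) : S3_act (S1_cis 0) z = z.
Proof.
apply: val_inj; rewrite [LHS]set_val_S3_act S1_cis_val cis0 !expr1n invr1 !mul1r.
exact: esym (surjective_pairing _).
Qed.

Lemma S3_act_cisD (a b : R) (z : S3 R) :
  S3_act (S1_cis a) (S3_act (S1_cis b) z) = S3_act (S1_cis (a + b)) z.
Proof.
apply: val_inj; rewrite [LHS]set_val_S3_act [RHS]set_val_S3_act set_val_S3_act !S1_cis_val.
rewrite !cis_sqr !cis_cubeV /= !mulrA -!cisD.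
by congr (cis _ * _, cis _ * _); ring.
Qed.

Lemma S3_orbits_partition : partition (orbits (@S3_act R)) id [set: S3 R].
Proof.
split.
- apply/seteqP; split=> // z _; exists [set S3_act g z | g in [set: S1 R]]; first by exists z.
  by exists (S1_cis 0) => //; exact: S3_act_cis0.
- move=> _ _ [x _ <-] [y _ <-] [z [[g _ gx] [h _ hy]]].
  have [a aE] := S1_cis_onto g; have [b bE] := S1_cis_onto h.
  have xy : S3_act (S1_cis (a - b)) x = y.
    by rewrite addrC -S3_act_cisD aE gx -hy -bE S3_act_cisD addNr S3_act_cis0.
  have yx : S3_act (S1_cis (b - a)) y = x.
    by rewrite -xy S3_act_cisD (_ : _ + _ = 0) ?S3_act_cis0//; ring.
  apply/seteqP; split=> _ [k _ <-]; have [c <-] := S1_cis_onto k.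
    by exists (S1_cis (c + (b - a))) => //; rewrite -S3_act_cisD yx.
  by exists (S1_cis (c + (a - b))) => //; rewrite -S3_act_cisD xy.
- by move=> _ [x _ <-]; exists (S3_act (S1_cis 0) x), (S1_cis 0).
Qed.

Lemma S3_seifert : seifert_fibred (@S3_atlas R) (orbits (@S3_act R)).
Proof.
split; [exact: S3_oriented_manifold | exact: S3_orbits_partition |].
move=> _ [z _ <-].
have [b bz] : exists b : bool, (if b then (set_val z).2 else (set_val z).1 : C) != 0.
  have := S3_vec_neq0 z; rewrite S3_vecE cvec_eq0 negb_and => /orP[h|h].
    by exists false.
  by exists true.
exists (if b then 3 else 2)%N, (if b then 1 else 3)%N, (torus b); split.
- by case: b {bz}.
- by case: b {bz}.
- exact: torus_fibred.
have /(_ z) : [set z : S3 R | (if b then (set_val z).2 else (set_val z).1 : C) != 0] `<=`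
  torus b @` @open_cylinder R by rewrite torus_image.
move=> /(_ bz)[p pU <-].
rewrite -torus_fibre// => _ [p' E <-]; exists p' => //.
by rewrite /open_cylinder /= -nsq_disc E nsq_disc.
Qed.

End sphere_seifert.

(** * Transport along a homeomorphism *)

Section transport.
Variables (R : realType) (n : nat) (M N : topologicalType) (F : M -> N) (G : N -> M).
Hypotheses (cF : continuous F) (cG : continuous G) (FK : cancel F G) (GK : cancel G F).
Implicit Types (c d : chart R n N).

(** With these charts F becomes the identity in coordinates: the local expressions of
    F, of its inverse and of the transition maps are those of the atlas of N. *)
Definition pull_chart c : chart R n M :=
  Chart (F @^-1` chart_dom c) (to_coord c \o F) (G \o of_coord c).

Definition pull_atlas (B : set (chart R n N)) := [set pull_chart c | c in B].

Lemma pull_img c : chart_img (pull_chart c) = chart_img c.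
Proof.
apply/seteqP; split=> _ [x xd <-]; first by exists (F x).
by exists (G x); rewrite /preimage /= GK.
Qed.

Lemma is_chart_pull c : is_chart c -> is_chart (pull_chart c).
Proof.
move=> [od oi K ct co]; split.
- by apply: open_comp od => x _; exact: cF.
- by rewrite pull_img.
- by move=> x xd /=; rewrite K.
- by move=> x xd; apply: continuous_comp; [exact: cF | exact: ct].
- by rewrite pull_img => p pi; apply: continuous_comp; [exact: co | exact: cG].
Qed.

Lemma preimage_homeo (S : set N) : F @^-1` S = G @` S.
Proof.
apply/seteqP; split=> [x Sx|_ [y Sy <-]]; last by rewrite /preimage /= GK.
by exists (F x).
Qed.

Lemma local_dom_pull c d : local_dom (pull_chart c) (pull_chart d) id = local_dom c d id.
Proof. by rewrite /local_dom pull_img /= /preimage; apply/seteqP; split=> p /=; rewrite GK. Qed.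

Lemma local_expr_pull c d : local_expr (pull_chart c) (pull_chart d) id = local_expr c d id.
Proof. by apply/funext => p; rewrite /local_expr /= GK. Qed.

Lemma local_dom_to c d : local_dom (pull_chart c) d F = local_dom c d id.
Proof. by rewrite /local_dom pull_img /=; apply/seteqP; split=> p /=; rewrite GK. Qed.

Lemma local_expr_to c d : local_expr (pull_chart c) d F = local_expr c d id.
Proof. by apply/funext => p; rewrite /local_expr /= GK. Qed.

Lemma local_dom_from c d : local_dom c (pull_chart d) G = local_dom c d id.
Proof. by rewrite /local_dom /= /preimage; apply/seteqP; split=> p /=; rewrite GK. Qed.

Lemma local_expr_from c d : local_expr c (pull_chart d) G = local_expr c d id.
Proof. by apply/funext => p; rewrite /local_expr /= GK. Qed.

Lemma oriented_atlas_pull B : oriented_atlas B -> oriented_atlas (pull_atlas B).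
Proof.
move=> [Bc Bcov Bt]; split.
- by move=> _ [c Bc' <-]; apply: is_chart_pull; exact: Bc.
- by move=> x; have [c Bc' xc] := Bcov (F x); exists (pull_chart c) => //; exists c.
- by move=> _ _ [c c' <-] [d d' <-]; rewrite local_dom_pull local_expr_pull; exact: Bt.
Qed.

Lemma diffeomorphism_pull B : oriented_atlas B -> diffeomorphism (pull_atlas B) B F.
Proof.
move=> [_ _ Bt]; exists G; split=> //; split=> //.
  by move=> _ d [c Bc <-] Bd; rewrite local_dom_to local_expr_to; have [] := Bt _ _ Bc Bd.
by move=> c _ Bc [d Bd <-]; rewrite local_dom_from local_expr_from; have [] := Bt _ _ Bc Bd.
Qed.

Lemma orientation_preserving_pull B : oriented_atlas B -> orientation_preserving (pull_atlas B) B F.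
Proof.
move=> [_ _ Bt] _ d [c Bc <-] Bd; rewrite local_dom_to local_expr_to.
by have [] := Bt _ _ Bc Bd.
Qed.

End transport.

Section transport_seifert.
Variables (R : realType) (M N : topologicalType) (F : M -> N) (G : N -> M).
Hypotheses (cF : continuous F) (cG : continuous G) (FK : cancel F G) (GK : cancel G F).
Variables (B : set (chart R 3 N)) (T : Type) (actM : T -> M -> M) (actN : T -> N -> N).
Hypothesis Fact : forall l x, F (actM l x) = actN l (F x).

Lemma image_FK (S : set M) : G @` (F @` S) = S.
Proof. by rewrite image_comp (_ : G \o F = id) ?image_id//; apply/funext. Qed.

Lemma orbits_push O : orbits actM O -> orbits actN (F @` O).
Proof.
move=> [x _ <-]; exists (F x) => //; rewrite image_comp.
by congr image; apply/funext => l /=; rewrite Fact.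
Qed.

Lemma orbits_pull O : orbits actN O -> orbits actM (G @` O).
Proof.
move=> [y _ <-]; exists (G y) => //; rewrite image_comp.
suff -> : G \o actN^~ y = actM^~ (G y) by [].
by apply/funext => l /=; rewrite -{1}(GK y) -Fact FK.
Qed.

Lemma fibred_pull a b Phi : fibred_solid_torus B (orbits actN) a b Phi ->
  fibred_solid_torus (pull_atlas F G B) (orbits actM) a b (G \o Phi).
Proof.
move=> [[cP oP] jP iP fP]; split.
- split=> [p pU|]; first by apply: continuous_comp; [exact: cP | exact: cG].
  by rewrite -image_comp -(preimage_homeo FK GK); apply: open_comp oP => x _; exact: cF.
- move=> _ [c Bc <-] V; have := jP c Bc.
  have -> : to_coord (pull_chart F G c) \o (G \o Phi) = to_coord c \o Phi.
    by apply/funext => p /=; rewrite GK.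
  suff -> : V = [set p | open_cylinder p /\ chart_dom c (Phi p)] by [].
  by apply/seteqP; split=> p; rewrite /V /= /preimage /= GK.
- move=> p p' pU pU'; rewrite -(iP p p' pU pU'); split=> [/(congr1 F)|/= ->//].
  by rewrite /= !GK.
- by move=> p pU; rewrite -image_comp; apply: orbits_pull; exact: fP.
Qed.

Lemma seifert_pull : hausdorff_space M -> @second_countable M ->
  seifert_fibred B (orbits actN) -> seifert_fibred (pull_atlas F G B) (orbits actM).
Proof.
move=> hM sM [[_ _ oB] [cv tr ne] fB]; split.
- by split=> //; exact: oriented_atlas_pull.
- split.
  + apply/seteqP; split=> // x _.
    have : cover (orbits actN) id (F x) by rewrite cv.
    by move=> [U1 o1 x1]; exists (G @` U1); [exact: orbits_pull | exists (F x)].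
  + move=> U1 U2 o1 o2 [x [x1 x2]]; rewrite -(image_FK U1) -(image_FK U2); congr image.
    by apply: tr; [exact: orbits_push..|]; exists (F x); split; exists x.
  + move=> U1 /orbits_push/ne[_ [x x1 _]]; by exists x.
move=> U1 o1; have [a [b [Phi [a0 ab tP sO]]]] := fB _ (orbits_push o1).
exists a, b, (G \o Phi); split=> //; first exact: fibred_pull.
by rewrite -image_comp -(image_FK U1); exact: image_subset.
Qed.

End transport_seifert.

(** * The oriented Seifert manifold of the sets of at most three points *)

Section exp3_manifold.
Variable R : realType.
Local Notation X := (S1 R).

Definition exp3_atlas : set (chart R 3 (exp 3 X)) :=
  pull_atlas (@exp_to_S3 R) (@S3_to_exp R) (@S3_atlas R).

Lemma exp3_hausdorff : hausdorff_space (exp 3 X).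
Proof.
exact: hausdorff_inj (@exp_to_S3_continuous R) (can_inj (@exp_to_S3K R)) (@S3_hausdorff R).
Qed.

Lemma exp3_second_countable : @second_countable (exp 3 X).
Proof.
apply: (@embedded_second_countable R 4 _ (@S3_vec R \o @exp_to_S3 R) (@S3_to_exp R \o @S3n R)).
- move=> x; apply: continuous_comp; [exact: exp_to_S3_continuous | exact: S3_vec_continuous].
- by move=> x /=; rewrite S3nK exp_to_S3K.
- by move=> x; apply: continuous_comp; [exact: S3n_continuous_at | exact: S3_to_exp_continuous].
Qed.

Lemma exp3_seifert : seifert_fibred exp3_atlas (orbits (@expS1_act R 3)).
Proof.
apply: (seifert_pull (@exp_to_S3_continuous R) (@S3_to_exp_continuous R) (@exp_to_S3K R)
  (@S3_to_expK R) (@exp_to_S3_act R)).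
- exact: exp3_hausdorff.
- exact: exp3_second_countable.
- exact: S3_seifert.
Qed.

(** The charts are those of the sphere composed with the homeomorphism, which on
    sets of three points is the explicit map [tri] followed by radial projection. *)
Lemma exp3_canonical (eps : bool) : canonical_on_triples eps exp3_atlas.
Proof.
move=> _ [c Ac <-] V; have s1 : ((-1) ^+ eps : R) ^+ 2 = 1 by rewrite sqrr_sign.
have oU := @open_cyclic_triples R.
have v0 p : @cyclic_triples R p -> cvec (tri ((-1) ^+ eps) p) != 0.
  move=> _; rewrite cvec_eq0; apply/negP => /andP[/eqP E1 /eqP E2].
  have [u1 v1 w1] := tri_nsq ((-1) ^+ eps) p.
  by apply: (coords_neq0 u1 v1 w1); move: E1 E2; rewrite /tri; case: coords => a b /= -> ->.
have sv : smooth_on (@cyclic_triples R) (fun p => cvec (tri ((-1) ^+ eps) p)).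
  by apply: smooth_on_sub (smooth_tri _) => //; exact: openT.
pose f (p : 'rV[R]_3) : S3 R := S3n (cvec (tri ((-1) ^+ eps) p)).
have sf : smooth_on (@cyclic_triples R) (@S3_vec R \o f) := smooth_S3n oU v0 sv.
have Ff p : cyclic_triples p -> exp_to_S3 (triple_param eps p) = f p := @exp_to_S3_triple R eps p.
have VE : V = @cyclic_triples R `&` [set p | chart_dom c (f p)].
  by apply/seteqP; split=> p [pU pc]; split=> //; move: pc; rewrite /= /preimage /= Ff.
have oV : open V by rewrite VE; exact: chart_pull_open Ac oU (fun p => smooth_S3_continuous sf).
have sV : smooth_on V (to_coord c \o f) by rewrite VE; exact: chart_smooth Ac oU sf.
have gE p : V p -> (to_coord c \o f) p = (to_coord (pull_chart (@exp_to_S3 R) (@S3_to_exp R) c) \o triple_param eps) p.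
  by move=> [pU _] /=; rewrite Ff.
have sg := smooth_on_eq oV gE sV.
split=> // p Vp; have := Vp; rewrite VE => -[pU pc].
rewrite -(jac_near (smooth_on_diff oV sV Vp) (smooth_on_diff oV sg Vp)); last first.
  by apply: filterS gE _; exact: open_nbhs_nbhs.
apply: (chart_jac_pos Ac oU sf pU pc).
by rewrite (frame_S3n_gt0 oU v0 sv pU) frame_tri_gt0.
Qed.

End exp3_manifold.

Theorem theorem3 (R : realType) (eps : bool) :
  exists A : set (chart R 3 (exp 3 (S1 R))),
    [/\ canonical_on_triples eps A,
        seifert_fibred A (orbits (@expS1_act R 3)),
        seifert_fibred (@S3_atlas R) (orbits (@S3_act R)) &
        exists F : exp 3 (S1 R) -> S3 R,
          [/\ diffeomorphism A (@S3_atlas R) F,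
              orientation_preserving A (@S3_atlas R) F &
              forall O, orbits (@expS1_act R 3) O ->
                orbits (@S3_act R) (F @` O)]].
Proof.
have [_ _ oA] := @S3_oriented_manifold R.
exists (@exp3_atlas R); split.
- exact: exp3_canonical.
- exact: exp3_seifert.
- exact: S3_seifert.
exists (@exp_to_S3 R); split.
- exact: (diffeomorphism_pull (@exp_to_S3_continuous R) (@S3_to_exp_continuous R)
    (@exp_to_S3K R) (@S3_to_expK R) oA).
- exact: (orientation_preserving_pull (@S3_to_expK R) oA).
- exact: orbits_push (@exp_to_S3_act R).
Qed.
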